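(* Let $\Omega$ be a nonempty proper open subset of $\mathbb{R}^n$ with the property that $\partial\Omega=\partial(\overline\Omega)$ and such that $(\Omega^c)^\circ$ is an $(\varepsilon,\delta)$-domain with $\operatorname{rad}((\Omega^c)^\circ)>0$. Then for every $k\in\mathbb{N}$ and $p\in(1,\infty)$, $$\widetilde W^{k,p}(\Omega)=\mathring W^{k,p}(\Omega).$$ As a corollary, in the current setting the following properties hold: (a) $\big(\widetilde W^{k,p}(\Omega),\|\cdot\|_{W^{k,p}(\Omega)}\big)$ is a Banach space; (b) the map $\widetilde W^{k,p}(\Omega)\ni u\mapsto\widetilde u\in W^{k,p}(\mathbb{R}^n)$ is isometric; (c) $\widetilde W^{k,p}(\Omega)=\big\{v|_\Omega:\ v\in W^{k,p}(\mathbb{R}^n)\text{ with }\operatorname{supp}v\subseteq\overline\Omega\big\}$.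
   Context: Throughout $n\ge2$. $E^c$, $E^\circ$, $\overline E$ denote complement, interior and closure in $\mathbb{R}^n$. $W^{k,p}(\Omega)$ is the Sobolev space of $u\in L^1_{loc}(\Omega)$ with $\partial^\alpha u\in L^p(\Omega)$, $|\alpha|\le k$, normed by $\|u\|_{W^{k,p}(\Omega)}=\sum_{|\alpha|\le k}\|\partial^\alpha u\|_{L^p(\Omega)}$; $\mathring W^{k,p}(\Omega)$ is the closure of $C^\infty_c(\Omega)$ in it. For a function $u$ on $\Omega$, $\widetilde u$ is its extension by zero to $\mathbb{R}^n$, and $\widetilde W^{k,p}(\Omega):=\{u\in W^{k,p}(\Omega):\widetilde u\in W^{k,p}(\mathbb{R}^n)\}$, equipped with $\|\cdot\|_{W^{k,p}(\Omega)}$. $\operatorname{supp}v$ is the complement of the largest open set on which $v=0$ a.e. $(\varepsilon,\delta)$-domain ($\varepsilon\in(0,\infty)$, $\delta\in(0,\infty]$): a nonempty, open, proper $U\subset\mathbb{R}^n$ such that any $x,y\in U$ with $|x-y|<\delta$ are joined by a rectifiable curve $\gamma:[0,1]\to U$, $\gamma(0)=x$, $\gamma(1)=y$, with $\operatorname{length}(\gamma)\le\frac1\varepsilon|x-y|$ and $\frac{\varepsilon|z-x||z-y|}{|x-y|}\le\operatorname{dist}(z,\partial U)$ for all $z\in\gamma([0,1])$. For open $U$ with connected components $\{U_m\}_m$, $\operatorname{rad}(U):=\inf_m\inf_{x\in U_m}\sup_{y\in U_m}|x-y|$. *)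

(* Defs.v *)
From HB Require Import structures.
From mathcomp Require Import all_boot all_order all_algebra.
From mathcomp Require Import all_classical all_reals all_analysis.

Set Implicit Arguments.
Unset Strict Implicit.
Unset Printing Implicit Defensive.

Import Order.TTheory GRing.Theory Num.Def Num.Theory.
Import numFieldNormedType.Exports.

Local Open Scope classical_set_scope.
Local Open Scope ring_scope.

(* The sigma-algebra on row vectors is the product one, generated by the
   coordinate maps (as the library does for n.-tuple T). On 'rV[R]_n it is the
   Borel sigma-algebra. *)
Definition measure_rV_display : measure_display -> measure_display.
Proof. exact. Qed.

Section measurable_rV.
Context {d} {T : sigmaRingType d}.
Variable n : nat.

Let coors : 'I_n -> 'rV[T]_n -> T := fun i x => x ord0 i.

Let rV_set0 : g_sigma_preimage coors set0.
Proof. exact: sigma_algebra0. Qed.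

Let rV_setC A : g_sigma_preimage coors A -> g_sigma_preimage coors (~` A).
Proof. exact: sigma_algebraC. Qed.

Let rV_bigcup (F : _^nat) : (forall i, g_sigma_preimage coors (F i)) ->
  g_sigma_preimage coors (\bigcup_i (F i)).
Proof. exact: sigma_algebra_bigcup. Qed.

HB.instance Definition _ := @isMeasurable.Build (measure_rV_display d)
  'rV[T]_n (g_sigma_preimage coors) rV_set0 rV_setC rV_bigcup.

End measurable_rV.

Lemma measurable_rV_coord d (T : sigmaRingType d) n (i : 'I_n) :
  measurable_fun [set: 'rV[T]_n] (fun x => x ord0 i).
Proof.
move=> _ Y mY; rewrite setTI; apply: sub_sigma_algebra => /=.
rewrite -bigcup_seq/=; exists i => /=; first by rewrite mem_index_enum.
by exists Y => //; rewrite setTI.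
Qed.

Lemma measurable_fun_rVP d1 d2 (T1 : measurableType d1)
    (T2 : measurableType d2) n (f : T1 -> 'rV[T2]_n) :
  (forall i, measurable_fun [set: T1] (fun x => f x ord0 i)) ->
  measurable_fun [set: T1] f.
Proof.
move=> mf; apply: measurability => //.
move=> _ [B + <-].
rewrite -bigcup_seq/= => -[i _ [C mC <-]].
by rewrite setTI; exact: mf.
Qed.

Section lebesgue_measure_step.
Context {R : realType} (n : nat).

Definition rV_cons (z : measurableTypeR R * 'rV[R]_n) : 'rV[R]_n.+1 :=
  \row_i (if unlift ord0 i is Some j then z.2 ord0 j else z.1).

Definition rV_uncons (x : 'rV[R]_n.+1) : measurableTypeR R * 'rV[R]_n :=
  (x ord0 ord0, \row_j x ord0 (lift ord0 j)).

Lemma rV_consK : cancel rV_cons rV_uncons.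
Proof.
case=> a v; rewrite /rV_uncons /rV_cons !mxE unlift_none; congr pair.
by apply/rowP => j; rewrite !mxE liftK.
Qed.

Lemma measurable_rV_cons : measurable_fun [set: _] rV_cons.
Proof.
apply: measurable_fun_rVP => i; rewrite /rV_cons.
case: (unliftP ord0 i) => [j ->|->].
  rewrite (_ : (fun _ => _) =
      (fun x : 'rV[R]_n => x ord0 j) \o snd); last first.
    by apply/funext => z /=; rewrite mxE liftK.
  exact: measurableT_comp (measurable_rV_coord j) _.
rewrite (_ : (fun _ => _) = fst)//.
by apply/funext => z /=; rewrite mxE unlift_none.
Qed.

Lemma measurable_rV_uncons : measurable_fun [set: _] rV_uncons.
Proof.
apply/measurable_fun_pairP; split; first exact: measurable_rV_coord.
apply: measurable_fun_rVP => i.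
rewrite (_ : (fun _ => _) =
    (fun x : 'rV[R]_n.+1 => x ord0 (lift ord0 i))); last first.
  by apply/funext => z /=; rewrite mxE.
exact: measurable_rV_coord.
Qed.

Variable mu : {sigma_finite_measure set 'rV[R]_n -> \bar R}.

Definition lebesgue_step : set 'rV[R]_n.+1 -> \bar R :=
  pushforward (@lebesgue_measure R \x mu)%E rV_cons.

Let lebesgue_step0 : lebesgue_step set0 = 0%E.
Proof. by apply: measure0; exact: measurable_rV_cons. Qed.

Let lebesgue_step_ge0 A : (0 <= lebesgue_step A)%E.
Proof. by apply: measure_ge0; exact: measurable_rV_cons. Qed.

Let lebesgue_step_sigma_additive : semi_sigma_additive lebesgue_step.
Proof.
by apply: measure_semi_sigma_additive; exact: measurable_rV_cons.
Qed.

HB.instance Definition _ := isMeasure.Build _ _ _ lebesgue_step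
  lebesgue_step0 lebesgue_step_ge0 lebesgue_step_sigma_additive.

Let lebesgue_step_sigma_finite : sigma_finite setT lebesgue_step.
Proof.
have /sigma_finiteP[F [TF ndF Foo]] := sigma_finiteT (@lebesgue_measure R).
have /sigma_finiteP[G [TG ndG Goo]] := sigma_finiteT mu.
exists (fun k => rV_uncons @^-1` (F k `*` G k)).
  rewrite -preimage_bigcup (_ : \bigcup_k _ = setT) ?preimage_setT//.
  rewrite -setXTT TF TG predeqE => -[x y]; split.
    by move=> [k _ []/= ? ?]; split; exists k.
  move=> [/= [k _ Fkx] [l _ Gly]]; exists (maxn k l) => //; split.
  - by move: x Fkx; exact/subsetPset/ndF/leq_maxl.
  - by move: y Gly; exact/subsetPset/ndG/leq_maxr.
move=> k; have [mF Fk] := Foo k; have [mG Gk] := Goo k; split.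
  rewrite -[X in measurable X]setTI.
  by apply: measurable_rV_uncons => //; exact: measurableX.
rewrite /lebesgue_step /pushforward -comp_preimage.
rewrite (_ : rV_uncons \o rV_cons = id); last first.
  by apply/funext => z /=; rewrite rV_consK.
by rewrite preimage_id product_measure1E// lte_mul_pinfty// ge0_fin_numE.
Qed.

HB.instance Definition _ := Measure_isSigmaFinite.Build _ _ _ lebesgue_step
  lebesgue_step_sigma_finite.

End lebesgue_measure_step.

Fixpoint lebesgue_rV (R : realType) (n : nat) :
    {sigma_finite_measure set 'rV[R]_n -> \bar R} :=
  match n with
  | 0 => dirac (0 : 'rV[R]_0)
  | n'.+1 => lebesgue_step (lebesgue_rV R n')
  end.

Lemma measurable_rV_box d (T : measurableType d) n (A : 'I_n -> set T) :
  (forall i, measurable (A i)) ->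
  measurable [set x : 'rV[T]_n | forall i, A i (x ord0 i)].
Proof.
move=> mA.
rewrite (_ : mkset _ = \big[setI/setT]_(i < n)
    ((fun x : 'rV[T]_n => x ord0 i) @^-1` A i)).
  apply: bigsetI_measurable => i _; rewrite -[X in measurable X]setTI.
  exact: measurable_rV_coord.
apply/seteqP; split => x /=.
  by move=> Ax; elim/big_ind : _ => // i _; exact: Ax.
by move=> + i; rewrite (bigD1 i)//= => -[].
Qed.

Lemma open_measurable_rV (R : realType) n (U : set 'rV[R]_n) :
  open U -> measurable U.
Proof.
move=> oU.
pose B (q : 'rV[rat * rat]_n) := [set x : 'rV[R]_n | forall i,
  `](ratr (q ord0 i).1), (ratr (q ord0 i).2)[%classic (x ord0 i)].
rewrite (_ : U = \bigcup_(q in [set q | B q `<=` U]) B q).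
  rewrite bigcup_mkcond; apply: countable_bigcupT_measurable.
    exact: countableP.
  move=> q.
  case: ifPn => // _.
  apply: (@measurable_rV_box _ R n (fun i =>
    [set` `](ratr (q ord0 i).1), (ratr (q ord0 i).2)[%R])) => i.
  exact: measurable_itv.
apply/seteqP; split; last by move=> x [q /= qU /qU].
move=> x Ux.
have /nbhs_ballP[e /= e0 eU] : nbhs x U by exact: open_nbhs_nbhs.
have qx (i : 'I_n) : exists q : rat * rat,
    [/\ x ord0 i - e < ratr q.1, ratr q.1 < x ord0 i,
        x ord0 i < ratr q.2 & ratr q.2 < x ord0 i + e].
  have [q1] := @rat_in_itvoo R (x ord0 i - e) (x ord0 i) ltac:(by rewrite gtrBl).
  have [q2] := @rat_in_itvoo R (x ord0 i) (x ord0 i + e) ltac:(by rewrite ltrDl).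
  rewrite !in_itv/= => /andP[? ?] /andP[? ?].
  by exists (q1, q2).
have [q Hq] := choice qx.
exists (\row_i q i); last by move=> i; rewrite mxE/= in_itv/=; have [_ -> ->] := Hq i.
move=> y qy; apply: eU; split=> [//|i j]; rewrite ord1.
have := qy j; rewrite mxE/= in_itv/= => /andP[y1 y2].
have [x1 _ _ x2] := Hq j.
rewrite /ball/= ltr_distlC; apply/andP; split.
  exact: lt_trans x1 y1.
exact: lt_trans y2 x2.
Qed.

(* This characterizes lebesgue_rV. *)
Lemma lebesgue_rV_box (R : realType) n (A : 'I_n -> set (measurableTypeR R)) :
  (forall i, measurable (A i)) ->
  (lebesgue_rV R n [set x : 'rV[R]_n | forall i, A i (x ord0 i)] =
   \prod_(i < n) lebesgue_measure (A i))%E.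
Proof.
elim: n A => [|n IHn] A mA.
  rewrite big_ord0 /= diracE (_ : _ \in _ = true)//.
  by apply/mem_set => -[].
rewrite big_ord_recl -IHn; last by move=> i; exact: mA.
transitivity ((@lebesgue_measure R \x lebesgue_rV R n)%E
    (A ord0 `*` [set x : 'rV[R]_n | forall i, A (lift ord0 i) (x ord0 i)])).
  congr product_measure1; apply/seteqP; split => -[a v] /=.
    move=> H; split; first by have := H ord0; rewrite mxE unlift_none.
    by move=> i; have := H (lift ord0 i); rewrite mxE liftK.
  move=> [H0 H1] i; rewrite mxE /=.
  by case: (unliftP ord0 i) => [j ->|->].
rewrite product_measure1E//.
by apply: (@measurable_rV_box _ R n (fun i => A (lift ord0 i))) => i; exact: mA.
Qed.

Section euclidean_geometry.
Context {R : realType} {n : nat}.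
Implicit Types (x y z : 'rV[R]_n) (A U : set 'rV[R]_n) (gamma : R -> 'rV[R]_n).

(* The norm `|x| that the library puts on 'rV[R]_n is the sup norm. *)
Definition enorm x : R := sqrtr (\sum_i (x ord0 i) ^+ 2).

Definition boundary A : set 'rV[R]_n := closure A `\` A°.

Definition dist_to x A : \bar R := ereal_inf [set (enorm (x - y))%:E | y in A].

(* Length of gamma restricted to [a, b]: the vector-valued, Euclidean
   counterpart of total_variation. *)
Definition curve_variation (a b : R) gamma (s : seq R) : R :=
  let F := gamma \o nth b (a :: s) in
  \sum_(0 <= i < size s) enorm (F i.+1 - F i).

Definition curve_length (a b : R) gamma : \bar R :=
  ereal_sup [set (curve_variation a b gamma s)%:E | s in itv_partition a b].

(* delta is an extended real, since delta = +oo is allowed. For x = y the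
   quotient is 0 by the convention r / 0 = 0, and a constant curve does. *)
Definition eps_delta_domain (eps : R) (delta : \bar R) U : Prop :=
  [/\ open U, U !=set0, U != setT &
    forall x y, U x -> U y -> ((enorm (x - y))%:E < delta)%E ->
    exists gamma,
      [/\ {within `[0, 1], continuous gamma},
          gamma 0 = x, gamma 1 = y,
          (curve_length 0 1 gamma <= (eps^-1 * enorm (x - y))%:E)%E &
          forall t, t \in `[0, 1] ->
            U (gamma t) /\
            ((eps * enorm (gamma t - x) * enorm (gamma t - y) /
              enorm (x - y))%:E <= dist_to (gamma t) (boundary U))%E]].

Definition connected_components U : set (set 'rV[R]_n) :=
  [set connected_component U x | x in U].

Definition component_radius U : \bar R :=
  ereal_inf [set ereal_inf [set ereal_sup [set (enorm (x - y))%:E | y in C]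
                           | x in C]
            | C in connected_components U].

End euclidean_geometry.

Section sobolev_spaces.
Context {R : realType} {n : nat}.
Implicit Types (u v phi : 'rV[R]_n -> R) (Omega U : set 'rV[R]_n).
Implicit Types (a : 'I_n -> nat) (k : nat) (p : R).

Local Notation mu := (lebesgue_rV R n).

Definition partial (i : 'I_n) phi : 'rV[R]_n -> R :=
  fun x => 'D_(delta_mx ord0 i) phi x.

Definition partials (s : seq 'I_n) phi : 'rV[R]_n -> R := foldr partial phi s.

Definition mi_seq a : seq 'I_n := flatten [seq nseq (a i) i | i <- enum 'I_n].

Definition mi_deg a : nat := \sum_i a i.

Definition smooth phi : Prop :=
  forall s, continuous (partials s phi) /\
    forall i x, derivable (partials s phi) x (delta_mx ord0 i).

(* C_c^oo(Omega), its elements being extended by zero to the whole space. *)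
Definition test_function Omega phi : Prop :=
  [/\ smooth phi, compact (closure [set x | phi x != 0]) &
      closure [set x | phi x != 0] `<=` Omega].

(* A function on Omega is represented by a total function whose values outside
   Omega are irrelevant; its extension by zero is u \_ Omega. Functions are not
   identified when equal a.e., but all the sets of functions below are stable
   under a.e. equality on Omega of (Borel) measurable functions. *)

Definition L1loc Omega u : Prop :=
  measurable_fun Omega u /\
  forall K, compact K -> K `<=` Omega -> mu.-integrable K (EFin \o u).

Definition Lpnorm p Omega u : \bar R := 'N[mu]_p%:E[EFin \o (u \_ Omega)].

Definition Lp p Omega u : Prop := (u \_ Omega) \in Lfun mu p%:E.

Definition is_weak_deriv Omega a u v : Prop :=
  L1loc Omega v /\
  forall phi, test_function Omega phi ->
    \int[mu]_(x in Omega) (u x * partials (mi_seq a) phi x) =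
    (-1) ^+ mi_deg a * \int[mu]_(x in Omega) (v x * phi x).

(* A version of the weak derivative, when one exists. *)
Definition weak_deriv Omega a u : 'rV[R]_n -> R :=
  get (is_weak_deriv Omega a u).

(* Multi-indices of length at most k are taken in the finite type
   {ffun 'I_n -> 'I_k.+1}, so that one can sum over them. *)
Definition mi k (a : {ffun 'I_n -> 'I_k.+1}) : 'I_n -> nat := fun i => a i.

Definition sobolev k p Omega : set ('rV[R]_n -> R) :=
  [set u | L1loc Omega u /\
    forall a : {ffun 'I_n -> 'I_k.+1}, (mi_deg (mi a) <= k)%N ->
      exists2 v, is_weak_deriv Omega (mi a) u v & Lp p Omega v].

Definition sobolev_norm k p Omega u : \bar R :=
  (\sum_(a : {ffun 'I_n -> 'I_k.+1} | (mi_deg (mi a) <= k)%N)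
    Lpnorm p Omega (weak_deriv Omega (mi a) u))%E.

(* The closure of C_c^oo(Omega) in W^{k,p}(Omega). *)
Definition sobolev_circ k p Omega : set ('rV[R]_n -> R) :=
  [set u | sobolev k p Omega u /\
    forall e : R, 0 < e ->
      exists2 phi, test_function Omega phi &
        (sobolev_norm k p Omega (u - phi)%R < e%:E)%E].

Definition sobolev_tilde k p Omega : set ('rV[R]_n -> R) :=
  [set u | sobolev k p Omega u /\ sobolev k p setT (u \_ Omega)].

Definition ess_support v : set 'rV[R]_n :=
  ~` \bigcup_(U in [set U | open U /\ {ae mu, forall x, U x -> v x = 0}]) U.

(* W is a linear space of functions on Omega and, after identification of
   functions that are equal a.e. on Omega, it is a Banach space for the norm
   N: E is the space of classes and cls maps a function to its class. *)
Definition is_banach Omega (W : set ('rV[R]_n -> R))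
    (N : ('rV[R]_n -> R) -> \bar R) : Prop :=
  [/\ W 0, (forall (c : R) u v, W u -> W v -> W (c *: u + v)) &
    exists (E : completeNormedModType R) (cls : ('rV[R]_n -> R) -> E),
      [/\ forall (c : R) u v, W u -> W v -> cls (c *: u + v) = c *: cls u + cls v,
          forall e, exists2 u, W u & cls u = e,
          forall u v, W u -> W v ->
            (cls u = cls v <-> {ae mu, forall x, Omega x -> u x = v x}) &
          forall u, W u -> N u = (`|cls u|)%:E]].

End sobolev_spaces.

(* Main.v *)
(** Write U for the interior of the complement of Omega. The complement of Omega
lies in the closure of U, and the (eps, delta) condition together with the
lower bound on the radius gives a corkscrew condition: every ball of small radius
r centred in U contains a ball of radius comparable to r inside U. Two
consequences are drawn from it. First, a bounded number of translations of size
O(t) carry the t-neighbourhood of U into U, and so, translations being continuous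
in L^1, the boundary of Omega is null. Second, since an L^p function with weak
gradient in L^p moves under a translation by h by at most |h| times its gradient
in L^p norm, a Sobolev function vanishing on U satisfies a Poincaré inequality,
without extension operator: its norm on the t-neighbourhood of U is O(t) times
the norm of its gradient on the O(t)-neighbourhood. Iterating, the derivatives of
order m of a function of tilde W^{k,p} have norm o(t^{k-m}) on the
t-neighbourhood of U, so that it can be cut off there at scale t at a vanishing
cost, cut off at infinity, and mollified. Hence tilde W^{k,p} is contained in the
closure of the test functions. The other statements follow because weak
derivatives pass to L^p limits and because those of an extension by zero vanish
a.e. outside Omega. *)
Require Import Defs.
From HB Require Import structures.
From mathcomp Require Import finmap all_boot all_order all_algebra.
From mathcomp Require Import all_classical all_reals all_analysis.
From mathcomp Require Import measurable_realfun.
From mathcomp Require Import ring lra.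

Set Implicit Arguments.
Unset Strict Implicit.
Unset Printing Implicit Defensive.

Import Order.TTheory GRing.Theory Num.Def Num.Theory.
Import numFieldNormedType.Exports.

Local Open Scope classical_set_scope.
Local Open Scope ring_scope.

(** * Lebesgue measure on row vectors *)

(** The obstacle is the cutoff at scale t: its derivatives of order j are of size t^-j, so Leibniz's
    rule leaves terms t^(m-k) times a derivative of order m of the function, and boundedness alone
    makes none of them small. The smallness comes from order k only: the derivatives of order k
    vanish on the closure of U, so their norm on the t-neighbourhood tends to 0, without any rate,
    by dominated convergence. Each use of the Poincaré inequality then trades one order of
    differentiation for one factor t and enlarges the neighbourhood by a constant factor, harmless
    since at most k uses occur. The predicate [sob] carries exactly these weights, which turns the
    cutoff estimate into an induction. The analysis uses the sup norm; the Euclidean norm of the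
    definition of the domain is compared with it in [component_sphere] and [corkscrew_ball] only.
    Derivatives are indexed by words of directions in the analysis and by multi-indices in the
    statement; the symmetry of the partial derivatives of test functions relates the two. *)

Definition image_measure d d' (T1 : measurableType d) (T2 : measurableType d')
    (R : realType) (m : {measure set T1 -> \bar R}) (f : T1 -> T2)
    (mf : measurable_fun setT f) : {measure set T2 -> \bar R} :=
  measure_function_pushforward__canonical__measure_function_Measure m mf.

Section lebesgue_line.
Context {R : realType}.

(** The pushforward by a translation gives half-open intervals their length, and Lebesgue measure is
    the only measure that does so. *)
Lemma lebesgue_measure_shift (c : R) (A : set (measurableTypeR R)) :
  measurable A -> lebesgue_measure ((fun x => x + c) @^-1` A) = lebesgue_measure A.
Proof.
move=> mA.
have mf : measurable_fun setT (fun x : measurableTypeR R => x + c : measurableTypeR R).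
  exact: measurable_funD.
rewrite -[LHS]/(image_measure (@lebesgue_measure R) mf A).
apply/esym/lebesgue_measure_unique => // _ [[a b]] _ <- /=.
rewrite /image_measure/= /pushforward/=.
rewrite (_ : _ @^-1` _ = `]a - c, b - c]%classic); last first.
  by apply/seteqP; split => x /=; rewrite !in_itv/= ltrBlDr lerBrDr.
rewrite !lebesgue_measure_itv/= !lte_fin ltrD2r; case: ifP => // _.
by rewrite -!EFinD; congr EFin; ring.
Qed.

End lebesgue_line.

Section lebesgue_space.
Context {R : realType} {n : nat}.
Local Notation V := 'rV[R]_n.
Local Notation mu := (lebesgue_rV R n).

Definition box (B : 'I_n -> set (measurableTypeR R)) : set V :=
  [set x | forall i, B i (x ord0 i)].

Definition measurable_boxes : set (set V) :=
  [set A | exists2 B, (forall i, measurable (B i)) & A = box B].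

Lemma measurable_rV_generated :
  (@measurable _ V : set (set V)) = <<s measurable_boxes >>.
Proof.
apply/seteqP; split.
  apply: smallest_sub; first exact: smallest_sigma_algebra.
  move=> A; rewrite -bigcup_seq/= => -[i _ [C mC <-]].
  apply: sub_sigma_algebra.
  exists (fun j => if j == i then C else setT) => [j|]; first by case: ifP.
  apply/seteqP; split => x /=; rewrite ?setTI.
    by move=> Cx j; case: ifPn => // /eqP ->; case: Cx.
  by move=> /(_ i); rewrite eqxx.
apply: smallest_sub; first exact: sigma_algebra_measurable.
by move=> _ [B mB ->]; exact: measurable_rV_box.
Qed.

Lemma measurable_boxesI : setI_closed measurable_boxes.
Proof.
move=> _ _ [B mB ->] [C mC ->]; exists (fun i => B i `&` C i).
  by move=> i; exact: measurableI.
apply/seteqP; split => x /=; first by case=> Bx Cx i.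
by move=> H; split=> i; have [] := H i.
Qed.

Definition cube (r : R) : set V := box (fun=> `[- r, r]%classic).

Lemma cubeP r x : cube r x <-> forall i, `|x ord0 i| <= r.
Proof. by split=> h i; have := h i; rewrite /= in_itv/= ler_norml. Qed.

Lemma measurable_cube r : measurable (cube r).
Proof. by apply: measurable_rV_box => i; exact: measurable_itv. Qed.

Lemma bigcup_cube : \bigcup_k cube k%:R = setT.
Proof.
apply/seteqP; split => // x _.
exists (\max_i (truncn `|x ord0 i|).+1)%N => //; apply/cubeP => i.
apply: (le_trans (ltW (truncnS_gt _))).
rewrite ler_nat.
by apply: (leq_bigmax (F := fun i => (truncn `|x ord0 i|).+1) i).
Qed.

Lemma lebesgue_cube_fin r : mu (cube r) \is a fin_num.
Proof.
rewrite lebesgue_rV_box; last by move=> i; exact: measurable_itv.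
elim/big_ind : _ => // [x y|i _]; first exact: fin_numM.
by rewrite lebesgue_measure_itv; case: ifP.
Qed.

Lemma measurable_addr (h : V) : measurable_fun setT (fun x : V => x + h).
Proof.
apply: measurable_fun_rVP => i.
rewrite (_ : (fun _ => _) = (fun x : V => x ord0 i + h ord0 i)); last first.
  by apply/funext => x; rewrite mxE.
by apply: measurable_funD => //; exact: measurable_rV_coord.
Qed.

Lemma measurable_add2 : measurable_fun setT (fun z : V * V => z.1 + z.2).
Proof.
apply: measurable_fun_rVP => i.
rewrite (_ : (fun _ => _) = (fun z : V * V => z.1 ord0 i + z.2 ord0 i)); last first.
  by apply/funext => x; rewrite mxE.
by apply: measurable_funD;
  [apply: (measurableT_comp (measurable_rV_coord i)) measurable_fst|
   apply: (measurableT_comp (measurable_rV_coord i)) measurable_snd].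
Qed.

(** Both sides are measures that agree on boxes, by the product formula and the one-dimensional
    case; boxes form a pi-system generating the sigma-algebra, and cubes of finite measure exhaust
    the space. *)
Lemma lebesgue_shift (h : V) (A : set V) :
  measurable A -> mu ((fun x => x + h) @^-1` A) = mu A.
Proof.
move=> mA.
rewrite -[LHS]/(image_measure mu (measurable_addr h) A).
have shift_box B : (forall i, measurable (B i)) ->
    image_measure mu (measurable_addr h) (box B) = mu (box B).
  move=> mB; rewrite /image_measure/= /pushforward/=.
  rewrite (_ : _ @^-1` _ = box (fun i => (fun x => x + h ord0 i) @^-1` B i)); last first.
    by apply/seteqP; split => x /= H i; have /= := H i; rewrite mxE.
  rewrite !lebesgue_rV_box//; last first.
    move=> i; rewrite -[X in measurable X]setTI.
    have m : measurable_fun setT (fun x : R => x + h ord0 i) by exact: measurable_funD.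
    by apply: m => //; exact: mB.
  by apply: eq_bigr => i _; exact: lebesgue_measure_shift.
apply: (measure_unique measurable_boxes (fun k => cube k%:R)) => //.
- exact: measurable_rV_generated.
- exact: measurable_boxesI.
- by move=> k; exists (fun=> `[- k%:R, k%:R]%classic) => // i; exact: measurable_itv.
- exact: bigcup_cube.
- by move=> _ [B mB ->]; exact: shift_box.
- move=> k; rewrite shift_box; last by move=> i; exact: measurable_itv.
  by rewrite -ge0_fin_numE//; exact: lebesgue_cube_fin.
Qed.

Lemma ge0_integral_shift (h : V) (f : V -> \bar R) : measurable_fun setT f ->
  (forall x, 0 <= f x)%E -> (\int[mu]_x f (x + h)%R = \int[mu]_x f x)%E.
Proof.
move=> mf f0.
have := @ge0_integral_pushforward _ _ _ _ _ _ (measurable_addr h) mu setT f measurableT mf.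
rewrite preimage_setT => <- //.
apply: eq_measure_integral => [|mh A mA _].
  exact: measurable_addr.
exact: (lebesgue_shift h mA).
Qed.

Lemma integrable_shift (h : V) (f : V -> R) : mu.-integrable setT (EFin \o f) ->
  mu.-integrable setT (EFin \o (fun x => f (x + h))).
Proof.
case/integrableP => /measurable_EFinP mf ilt; apply/integrableP; split.
  by apply/measurable_EFinP; exact: measurableT_comp mf (measurable_addr h).
rewrite (ge0_integral_shift h (f := fun x => `|(f x)%:E|%E))//.
by apply: measurableT_comp => //; exact/measurable_EFinP.
Qed.

Lemma Rintegral_shift (h : V) (f : V -> R) : mu.-integrable setT (EFin \o f) ->
  \int[mu]_x f (x + h) = \int[mu]_x f x.
Proof.
move=> intf; rewrite /Rintegral; congr fine.
have mf : measurable_fun setT (EFin \o f) by exact: measurable_int intf.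
have := @integral_pushforward _ _ _ _ _ _ (measurable_addr h) mu setT (EFin \o f) mf.
rewrite preimage_setT => <- //; last exact: integrable_shift.
apply: eq_measure_integral => [|mh A mA _].
  exact: measurable_addr.
exact: (lebesgue_shift h mA).
Qed.

End lebesgue_space.

(** * Smooth functions *)

(* Smoothness is locked to keep trivial goal solving from unfolding it. *)
HB.lock Definition Csmooth (R : realType) (n : nat) (f : 'rV[R]_n -> R) : Prop := smooth f.
Canonical locked_Csmooth := Unlockable Csmooth.unlock.

Section smooth_functions.
Context {R : realType} {n : nat}.
Local Notation V := 'rV[R]_n.
Implicit Types (f g phi : V -> R) (x v h : V) (i j : 'I_n).
Local Notation e := (delta_mx ord0).

Lemma half_dist_lt (u v w : R) :
  `|w - u| < `|u - v| / 2 -> `|w - v| < `|u - v| / 2 -> False.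
Proof. by have := ler_distD w u v; rewrite [ `|u - w|]distrC; lra. Qed.

Lemma continuous_norm_lt f x (d : R) : continuous f -> 0 < d ->
  exists2 r, 0 < r & forall y, `|y - x| < r -> `|f y - f x| < d.
Proof.
move=> /(_ x)/cvgrPdist_lt/[apply]/nbhs_ballP[r /= r0 Hr]; exists r => // y yx.
by rewrite distrC; apply: Hr; rewrite mx_norm_ball /ball_/= distrC.
Qed.

Lemma derive_line f v x (s : R) :
  derivable (fun s : R => f (x + s *: v)) s 1 = derivable f (x + s *: v) v /\
  'D_1 (fun s : R => f (x + s *: v)) s = 'D_v f (x + s *: v).
Proof.
rewrite /derivable /derive.
have -> : (fun h : R => h^-1 *: (((fun s : R => f (x + s *: v)) \o shift s) (h *: 1)
              - f (x + s *: v))) =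
          (fun h : R => h^-1 *: ((f \o shift (x + s *: v)) (h *: v)
              - f (x + s *: v))).
  apply/funext => h /=; congr (_ *: (f _ - _)).
  by rewrite /shift/= [h%:A]mulr1 scalerDl addrCA.
by [].
Qed.

(** Only the derivative in the direction [v] is assumed, so the chain rule is applied to the
    restriction of [f] to a line. *)
Lemma derive_affine f (c : R) h v x : derivable f (c *: x + h) v ->
  derivable (fun x => f (c *: x + h)) x v /\
  'D_v (fun x => f (c *: x + h)) x = c * 'D_v f (c *: x + h).
Proof.
move=> df.
pose L s := f (c *: x + h + s *: v).
have [dL L'] := derive_line f v (c *: x + h) 0.
rewrite scale0r addr0 in dL L'.
have [dG G'] := derive_line (fun x => f (c *: x + h)) v x 0.
rewrite scale0r addr0 in dG G'.
rewrite -dG -G' -L'.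
have -> : (fun s => f (c *: (x + s *: v) + h)) = L \o (fun s => c * s).
  apply/funext => s /=; rewrite /L; congr f.
  by rewrite scalerDr scalerA addrAC.
have dcs s : is_derive s (1 : R) (fun s => c * s) c.
  by rewrite -[X in is_derive _ _ _ X]mulr1; exact: (@is_deriveZ _ _ _ id c s 1 1).
have dL0 : derivable L (c * 0) 1 by rewrite mulr0 dL.
split.
  apply/derivable1_diffP; apply: differentiable_comp; apply/derivable1_diffP.
    by have [] := dcs 0.
  exact: dL0.
rewrite -derive1E derive1_comp; [|by have [] := dcs 0|exact: dL0].
by rewrite !derive1E mulr0 (@derive_val _ _ _ _ _ _ _ (dcs 0)) mulrC.
Qed.

Lemma partials_rcons (s : seq 'I_n) i f :
  partials (rcons s i) f = partials s (partial i f).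
Proof. by rewrite /partials foldr_rcons. Qed.

Lemma smooth_partial i f : Csmooth f -> Csmooth (partial i f).
Proof. by rewrite unlock => sf s; rewrite -partials_rcons; exact: sf. Qed.

Lemma smooth_partials s f : Csmooth f -> Csmooth (partials s f).
Proof. by move=> sf; elim: s => //= i s; exact: smooth_partial. Qed.

Lemma smooth_continuous f : Csmooth f -> continuous f.
Proof. by rewrite unlock => /(_ [::]) []. Qed.

Lemma smooth_derivable f i x : Csmooth f -> derivable f x (e i).
Proof. by rewrite unlock => /(_ [::]) []. Qed.

Arguments smooth_derivable {f} i x _.

(** A coinduction principle: to prove a function smooth it suffices to place it in a class of
    continuous functions, derivable along the coordinates, that is stable under [partial]. *)
Lemma smooth_coind (S : set (V -> R)) f :
  (forall g, S g -> continuous g /\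
     forall i, S (partial i g) /\ forall x, derivable g x (e i)) ->
  S f -> Csmooth f.
Proof.
move=> HS Sf; rewrite unlock => s.
suff /HS[cf df] : S (partials s f) by split=> // i x; exact: (df i).2.
by elim: s => //= i s /HS[_ /(_ i)[]].
Qed.

Lemma partialD i f g : Csmooth f -> Csmooth g ->
  partial i (f + g) = partial i f + partial i g.
Proof.
by move=> sf sg; apply/funext => x; rewrite /partial (deriveD (smooth_derivable i x sf) (smooth_derivable i x sg)).
Qed.

Lemma partialZ i (c : R) f : Csmooth f -> partial i (c *: f) = c *: partial i f.
Proof.
by move=> sf; apply/funext => x; rewrite /partial (deriveZ _ (smooth_derivable i x sf)).
Qed.

Lemma partialM i f g : Csmooth f -> Csmooth g ->
  partial i (f * g) = f * partial i g + g * partial i f.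
Proof.
by move=> sf sg; apply/funext => x; rewrite /partial (deriveM (smooth_derivable i x sf) (smooth_derivable i x sg)).
Qed.

Lemma partialN i f : Csmooth f -> partial i (- f) = - partial i f.
Proof. by move=> sf; rewrite -scaleN1r partialZ// scaleN1r. Qed.

Lemma smooth_cst (c : R) : Csmooth (cst c : V -> R).
Proof.
apply: (@smooth_coind [set g | exists c, g = cst c]); last by exists c.
move=> _ [{}c ->]; split; first exact: cst_continuous.
move=> i; split=> [|x]; last exact: derivable_cst.
by exists 0; apply/funext => x; rewrite /partial derive_cst.
Qed.

Lemma smoothD f g : Csmooth f -> Csmooth g -> Csmooth (f + g).
Proof.
move=> sf sg; apply: (@smooth_coind [set h | exists f g, [/\ Csmooth f, Csmooth g & h = f + g]]); last by exists f, g.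
move=> _ [{sf}f [{sg}g [sf sg ->]]]; split.
  by move=> x; apply: continuousD; [exact: (smooth_continuous sf)|exact: (smooth_continuous sg)].
move=> i; split=> [|x]; last by apply: derivableD; [exact: (smooth_derivable i x sf)|exact: (smooth_derivable i x sg)].
by rewrite partialD//; exists (partial i f), (partial i g); split => //; exact: smooth_partial.
Qed.

Lemma smoothZ c f : Csmooth f -> Csmooth (c *: f).
Proof.
move=> sf; apply: (@smooth_coind [set h | exists2 f, Csmooth f & h = c *: f]); last by exists f.
move=> _ [{sf}f sf ->]; split.
  by move=> x; apply: continuousZr; exact: (smooth_continuous sf).
move=> i; split=> [|x]; last by apply: derivableZ; exact: smooth_derivable.
by rewrite partialZ//; exists (partial i f) => //; exact: smooth_partial.
Qed.

Lemma smoothN f : Csmooth f -> Csmooth (- f).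
Proof. by move=> sf; rewrite -scaleN1r; exact: smoothZ. Qed.

Lemma smoothB f g : Csmooth f -> Csmooth g -> Csmooth (f - g).
Proof. by move=> sf sg; apply: smoothD => //; exact: smoothN. Qed.

(* Sums of products of Csmooth functions form a class stable under partial
   derivatives. *)
Lemma smoothM f g : Csmooth f -> Csmooth g -> Csmooth (f * g).
Proof.
pose S := [set u : V -> R | exists s : seq ((V -> R) * (V -> R)),
  (forall q, List.In q s -> Csmooth q.1 /\ Csmooth q.2) /\
  u = \sum_(q <- s) q.1 * q.2].
move=> sf sg; apply: (@smooth_coind S); last first.
  by exists [:: (f, g)]; split; [move=> q [<-//|//]|rewrite big_seq1].
move=> _ [s [Hs ->]].
elim: s Hs => [|[a b] s IH] Hs.
  rewrite big_nil; split; first exact: cst_continuous.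
  move=> i; split=> [|x]; last exact: derivable_cst.
  exists [::]; split => //; rewrite big_nil; apply/funext => x.
  by rewrite /partial -[0]/(cst 0) derive_cst.
have [sa sb] := Hs (a, b) (or_introl erefl).
have [cs ds] := IH (fun q qs => Hs q (or_intror qs)).
rewrite big_cons /=; split.
  move=> x; apply: continuousD; last exact: cs.
  by apply: continuousM; [exact: (smooth_continuous sa)|exact: (smooth_continuous sb)].
move=> i; have [[t [Ht dE]] dx] := ds i; split=> [|x]; last first.
  by apply: derivableD => //; apply: derivableM; [exact: (smooth_derivable i x sa)|exact: (smooth_derivable i x sb)].
exists [:: (a, partial i b), (b, partial i a) & t]; split.
  by move=> q /= [<-|[<-|/Ht//]]; split => //; exact: smooth_partial.
rewrite !big_cons /= -dE addrA -partialM//; apply/funext => x.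
rewrite /partial deriveD//.
by apply: derivableM; [exact: (smooth_derivable i x sa)|exact: (smooth_derivable i x sb)].
Qed.

Lemma partialB i f g : Csmooth f -> Csmooth g ->
  partial i (f - g) = partial i f - partial i g.
Proof. by move=> sf sg; rewrite partialD ?partialN//; exact: smoothN. Qed.

Lemma partial_affine i c h f : Csmooth f ->
  partial i (fun x => f (c *: x + h)) = c *: (fun x => partial i f (c *: x + h)).
Proof.
move=> sf; apply/funext => x; rewrite /partial.
by have [_ ->] := derive_affine (smooth_derivable i (c *: x + h) sf).
Qed.

Lemma smooth_affine c h f : Csmooth f -> Csmooth (fun x => f (c *: x + h)).
Proof.
move=> sf.
apply: (@smooth_coind [set g | exists c' f, Csmooth f /\ g = c' *: (fun x : V => f (c *: x + h))]); last first.
  by exists 1, f; split => //; rewrite scale1r.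
move=> _ [c' [{sf}f [sf ->]]].
have cg : continuous (fun x : V => f (c *: x + h)).
  move=> x; apply: (@continuous_comp _ _ _ (fun x : V => c *: x + h) f); last exact: smooth_continuous.
  by apply: continuousD; [exact: scaler_continuous|exact: cst_continuous].
have dg i x : derivable (fun x : V => f (c *: x + h)) x (e i).
  by have [] := derive_affine (smooth_derivable i (c *: x + h) sf).
split; first by move=> x; apply: continuousZr; exact: cg.
move=> i; split=> [|x]; last exact: derivableZ.
exists (c' * c), (partial i f); split; first exact: smooth_partial.
apply/funext => x; rewrite /partial (deriveZ _ (dg i x)).
have /(congr1 (fun u => u x)) := partial_affine i c h sf.
by rewrite /partial => ->; rewrite [LHS]scalerA.
Qed.

Lemma partials_affine s c h f : Csmooth f ->
  partials s (fun x => f (c *: x + h)) =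
  c ^+ size s *: (fun x => partials s f (c *: x + h)).
Proof.
move=> sf; elim: s => [|i s ih] /=; first by rewrite expr0 scale1r.
rewrite ih partialZ; last exact/smooth_affine/smooth_partials.
rewrite partial_affine; last exact: smooth_partials.
by rewrite scalerA exprSr.
Qed.

Lemma smooth_shift h f : Csmooth f -> Csmooth (fun x => f (x + h)).
Proof.
move=> /(@smooth_affine 1 h); congr Csmooth.
by apply/funext => x; rewrite scale1r.
Qed.

Lemma partial_shift i h f : Csmooth f ->
  partial i (fun x => f (x + h)) = (fun x => partial i f (x + h)).
Proof.
move=> sf; have := partial_affine i 1 h sf; rewrite scale1r.
by under eq_fun do rewrite scale1r; move=> ->; under eq_fun do rewrite scale1r.
Qed.

Lemma partialsD s f g : Csmooth f -> Csmooth g ->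
  partials s (f + g) = partials s f + partials s g.
Proof.
move=> sf sg; elim: s => //= i s ->.
by rewrite partialD//; exact: smooth_partials.
Qed.

Lemma partialsZ s (c : R) f : Csmooth f -> partials s (c *: f) = c *: partials s f.
Proof.
move=> sf; elim: s => //= i s ->.
by rewrite partialZ//; exact: smooth_partials.
Qed.

Lemma partialsB s f g : Csmooth f -> Csmooth g ->
  partials s (f - g) = partials s f - partials s g.
Proof.
move=> sf sg; rewrite -[- g]scaleN1r partialsD//; last exact: smoothZ.
by rewrite partialsZ// scaleN1r.
Qed.

Lemma smooth_line_MVT f i x (a : R) : Csmooth f -> 0 < a ->
  exists2 c, c \in `]0, a[ & f (x + a *: e i) - f x = partial i f (x + c *: e i) * a.
Proof.
move=> sf a0.
have dL (s : R) : is_derive s 1 (fun s : R => f (x + s *: e i)) (partial i f (x + s *: e i)).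
  have [dE DE] := derive_line f (e i) x s.
  by split; [rewrite dE; exact: smooth_derivable|rewrite DE].
have := @MVT _ (fun s : R => f (x + s *: e i)) (fun s : R => partial i f (x + s *: e i)) 0 a a0.
rewrite scale0r addr0 subr0; apply => //.
apply: derivable_within_continuous => s _; exact: ex_derive.
Qed.

Lemma smooth_line_lip f i x (s M : R) : Csmooth f ->
  (forall y, `|partial i f y| <= M) -> `|f (x + s *: e i) - f x| <= M * `|s|.
Proof.
move=> sf fM.
wlog s0 : x s / 0 <= s => [H|].
  have [|s0] := leP 0 s; first exact: H.
  have := H (x + s *: e i) (- s); rewrite -addrA -scalerDl subrr scale0r addr0.
  by rewrite normrN distrC; apply; rewrite oppr_ge0 ltW.
move: s0; rewrite le_eqVlt => /predU1P[<-|s0].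
  by rewrite scale0r addr0 subrr !normr0 mulr0.
have [c _ ->] := smooth_line_MVT i x sf s0.
by rewrite normrM ler_wpM2r.
Qed.

Lemma normr_delta i : `|e i : V| = 1.
Proof.
apply/eqP; rewrite eq_le [ `|_|]mx_normrE; apply/andP; split.
  apply/bigmax_leP; split => // -[a b] _ /=; rewrite mxE.
  by case: (_ && _); rewrite ?normr1 ?normr0.
by apply/bigmax_geP; right; exists (ord0, i) => //=; rewrite mxE !eqxx normr1.
Qed.

Lemma norm_coord (x : V) i : `|x ord0 i| <= `|x|.
Proof. by rewrite [leRHS]mx_normrE; apply/bigmax_geP; right; exists (ord0, i). Qed.

Lemma norm_coord_le (x : V) (r : R) : 0 <= r -> (forall i, `|x ord0 i| <= r) -> `|x| <= r.
Proof.
move=> r0 H; rewrite [leLHS]mx_normrE; apply/bigmax_leP; split => // -[a b] _ /=.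
by rewrite ord1.
Qed.

(* Both mixed partials are limits of the same second difference quotient. *)
Lemma partialC i j f : Csmooth f -> partial i (partial j f) = partial j (partial i f).
Proof.
move=> sf; apply/funext => x.
pose A := partial i (partial j f); pose B := partial j (partial i f).
have H (k l : 'I_n) (a : R) : 0 < a -> exists2 y, `|y - x| <= 2 * a &
    f (x + a *: e k + a *: e l) - f (x + a *: e k) - (f (x + a *: e l) - f x) =
    partial l (partial k f) y * a ^+ 2.
  move=> a0.
  pose g y := f (y + a *: e l) - f y.
  have sg : Csmooth g by apply: smoothB => //; exact: smooth_shift.
  have [c] := smooth_line_MVT k x sg a0.
  rewrite in_itv/= => /andP[c0 ca] gE.
  have dg : partial k g = (fun y => partial k f (y + a *: e l)) - partial k f.
    rewrite -[g]/((fun y => f (y + a *: e l)) - f) partialB ?partial_shift//.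
    exact: smooth_shift.
  have [d] := smooth_line_MVT l (x + c *: e k) (smooth_partial k sf) a0.
  rewrite in_itv/= => /andP[d0 da] fE.
  exists (x + c *: e k + d *: e l).
    have -> : x + c *: e k + d *: e l - x = c *: e k + d *: e l.
      by rewrite -[x + _ + _]addrA [x + _]addrC addrK.
    rewrite (le_trans (ler_normD _ _))//.
    by rewrite !normrZ !normr_delta !gtr0_norm// !mulr1; lra.
  by rewrite -[LHS]/(g (x + a *: e k) - g x) gE dg !fctE fE -mulrA -expr2.
apply/eqP; apply: contrapT => /negP; rewrite -subr_eq0 -normr_gt0 => d0.
rewrite -/(A x) -/(B x) in d0; set d := `|_| in d0.
have cA : continuous A by apply/smooth_continuous/smooth_partial/smooth_partial.
have cB : continuous B by apply/smooth_continuous/smooth_partial/smooth_partial.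
have d20 : 0 < d / 2 by rewrite divr_gt0.
have [r1 r10 Hr1] := continuous_norm_lt x cA d20.
have [r2 r20 Hr2] := continuous_norm_lt x cB d20.
pose a := Num.min r1 r2 / 4.
have a0 : 0 < a by rewrite divr_gt0// lt_min r10.
have [ar1 ar2] : 2 * a < r1 /\ 2 * a < r2.
  have : a * 4 = Num.min r1 r2 by rewrite /a divfK.
  by have := ge_min r1 r1 r2; have := ge_min r2 r1 r2; rewrite !lexx orbT /= => ? ? ?; split; lra.
have [y1 xy1 E1] := H j i a a0; have [y2 xy2 E2] := H i j a a0.
have AB : A y1 = B y2.
  apply: (mulIf (x := a ^+ 2)); first by rewrite expf_neq0// gt_eqF.
  apply: etrans (esym E1) (etrans _ E2).
  have -> : x + a *: e j + a *: e i = x + a *: e i + a *: e j by rewrite addrAC.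
  by move: (f _) (f _) (f _) (f _) => p q r u; ring.
have A1 := Hr1 y1 (le_lt_trans xy1 ar1).
have B2 := Hr2 y2 (le_lt_trans xy2 ar2).
move: A1 B2; rewrite AB /d; move: (A x) (B x) (B y2) => u v w wu wv.
by have := half_dist_lt wu wv.
Qed.

Lemma partials_perm s t f : perm_eq s t -> Csmooth f -> partials s f = partials t f.
Proof.
move=> + sf; elim: s t => [|i s ih] t; first by rewrite perm_sym => /perm_nilP ->.
move=> st.
have it : i \in t by rewrite -(perm_mem st) mem_head.
have [t1 [t2 tE]] : exists t1 t2, t = t1 ++ i :: t2.
  by have [t1 t2] := splitPr it; exists t1, t2.
rewrite /= (ih (t1 ++ t2)); last first.
  by rewrite -(perm_cons i) (perm_trans st)// tE -cat1s perm_catCA.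
rewrite tE {tE it st ih}; elim: t1 => //= j t1 <-.
by rewrite partialC//; exact: smooth_partials.
Qed.
End smooth_functions.

(** * A smooth bump function *)

Section flat_function.
Context {R : realType}.
Implicit Types P : {poly R}.

(** The polynomial [P] is evaluated at 1/t: these are the functions obtained by differentiating
    exp(-1/t) repeatedly, and they form a class stable under derivation. *)
Definition flat P (t : R) : R := if 0 < t then P.[t^-1] * expR (- t^-1) else 0.

(** With X standing for 1/t, whose derivative is -1/t^2, this is the product rule for P(1/t)
    exp(-1/t). *)
Definition flat_deriv P : {poly R} := 'X^2 * (P - P^`()).

(** The exponential series gives y^(i+1) <= (i+1)! exp(y); with y = 1/t, the term of degree i in [P]
    is at most (i+1)! t. A bound linear in t is what both continuity and derivability at 0
    require. *)
Lemma flat_le P : exists2 C : R, 0 <= C & forall t, `|flat P t| <= C * `|t|.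
Proof.
exists (\sum_(i < size P) `|P`_i| * (i.+1)`!%:R).
  by apply: sumr_ge0 => i _; exact: mulr_ge0.
move=> t; rewrite /flat; case: ifPn => [t0|_]; last first.
  rewrite normr0 mulr_ge0//.
  by apply: sumr_ge0 => i _; exact: mulr_ge0.
rewrite (gtr0_norm t0) horner_coef mulr_suml (le_trans (ler_norm_sum _ _ _))//.
rewrite mulr_suml.
apply: ler_sum => i _; rewrite -!mulrA normrM ler_wpM2l//.
rewrite ger0_norm; last by rewrite mulr_ge0 ?expR_ge0// exprn_ge0// invr_ge0 ltW.
rewrite expRN ler_pdivrMr ?expR_gt0// -mulrA.
have y0 : 0 <= t^-1 by rewrite invr_ge0 ltW.
have := expR_ge1Dxn i y0; set e := expR _ => e1.
have : t^-1 ^+ i.+1 <= i.+1`!%:R * e.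
  rewrite mulrC -ler_pdivrMr ?ltr0n ?fact_gt0//.
  by apply: le_trans e1; rewrite lerDr.
rewrite exprSr ler_pdivrMr// => /le_trans; apply.
by rewrite -mulrA [e * t]mulrC.
Qed.

Lemma is_derive_flat P t : is_derive t (1 : R) (flat P) (flat (flat_deriv P) t).
Proof.
have [t0|t0|->] := ltgtP t 0.
- apply: (@near_eq_is_derive _ _ _ (cst 0)); last first.
    by apply: is_derive_eq; rewrite /flat ltNge ltW.
  near=> s; rewrite /flat ifN// -leNgt ltW//.
  by near: s; exact: lt_nbhsl.
- apply: (@near_eq_is_derive R R R (fun t : R => P.[t^-1] * expR (- t^-1)) (flat P) t 1 _); last first.
    rewrite /flat t0.
    have tn0 : t != 0 by rewrite gt_eqF.
    have dV : is_derive t (1 : R) (fun t : R => t^-1) (- t ^- 2).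
      split; first exact: derivableV.
      by rewrite deriveV// derive_id [_ *: 1]mulr1.
    have dP : is_derive t (1 : R) (fun t => P.[t^-1]) (- t ^- 2 * P^`().[t^-1]).
      rewrite mulrC; exact: (@is_derive1_comp _ (horner P) (fun t => t^-1)).
    have dE : is_derive t (1 : R) (fun t => expR (- t^-1)) (t ^- 2 * expR (- t^-1)).
      have dN : is_derive t (1 : R) (fun t : R => - t^-1) (t ^- 2).
        by rewrite -[t ^- 2]opprK; exact: is_deriveN.
      rewrite mulrC; exact: (@is_derive1_comp _ expR (fun t => - t^-1)).
    apply: is_derive_eq.
    rewrite /flat_deriv !hornerE /=.
    set e := expR _; set a := P.[_]; set b := _.[_].
    by rewrite /GRing.scale/= exprVn; ring.
  near=> s; rewrite /flat ifT//.
  by near: s; exact: lt_nbhsr.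
have F0 : flat (flat_deriv P) 0 = 0 by rewrite /flat ltxx.
have Fl0 : flat P 0 = 0 by rewrite /flat ltxx.
(* At 0 the difference quotient of [flat P] is [flat ('X * P)], which the linear bound forces to
   0. *)
have [C C0 HC] := flat_le ('X * P).
have lim0 : h^-1 *: ((flat P \o shift 0) (h *: 1) - flat P 0) @[h --> 0^'] --> (0 : R).
  apply/cvgr0Pnorm_lt => e e0.
  have Ce0 : 0 < e / (C + 1) by rewrite divr_gt0// ltr_wpDl.
  near=> h; rewrite /= /shift/= addr0 [h%:A]mulr1 Fl0 subr0.
  have -> : h^-1 *: flat P h = flat ('X * P) h.
    rewrite /flat; case: ifPn => _; last by rewrite scaler0.
    by rewrite hornerM hornerX -mulrA.
  rewrite (le_lt_trans (HC h))//.
  have hC : `|h| < e / (C + 1).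
    by near: h; apply: dnbhs0_lt.
  rewrite (@le_lt_trans _ _ ((C + 1) * `|h|))//.
    by rewrite ler_wpM2r// lerDl.
  by rewrite mulrC -ltr_pdivlMr// ltr_wpDl.
split; first by apply/cvg_ex; exists 0.
by rewrite F0; apply/cvg_lim.
Unshelve. all: by end_near. Qed.

Lemma flat_ge0 t : 0 <= flat 1 t.
Proof. by rewrite /flat; case: ifP => // _; rewrite hornerC mul1r expR_ge0. Qed.

Lemma flat_le0 P t : t <= 0 -> flat P t = 0.
Proof. by rewrite /flat leNgt => /negbTE ->. Qed.

Lemma flat_ge t (a : R) : 0 < a -> a <= t -> expR (- a^-1) <= flat 1 t.
Proof.
move=> a0 at_; have t0 := lt_le_trans a0 at_.
by rewrite /flat t0 hornerC mul1r ler_expR lerN2 lef_pV2.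
Qed.

End flat_function.

Section bump.
Context {R : realType} {n : nat}.
Local Notation V := 'rV[R]_n.
Local Notation e := (delta_mx ord0).

Lemma is_derive_line (a b s : R) : is_derive s (1 : R) (fun s : R => a + b * s) b.
Proof.
have hb : is_derive s (1 : R) (fun s : R => b * s) b.
  by rewrite -[X in is_derive _ _ _ X]mulr1; exact: (@is_deriveZ _ _ _ id b s 1 1).
rewrite -[X in is_derive _ _ _ X]add0r.
exact: (@is_deriveD R R R (cst a) (fun s => b * s) s 1 0 b).
Qed.

Lemma smooth_flat_coord i (P : {poly R}) : Csmooth (fun x : V => flat P (x ord0 i)).
Proof.
apply: (@smooth_coind R n [set f : V -> R | exists (c : R) (Q : {poly R}), f = c *: ((fun x : V => flat Q (x ord0 i)) : V -> R)] _ _); last first.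
  by exists 1, P; rewrite scale1r.
move=> _ [c [Q ->]].
have cQ : continuous (fun x : V => flat Q (x ord0 i)).
  move=> x; apply: (@continuous_comp _ _ _ (fun x : V => x ord0 i) (flat Q)).
    exact: coord_continuous.
  apply: differentiable_continuous; apply/derivable1_diffP.
  by have [] := is_derive_flat Q (x ord0 i).
have dQ j (x : V) : is_derive x (e j) (fun x : V => flat Q (x ord0 i))
    ((i == j)%:R * flat (flat_deriv Q) (x ord0 i)).
  pose b : R := (i == j)%:R.
  have [dE DE] := derive_line (fun x : V => flat Q (x ord0 i)) (e j) x 0.
  rewrite scale0r addr0 in dE DE.
  have lineE : (fun s : R => flat Q ((x + s *: e j) ord0 i)) =
      flat Q \o (fun s => x ord0 i + b * s).
    by apply/funext => s /=; rewrite !mxE eqxx/= mulrC.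
  have dL := is_derive_line (x ord0 i) b 0.
  have dC : is_derive (0 : R) (1 : R) (flat Q \o (fun s => x ord0 i + b * s))
      (flat (flat_deriv Q) (x ord0 i) * b).
    have dF : is_derive (x ord0 i + b * 0) (1 : R) (flat Q) (flat (flat_deriv Q) (x ord0 i)).
      by rewrite mulr0 addr0; exact: is_derive_flat.
    exact: (@is_derive1_comp _ (flat Q) (fun s => x ord0 i + b * s)).
  case: dC; rewrite -lineE => dC1 dC2; split.
    by rewrite -dE.
  by rewrite -DE dC2 mulrC.
split; first by move=> x; apply: continuousZr; exact: cQ.
move=> j; split=> [|x]; last by apply: derivableZ; have [] := dQ j x.
exists (c * (i == j)%:R), (flat_deriv Q); apply/funext => x.
rewrite /partial deriveZ; last by have [] := dQ j x.
have [_ ->] := dQ j x.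
by rewrite -scalerA.
Qed.

Lemma smooth_prod (I : eqType) (s : seq I) (f : I -> V -> R) :
  (forall i, Csmooth (f i)) -> Csmooth (\prod_(i <- s) f i).
Proof.
move=> sf; elim/big_ind : _ => // [|g h]; [exact: smooth_cst|exact: smoothM].
Qed.

Definition bump : V -> R :=
  \prod_(i < n) ((fun x : V => flat 1 (1 - x ord0 i)) * (fun x : V => flat 1 (1 + x ord0 i))).

Lemma bumpE x : bump x = \prod_(i < n) (flat 1 (1 - x ord0 i) * flat 1 (1 + x ord0 i)).
Proof. by rewrite /bump; elim/big_ind2 : _ => // f a g b <- <-. Qed.

Lemma smooth_bump : Csmooth bump.
Proof.
apply: smooth_prod => i; apply: smoothM.
  have := smooth_affine (-1) (const_mx 1) (smooth_flat_coord i 1).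
  by congr Csmooth; apply/funext => x; rewrite !mxE mulN1r addrC.
have := smooth_affine 1 (const_mx 1) (smooth_flat_coord i 1).
by congr Csmooth; apply/funext => x; rewrite !mxE mul1r addrC.
Qed.

Lemma bump_ge0 x : 0 <= bump x.
Proof. by rewrite bumpE; apply: prodr_ge0 => i _; rewrite mulr_ge0// flat_ge0. Qed.

Lemma bump_out x : ~ cube 1 x -> bump x = 0.
Proof.
move=> /cubeP/existsNP[i /negP]; rewrite -ltNge => xi.
rewrite bumpE (bigD1 i)//=.
suff -> : flat 1 (1 - x ord0 i) * flat 1 (1 + x ord0 i) = 0 by rewrite mul0r.
have [x0|x0] := leP 0 (x ord0 i); move: xi.
  by rewrite ger0_norm// => xi; rewrite flat_le0 ?mul0r// subr_le0 ltW.
by rewrite ltr0_norm// => xi; rewrite mulrC flat_le0 ?mul0r// -lerBrDl sub0r lerNr ltW.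
Qed.

(** Both 1 - x_i and 1 + x_i are at least 1/2 there, and [flat 1] is at least exp(-2) from 1/2
    on. *)
Lemma bump_in x : cube 2^-1 x -> (expR (- 2) ^+ 2) ^+ n <= bump x.
Proof.
move=> /cubeP xi; rewrite bumpE.
rewrite -[X in _ ^+ X]card_ord -prodr_const; apply: ler_prod => i _.
rewrite exprn_ge0 ?expR_ge0//= expr2.
have := xi i; rewrite ler_norml => /andP[x1 x2].
have h0 : (0 : R) < 2^-1 by rewrite invr_gt0.
by apply: ler_pM; rewrite ?expR_ge0// -[X in - X]invrK; apply: flat_ge => //; lra.
Qed.

End bump.

(** * L^p seminorms and continuity of translations *)

Section Lp_norm.
Context d (T : measurableType d) (R : realType).
Variables (m : {measure set T -> \bar R}) (p : R).
Hypothesis p1 : 1 <= p.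
Implicit Types f g h : T -> R.

Let p0 : 0 < p. Proof. exact: lt_le_trans p1. Qed.

Lemma ler_powR_base (a b : R) : 0 <= a -> a <= b -> a `^ p <= b `^ p.
Proof.
move=> a0 ab; apply: ge0_ler_powR => //; rewrite ?nnegrE ?(ltW p0)//.
exact: le_trans ab.
Qed.

Definition nrm f : \bar R := 'N[m]_p%:E[EFin \o f].

Local Arguments nrm f%_ring_scope.

Lemma nrm_ge0 f : (0 <= nrm f)%E.
Proof. exact: Lnorm_ge0. Qed.

Lemma nrmE f : nrm f = ((\int[m]_x (`|f x| `^ p)%:E) `^ p^-1)%E.
Proof. by rewrite /nrm unlock. Qed.

Lemma integral_powR_ge0 f : (0 <= \int[m]_x (`|f x| `^ p)%:E)%E.
Proof. by apply: integral_ge0 => x _; rewrite lee_fin powR_ge0. Qed.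

Lemma poweR_nrm f : (nrm f `^ p = \int[m]_x (`|f x| `^ p)%:E)%E.
Proof. by rewrite nrmE -poweRrM mulVf ?gt_eqF// poweRe1// integral_powR_ge0. Qed.

Lemma measurable_abs_powR f : measurable_fun setT f ->
  measurable_fun setT (fun x => (`|f x| `^ p)%:E).
Proof.
move=> mf; apply/measurable_EFinP.
apply: (@measurableT_comp _ _ _ _ _ _ (@powR R ^~ p)) => //.
exact: measurableT_comp.
Qed.

Lemma nrm_le_pow f (e : R) : 0 <= e ->
  (nrm f <= e%:E)%E = (\int[m]_x (`|f x| `^ p)%:E <= (e `^ p)%:E)%E.
Proof.
move=> e0; rewrite -poweR_nrm -poweR_EFin; apply/idP/idP => H.
  by apply: gt0_ler_poweR => //; rewrite ?ltW// in_itv/= ?leey ?nrm_ge0 ?lee_fin ?e0.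
rewrite -[leLHS]poweRe1 ?nrm_ge0// -[leRHS]poweRe1//.
rewrite -(mulfV (x := p)) ?gt_eqF// !poweRrM.
by apply: gt0_ler_poweR => //; rewrite ?invr_ge0 ?ltW// in_itv/= ?leey ?poweR_ge0 ?lee_fin ?powR_ge0.
Qed.

Lemma nrm_le_ae f g : measurable_fun setT f -> measurable_fun setT g ->
  {ae m, forall x, `|f x| <= `|g x|} -> (nrm f <= nrm g)%E.
Proof.
move=> mf mg fg; rewrite !nrmE; apply: gt0_ler_poweR.
- by rewrite invr_ge0 ltW.
- by rewrite in_itv/= leey integral_powR_ge0.
- by rewrite in_itv/= leey integral_powR_ge0.
apply: ae_ge0_le_integral => //.
- exact: measurable_abs_powR.
- exact: measurable_abs_powR.
- apply: filterS fg => x fg _; rewrite lee_fin.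
  exact: ler_powR_base.
Qed.

Lemma nrm_le f g : measurable_fun setT f -> measurable_fun setT g ->
  (forall x, `|f x| <= `|g x|) -> (nrm f <= nrm g)%E.
Proof. by move=> mf mg fg; apply: nrm_le_ae => //; exact: aeW. Qed.

Lemma nrm_ae_eq f g : measurable_fun setT f -> measurable_fun setT g ->
  {ae m, forall x, f x = g x} -> nrm f = nrm g.
Proof.
move=> mf mg fg; apply/eqP; rewrite eq_le; apply/andP; split.
  by apply: nrm_le_ae => //; apply: filterS fg => x ->.
by apply: nrm_le_ae => //; apply: filterS fg => x ->.
Qed.

Lemma nrmD f g : measurable_fun setT f -> measurable_fun setT g ->
  (nrm (f + g)%R <= nrm f + nrm g)%E.
Proof. by move=> mf mg; exact: minkowski_EFin. Qed.

Lemma nrmZ (c : R) f : measurable_fun setT f ->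
  nrm (c *: f) = (`|c|%:E * nrm f)%E.
Proof.
move=> mf; rewrite !nrmE.
under eq_integral do rewrite normrM powRM// EFinM.
rewrite ge0_integralZl//.
  rewrite poweRM ?integral_powR_ge0 ?lee_fin ?powR_ge0//.
  by rewrite poweR_EFin -powRrM mulfV ?gt_eqF// powRr1.
exact: measurable_abs_powR.
Qed.

Lemma nrmN f : nrm (- f) = nrm f.
Proof. by rewrite !nrmE; under eq_integral do rewrite normrN. Qed.

Lemma nrm0 : nrm 0 = 0%E.
Proof. by rewrite /nrm (_ : _ \o _ = cst 0%E)// Lnorm0// eqe gt_eqF. Qed.

Lemma nrm_sub_trans f g h : measurable_fun setT f -> measurable_fun setT g ->
  measurable_fun setT h -> (nrm (f - h) <= nrm (f - g) + nrm (g - h))%E.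
Proof.
move=> mf mg mh; rewrite (_ : f - h = (f - g) + (g - h)); last by rewrite addrA subrK.
by apply: nrmD; apply: measurable_funB.
Qed.

Lemma nrm_sum (I : Type) (s : seq I) (F : I -> T -> R) :
  (forall i, measurable_fun setT (F i)) ->
  (nrm (\sum_(i <- s) F i)%R <= \sum_(i <- s) nrm (F i))%E.
Proof.
move=> mF; elim: s => [|i s ih]; first by rewrite !big_nil nrm0.
rewrite !big_cons (le_trans (nrmD _ _))// ?leeD2l//.
rewrite (_ : \sum_(j <- s) F j = (fun x => \sum_(j <- s) F j x)).
  exact: measurable_sum.
by apply/funext => x; rewrite fct_sumE.
Qed.

Lemma nrm_eq0 f : measurable_fun setT f ->
  (forall e, 0 < e -> (nrm f <= e%:E)%E) -> {ae m, forall x, f x = 0}.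
Proof.
move=> mf H.
have n0 : nrm f = 0%E.
  apply/eqP; rewrite eq_le nrm_ge0 andbT; apply/lee_addgt0Pr => e e0.
  by rewrite add0e; exact: H.
have := Lnorm_eq0_eq0 _ _ n0.
have /measurable_EFinP mf' := mf.
by move=> /(_ mf' p0); apply: filterS => x /= /(_ I) [].
Qed.

(** Dominated convergence for p-th powers, with the limit normalized to 0: its uses concern errors
    of truncations and of approximations from below. *)
Lemma nrm_dct (u : (T -> R)^nat) (G : T -> R) :
  (forall k, measurable_fun setT (u k)) -> measurable_fun setT G ->
  (nrm G < +oo)%E -> (forall k x, `|u k x| <= `|G x|) ->
  (forall x, u k x @[k --> \oo] --> 0) ->
  forall e : R, 0 < e -> exists N, forall k, (N <= k)%N -> (nrm (u k) <= e%:E)%E.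
Proof.
move=> mu mG Goo uG u0 e e0.
have iG : m.-integrable setT (fun x => (`|G x| `^ p)%:E).
  apply/integrableP; split; first exact: measurable_abs_powR.
  under eq_integral do rewrite gee0_abs ?lee_fin ?powR_ge0//.
  by rewrite -poweR_nrm; exact: poweR_lty.
have [] := @dominated_convergence _ _ _ m setT measurableT
    (fun k x => (`|u k x| `^ p)%:E) (cst 0%E) (fun x => (`|G x| `^ p)%:E).
- by move=> k; exact: measurable_abs_powR.
- exact: measurable_cst.
- apply: aeW => x _; apply: cvg_EFin; first exact: nearW.
  apply/cvgr0Pnorm_le => a a0; near=> k; rewrite /= ger0_norm ?powR_ge0//.
  have -> : a = (a `^ p^-1) `^ p.
    by rewrite -powRrM mulVf ?gt_eqF// powRr1// ltW.
  apply: ler_powR_base => //.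
  near: k; have := u0 x => /cvgr0Pnorm_le; apply.
  exact: powR_gt0.
- exact: iG.
- apply: aeW => x k _; rewrite gee0_abs ?lee_fin ?powR_ge0//.
  exact: ler_powR_base.
move=> _ _; rewrite integral0 => lim0.
have ep0 : 0 < e `^ p by exact: powR_gt0.
have /fine_cvgP[lfin lim1] := lim0.
move/cvgr0Pnorm_le : lim1 => /(_ _ ep0) lim2.
have [N _ HN] := filterI lfin lim2.
exists N => k Nk; have [/= fin le] := HN k Nk.
rewrite nrm_le_pow; last exact: ltW.
rewrite -(fineK fin) lee_fin (le_trans _ le)// ler_norm.
Unshelve. all: by end_near. Qed.

End Lp_norm.
Arguments nrm {d T R} m p%_ring_scope f%_ring_scope.

(** * Continuity of translations: stability properties *)

Section translation_continuity.
Context {R : realType} {n : nat}.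
Local Notation V := 'rV[R]_n.
Local Notation mu := (lebesgue_rV R n).
Variable p : R.
Hypothesis p1 : 1 <= p.
Let p0 : 0 < p. Proof. exact: lt_le_trans p1. Qed.
Implicit Types (f g : V -> R) (h : V).
Local Notation N := (nrm mu p).

Definition shiftf h f : V -> R := fun x => f (x + h).

Lemma measurable_shiftf h f : measurable_fun setT f -> measurable_fun setT (shiftf h f).
Proof. by move=> mf; exact: measurableT_comp mf (measurable_addr h). Qed.

Lemma nrm_shift h f : measurable_fun setT f -> N (shiftf h f) = N f.
Proof.
move=> mf; rewrite !nrmE; congr poweR.
apply: (ge0_integral_shift h (f := fun x => (`|f x| `^ p)%:E)).
  exact: measurable_abs_powR.
by move=> x; rewrite lee_fin powR_ge0.
Qed.

Definition shift_continuous f := forall e : R, 0 < e ->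
  exists2 r, 0 < r & forall h, `|h| <= r -> (N (shiftf h f - f) <= e%:E)%E.

Lemma shift_continuous0 : shift_continuous 0.
Proof.
move=> e e0; exists 1 => // h _.
have -> : shiftf h 0 - 0 = 0 by apply/funext => x; rewrite /shiftf !fctE subrr.
by rewrite nrm0// lee_fin ltW.
Qed.

Lemma shift_continuousD f g : measurable_fun setT f -> measurable_fun setT g ->
  shift_continuous f -> shift_continuous g -> shift_continuous (f + g).
Proof.
move=> mf mg cf cg e e0.
have e20 : 0 < e / 2 by rewrite divr_gt0.
have [r r0 Hr] := cf _ e20; have [s s0 Hs] := cg _ e20.
exists (Num.min r s); first by rewrite lt_min r0.
move=> h; rewrite le_min => /andP[hr hs].
have -> : shiftf h (f + g) - (f + g) = (shiftf h f - f) + (shiftf h g - g).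
  by rewrite opprD addrACA.
rewrite (le_trans (nrmD _ _ _ _))//; try (apply: measurable_funB => //; exact: measurable_shiftf).
by rewrite (splitr e) EFinD leeD ?Hr ?Hs.
Qed.

Lemma shift_continuousZ (c : R) f : measurable_fun setT f ->
  shift_continuous f -> shift_continuous (c *: f).
Proof.
move=> mf cf e e0.
have ec0 : 0 < e / (`|c| + 1) by rewrite divr_gt0// ltr_wpDl.
have [r r0 Hr] := cf _ ec0; exists r => // h hr.
have -> : shiftf h (c *: f) - (c *: f) = c *: (shiftf h f - f) by rewrite scalerBr.
rewrite nrmZ//; last by apply: measurable_funB => //; exact: measurable_shiftf.
apply: (@le_trans _ _ (`|c|%:E * (e / (`|c| + 1))%:E)%E).
  by rewrite lee_wpmul2l ?lee_fin// Hr.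
rewrite -EFinM lee_fin mulrCA ler_piMr ?(ltW e0)//.
by rewrite ler_pdivrMr ?ltr_wpDl// mul1r lerDl.
Qed.

(** A three-epsilon argument, translations being isometries of L^p. *)
Lemma shift_continuous_lim f : measurable_fun setT f ->
  (forall e : R, 0 < e -> exists g, [/\ measurable_fun setT g, shift_continuous g &
    (N (f - g) <= e%:E)%E]) -> shift_continuous f.
Proof.
move=> mf H e e0.
have e30 : 0 < e / 3 by rewrite divr_gt0.
have [g [mg cg fg]] := H _ e30; have [r r0 Hr] := cg _ e30; exists r => // h hr.
have mfh := measurable_shiftf h mf; have mgh := measurable_shiftf h mg.
apply: le_trans (nrm_sub_trans mu p1 mfh mgh mf) _.
apply: (@le_trans _ _ ((e / 3)%:E + (e / 3 + e / 3)%:E)%E); last first.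
  by rewrite -EFinD lee_fin; lra.
apply: leeD.
  rewrite -[shiftf h f - shiftf h g]/(shiftf h (f - g)) nrm_shift//.
  exact: measurable_funB.
apply: le_trans (nrm_sub_trans mu p1 mgh mg mf) _; rewrite EFinD leeD ?Hr//.
by rewrite -opprB nrmN.
Qed.

Lemma nrm_indic (A : set V) : measurable A ->
  N (\1_A : V -> R) = (mu A `^ p^-1)%E.
Proof.
move=> mA; rewrite nrmE; congr poweR.
rewrite -[in RHS](setIT A) -integral_indic//; apply: eq_integral => x _.
by rewrite indicE; case: (_ \in _); rewrite ?normr1 ?powR1// normr0 powR0// gt_eqF.
Qed.

End translation_continuity.

(** * Continuity of translations in L^1 on indicator functions *)

Section translation_indicators.
Context {R : realType} {n : nat}.
Local Notation V := 'rV[R]_n.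
Local Notation mu := (lebesgue_rV R n).
Implicit Types (f g : V -> R) (h : V) (A U C : set V).

(** The sigma-algebra defined by coordinates is the Borel one, so that a Dynkin argument can start
    from the open sets. *)
Lemma measurable_rV_opens : (@measurable _ V : set (set V)) = <<s open >>.
Proof.
apply/seteqP; split; last first.
  apply: smallest_sub; first exact: sigma_algebra_measurable.
  by move=> U; exact: open_measurable_rV.
apply: smallest_sub; first exact: smallest_sigma_algebra.
move=> A; rewrite -bigcup_seq/= => -[i _ [C mC <-]]; rewrite setTI.
pose P := [set C : set R | <<s (@open V) >> ((fun x : V => x ord0 i) @^-1` C)].
suff : P C by [].
have mR : (@measurable _ R : set (set R)) = <<s @RGenOpens.G R >>.
  exact: (RGenOpens.measurableE R).
have {mC} : <<s @RGenOpens.G R >> C by rewrite -mR.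
apply: smallest_sub => {C}.
  split => [|C PC|F PF]; rewrite /P/=.
  - by rewrite preimage_set0; exact: sigma_algebra0.
  - by rewrite setTD preimage_setC; exact: sigma_algebraC.
  - by rewrite preimage_bigcup; exact: sigma_algebra_bigcup.
move=> _ [a [b ->]]; apply: sub_sigma_algebra.
apply: open_comp; last exact: interval_open.
by move=> x _; exact: coord_continuous.
Qed.

Lemma measurable_continuous f : continuous f -> measurable_fun setT f.
Proof.
move=> cf; apply: (measurability _ (RGenOpens.measurableE R)).
move=> _ [_ [a [b ->] <-]]; rewrite setTI; apply: open_measurable_rV.
by apply: open_comp; [move=> x _; exact: cf|exact: interval_open].
Qed.

Lemma nrm1E f : (nrm mu 1 f = \int[mu]_x (`|f x|)%:E)%E.
Proof. by rewrite /nrm Lnorm1. Qed.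

(* The integral of [|b - a|] is twice that of the positive part of [a - b]
   when [a] is a translate of [b]; that part tends to [0] by openness of [U]. *)
Lemma shift_continuous_open U : open U -> (mu U < +oo)%E ->
  shift_continuous 1 (\1_U : V -> R).
Proof.
move=> oU Uoo e e0; apply: contrapT => H.
have mU := open_measurable_rV oU.
have {}H (k : nat) : exists h, `|h| <= k.+1%:R^-1 /\
    ~ (nrm mu 1 (shiftf h \1_U - \1_U) <= e%:E)%E.
  apply: contrapT => Hk; apply: H; exists k.+1%:R^-1; first by rewrite invr_gt0.
  by move=> h hk; apply: contrapT => Hh; apply: Hk; exists h.
have [h /all_and2[hk Nh]] := choice H.
pose a : V -> R := \1_U; pose b k := shiftf (h k) a.
have ma : measurable_fun setT a by exact: measurable_indic.
have mb k : measurable_fun setT (b k) by exact: measurable_shiftf.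
pose w k x := Num.max (a x - b k x) 0.
have mw k : measurable_fun setT (w k).
  by apply: measurable_maxr => //; exact: measurable_funB.
have a01 x : a x = 0 \/ a x = 1.
  by rewrite /a indicE; case: (_ \in _); [right|left].
have b01 k x : b k x = 0 \/ b k x = 1 by exact: a01.
have Na : (nrm mu 1 a < +oo)%E.
  by rewrite nrm_indic// invr1 poweRe1.
have e20 : 0 < e / 2 by rewrite divr_gt0.
have wa k x : `|w k x| <= `|a x|.
  rewrite /w; have [->|->] := a01 x; have [->|->] := b01 k x; rewrite ?subr0 ?subrr ?maxxx ?normr0 ?normr1//.
    by rewrite sub0r max_r ?normr0// oppr_le0.
  by rewrite max_l ?normr1.
have w0 x : w k x @[k --> \oo] --> 0.
  have [ax|ax] := a01 x.
    rewrite (_ : w ^~ x = cst 0); first exact: cvg_cst.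
    apply/funext => k; rewrite /w ax sub0r max_r// oppr_le0.
    by have [->|->] := b01 k x.
  have Ux : U x.
    apply: contrapT => nUx; move: ax; rewrite /a indicE memNset//= => /esym/eqP.
    by rewrite oner_eq0.
  have /nbhs_ballP[r /= r0 Hr] : nbhs x U by exact: open_nbhs_nbhs.
  apply: cvg_near_cst; near=> k.
  have -> : w k x = 0; last by [].
  rewrite /w ax /b /shiftf /a indicE mem_set ?subrr ?maxxx//.
  apply: Hr; rewrite mx_norm_ball /ball_/= opprD addNKr normrN.
  apply: le_lt_trans (hk k) _; near: k; exact: near_infty_natSinv_lt (PosNum r0).
have [M HM] := nrm_dct (lexx 1) mw ma Na wa w0 e20.
have HN := HM M (leqnn _); apply: (Nh M).
have shiftE : (\int[mu]_x (b M x)%:E = \int[mu]_x (a x)%:E)%E.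
  apply: (ge0_integral_shift (h M) (f := fun x => (a x)%:E)).
    exact/measurable_EFinP.
  by move=> x; rewrite lee_fin; have [->|->] := a01 x.
have aE : (\int[mu]_x (a x)%:E = mu U)%E.
  by rewrite integral_indic// setIT.
have key : (\int[mu]_x (b M x)%:E + 2%:E * nrm mu 1 (w M) =
            \int[mu]_x (a x)%:E + nrm mu 1 (b M - a))%E.
  rewrite !nrm1E -ge0_integralZl//; last first.
    by apply/measurable_EFinP; exact: measurableT_comp.
  rewrite -!ge0_integralD//.
  - apply: eq_integral => x _; rewrite -!EFinM -!EFinD; congr EFin.
    rewrite /w !fctE; have [->|->] := a01 x; have [->|->] := b01 M x.
    + by rewrite subrr maxxx normr0; ring.
    + by rewrite sub0r subr0 max_r ?oppr_le0// normr0 normr1; ring.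
    + by rewrite sub0r subr0 max_l// normr1 normrN normr1; ring.
    + by rewrite subrr maxxx normr0; ring.
  - by move=> x _; rewrite lee_fin; have [->|->] := a01 x.
  - exact/measurable_EFinP.
  - by apply/measurable_EFinP; apply: measurableT_comp => //; exact: measurable_funB.
  - by move=> x _; rewrite lee_fin; have [->|->] := b01 M x.
  - exact/measurable_EFinP.
  - by apply/measurable_EFinP; apply: measurable_funM => //; exact: measurableT_comp.
rewrite -/a -[shiftf _ _]/(b M).
have fU : mu U \is a fin_num by rewrite ge0_fin_numE.
have : (nrm mu 1 (b M - a) = 2%:E * nrm mu 1 (w M))%E.
  move: key; rewrite shiftE aE => /(congr1 (fun z => z - mu U)%E).
  by rewrite ![(mu U + _)%E]addeC !addeK.
move=> ->; apply: (@le_trans _ _ (2%:E * (e / 2)%:E)%E).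
  by rewrite lee_wpmul2l ?lee_fin.
by rewrite -EFinM lee_fin mulrC divfK.
Unshelve. all: by end_near. Qed.

(** Intersecting with a fixed open set of finite measure keeps every indicator in L^1. The good sets
    [A] then form a Dynkin system that contains the open sets, a pi-system generating the Borel
    sets. *)
Lemma shift_continuous_bounded C A : open C -> (mu C < +oo)%E -> measurable A ->
  shift_continuous 1 (\1_(A `&` C) : V -> R).
Proof.
move=> oC Coo mA.
have mC := open_measurable_rV oC.
have mI (B : set V) : measurable B -> measurable_fun setT (\1_(B `&` C) : V -> R).
  by move=> mB; apply: measurable_indic; exact: measurableI.
have muI (B : set V) : measurable B -> (mu (B `&` C) < +oo)%E.
  move=> mB; apply: le_lt_trans Coo; apply: le_measure; rewrite ?inE//.
  exact: measurableI.
have sC : shift_continuous 1 (\1_C : V -> R) by exact: shift_continuous_open.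
apply: (@dynkin_induction _ _ (@open V) (fun A => shift_continuous 1 (\1_(A `&` C) : V -> R))).
- exact: measurable_rV_opens.
- by move=> U W oU oW; exact: openI.
- by rewrite setTI.
- move=> U oU; apply: shift_continuous_open; first exact: openI.
  by apply: muI; exact: open_measurable_rV.
- move=> B mB sB.
  have -> : \1_(~` B `&` C) = \1_C + (-1) *: \1_(B `&` C) :> (V -> R).
    apply/funext => x; rewrite !fctE !indicE !in_setI in_setC.
    by case: (x \in B); case: (x \in C); rewrite /GRing.scale/=; ring.
  apply: shift_continuousD => //.
  + by apply: measurable_funM => //; exact: mI.
  + by apply: shift_continuousZ => //; exact: mI.
- move=> F mF tF sF.
  pose S m : V -> R := \sum_(k < m) \1_(F k `&` C).
  have mS m : measurable_fun setT (S m).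
    rewrite (_ : S m = (fun x => \sum_(k < m) \1_(F k `&` C) x)).
      by apply: measurable_sum => k; exact: mI.
    by apply/funext => x; rewrite /S fct_sumE.
  have sS m : shift_continuous 1 (S m).
    rewrite /S; elim: m => [|m ih].
      by rewrite big_ord0; exact: shift_continuous0.
    rewrite big_ord_recr/=; apply: shift_continuousD => //; first exact: mS.
    exact: mI.
  have mUF : measurable (\bigcup_k F k) by exact: bigcup_measurable.
  apply: shift_continuous_lim => //; first exact: mI.
  move=> e e0.
  (* By disjointness the partial sum is the indicator of the union of the first [m] sets within [C].
     The error is therefore dominated by the indicator of [C] and is eventually 0 at each point. *)
  have SE x m : S m x = if `[< exists2 j, (j < m)%N & F j x >] then \1_C x else 0.
    rewrite /S fct_sumE; case: asboolP => [[j jm Fjx]|nF]; last first.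
      apply: big1 => k _; rewrite indicE in_setI.
      rewrite [x \in F k]memNset//= => Fkx; apply: nF; exists k => //.
    rewrite (bigD1 (Ordinal jm))//= big1 ?addr0.
      by rewrite !indicE in_setI [x \in F j]mem_set.
    move=> k kj; rewrite indicE in_setI [x \in F k]memNset// => Fkx.
    move/trivIsetP : tF => /(_ k j I I) H.
    have : (F k `&` F j) x by [].
    rewrite H//; apply: contraNN kj => /eqP kj; apply/eqP/val_inj => //=.
  pose u m : V -> R := \1_(\bigcup_k F k `&` C) - S m.
  have mu' m : measurable_fun setT (u m) by apply: measurable_funB => //; exact: mI.
  have NC : (nrm mu 1 (\1_C : V -> R) < +oo)%E by rewrite nrm_indic// invr1 poweRe1.
  have uC m x : `|u m x| <= `|\1_C x : R|.
    rewrite /u !fctE SE !indicE in_setI; case: asboolP => [[j jm Fjx]|nF].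
      rewrite [x \in \bigcup_k F k]mem_set ?subrr ?normr0//; last by exists j.
    by rewrite subr0; case: (_ \in \bigcup_k F k); rewrite //= normr0.
  have u0 x : u m x @[m --> \oo] --> 0.
    have [[j _ Fjx]|nF] := pselect ((\bigcup_k F k) x).
      apply: cvg_near_cst; near=> m; rewrite /u !fctE SE asboolT; last first.
        by exists j => //; near: m; exact: nbhs_infty_gt.
      by rewrite !indicE in_setI mem_set ?subrr//; exists j.
    rewrite (_ : _ ^~ x = cst 0); first exact: cvg_cst.
    apply/funext => m; rewrite /u !fctE SE asboolF; last first.
      by move=> [j _ Fjx]; apply: nF; exists j.
    by rewrite indicE in_setI memNset// subr0.
  have [M HM] := nrm_dct (lexx 1) mu' (measurable_indic mC) NC uC u0 e0.
  by exists (S M); split => //; exact: HM.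
- by rewrite -measurable_rV_opens.
Unshelve. all: by end_near. Qed.

End translation_indicators.

Import HBNNSimple.

(** * Continuity of translations in L^p *)

Section translation_Lp.
Context {R : realType} {n : nat}.
Local Notation V := 'rV[R]_n.
Local Notation mu := (lebesgue_rV R n).
Implicit Types (f g : V -> R) (h : V) (A U C : set V).

Lemma ball_cube (r : R) : ball (0 : V) r `<=` cube r.
Proof.
move=> x; rewrite mx_norm_ball /ball_/= sub0r normrN => xr.
by apply/cubeP => i; exact: le_trans (norm_coord _ _) (ltW xr).
Qed.

Lemma cubeE (r : R) : 0 <= r -> cube r = [set x : V | `|x| <= r].
Proof.
move=> r0; apply/seteqP; split => x /=.
  by move=> /cubeP; exact: norm_coord_le.
by move=> xr; apply/cubeP => i; exact: le_trans (norm_coord _ _) xr.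
Qed.

Lemma shift_continuous1_indic A : measurable A -> (mu A < +oo)%E ->
  shift_continuous 1 (\1_A : V -> R).
Proof.
move=> mA Aoo; apply: shift_continuous_lim => //.
move=> e e0.
pose C (k : nat) : set V := ball (0 : V) k%:R.
have oC k : open (C k) by exact: ball_open.
have mC k := open_measurable_rV (oC k).
have Coo k : (mu (C k) < +oo)%E.
  have := lebesgue_cube_fin (k%:R : R) (n := n).
  rewrite ge0_fin_numE// => cfin; apply: le_lt_trans cfin.
  by apply: le_measure; rewrite ?inE//; [exact: measurable_cube|exact: ball_cube].
pose u k : V -> R := \1_A - \1_(A `&` C k).
have mI k : measurable_fun setT (\1_(A `&` C k) : V -> R).
  by apply: measurable_indic; exact: measurableI.
have mu' k : measurable_fun setT (u k) by exact: measurable_funB.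
have NA : (nrm mu 1 (\1_A : V -> R) < +oo)%E by rewrite nrm_indic// invr1 poweRe1.
have uA k x : `|u k x| <= `|\1_A x : R|.
  rewrite /u !fctE !indicE in_setI.
  by case: (x \in A); case: (x \in C k); rewrite /= ?subrr ?subr0 ?normr0.
have u0 x : u k x @[k --> \oo] --> 0.
  apply: cvg_near_cst; near=> k; rewrite /u !fctE !indicE in_setI.
  have -> : (x \in C k) = true; last by rewrite andbT subrr.
  apply/mem_set; rewrite /C mx_norm_ball /ball_/= sub0r normrN.
  near: k; have [M _ HM] := nbhs_infty_gtr `|x|; exists M => // k /HM.
have [M HM] := nrm_dct (lexx 1) mu' (measurable_indic mA) NA uA u0 e0.
by exists (\1_(A `&` C M)); split => //; [exact: shift_continuous_bounded|exact: HM].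
Unshelve. all: by end_near. Qed.

Variable p : R.
Hypothesis p1 : 1 <= p.
Let p0 : 0 < p. Proof. exact: lt_le_trans p1. Qed.
Local Notation N := (nrm mu p).

(** A difference of indicators takes its values in {-1, 0, 1}, so its p-th power in absolute value
    is its absolute value: the case of L^1 with bound e^p suffices. *)
Lemma shift_continuous_indic A : measurable A -> (mu A < +oo)%E ->
  shift_continuous p (\1_A : V -> R).
Proof.
move=> mA Aoo e e0.
have [r r0 Hr] := shift_continuous1_indic mA Aoo (powR_gt0 p e0).
exists r => // h /Hr H; rewrite (nrm_le_pow _ p1 _ (ltW e0)).
move: H; rewrite nrm1E; congr (_ <= _)%E; apply: eq_integral => x _; congr EFin.
rewrite /shiftf !fctE !indicE.
case: (_ \in A); case: (_ \in A);
  rewrite /= ?subrr ?subr0 ?sub0r ?normrN ?normr1 ?normr0 ?powR1 ?powR0// ?gt_eqF//.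
Qed.

Lemma shift_continuous_sum (I : eqType) (s : seq I) (F : I -> V -> R) :
  (forall i, i \in s -> measurable_fun setT (F i)) ->
  (forall i, i \in s -> shift_continuous p (F i)) ->
  measurable_fun setT (\sum_(i <- s) F i) /\
  shift_continuous p (\sum_(i <- s) F i).
Proof.
elim: s => [|i s ih] mF sF.
  by rewrite big_nil; split; [exact: measurable_cst|exact: shift_continuous0].
have [||ms ss] := ih.
- by move=> j js; apply: mF; rewrite inE js orbT.
- by move=> j js; apply: sF; rewrite inE js orbT.
have mi := mF i (mem_head _ _); rewrite big_cons; split; first exact: measurable_funD.
by apply: shift_continuousD => //; exact: (sF i (mem_head _ _)).
Qed.

(** Chebyshev's inequality, which puts the indicators of the nonzero levels of an approximating
    simple function within reach of the previous lemmas. *)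
Lemma nrm_finite_level f (y : R) : measurable_fun setT f -> (N f < +oo)%E -> y != 0 ->
  (mu (f @^-1` [set y]) < +oo)%E.
Proof.
move=> mf Nf y0.
have mA : measurable (f @^-1` [set y]).
  by rewrite -[X in measurable X]setTI; exact: mf.
have : (N (y *: \1_(f @^-1` [set y])) <= N f)%E.
  apply: nrm_le => //.
    by apply: measurable_funM => //; exact: measurable_indic.
  move=> x; rewrite !fctE indicE; case: (boolP (x \in _)) => [/set_mem/= ->|_].
    by rewrite [_ *: _]mulr1.
  by rewrite [_ *: _]mulr0 normr0.
rewrite (nrmZ mu p1 y (measurable_indic mA)).
rewrite nrm_indic// => /le_lt_trans/(_ Nf).
move=> H; apply: (@lty_poweRy _ _ p^-1); first by rewrite invr_neq0// gt_eqF.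
have y1 : (0 < `|y|)%R by rewrite normr_gt0.
move: H; case: (mu _ `^ _)%E (poweR_ge0 (mu (f @^-1` [set y])) p^-1) => [r| |]//= _.
  by move=> _; rewrite ltry.
by rewrite gt0_muley ?lte_fin.
Qed.

Lemma shift_continuous_ge0 f : measurable_fun setT f -> (N f < +oo)%E ->
  (forall x, 0 <= f x) -> shift_continuous p f.
Proof.
move=> mf Nf f0.
have mfE : measurable_fun setT (EFin \o f) by exact/measurable_EFinP.
pose g := nnsfun_approx measurableT mfE.
have fE0 x : setT x -> (0 <= (EFin \o f) x)%E by move=> _; rewrite lee_fin.
have mg k : measurable_fun setT (g k : V -> R) by exact: measurable_funPT.
have gf k x : g k x <= f x.
  by rewrite -lee_fin /g nnsfun_approxE; exact: (le_approx k fE0 I).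
have glim x : g k x @[k --> \oo] --> f x.
  have := @cvg_nnsfun_approx _ _ _ _ measurableT _ mfE fE0 x I.
  by move/fine_cvgP => [].
pose u k : V -> R := f - (g k : V -> R).
have mu' k : measurable_fun setT (u k) by exact: measurable_funB.
have uf k x : `|u k x| <= `|f x|.
  rewrite /u !fctE !ger0_norm ?subr_ge0 ?gf// gerBl; exact: fun_ge0.
have u0 x : u k x @[k --> \oo] --> 0.
  rewrite -(subrr (f x)); apply: cvgB; [exact: cvg_cst|exact: glim].
apply: shift_continuous_lim => // e e0.
have [M HM] := nrm_dct p1 mu' mf Nf uf u0 e0.
exists (g M); split; [exact: mg| |exact: HM].
have Ng : (N (g M : V -> R) < +oo)%E.
  apply: le_lt_trans Nf; apply: nrm_le => // x.
  by rewrite !ger0_norm ?gf//; exact: fun_ge0.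
have gE : (g M : V -> R) = \sum_(y <- fset_set (range (g M)))
    y *: (\1_(g M @^-1` [set y]) : V -> R).
  apply/funext => x; rewrite fct_sumE (fimfunE (g M) x) fsbig_finite//=.
rewrite gE; apply: (shift_continuous_sum _ _).2 => y _.
  by apply: measurable_funM => //; exact: measurable_indic.
(* The level set of 0 may have infinite measure, but its term in the sum is zero. *)
have [->|y0] := eqVneq y 0; first by rewrite scale0r; exact: shift_continuous0.
apply: shift_continuousZ => //.
apply: shift_continuous_indic; first by [].
exact: nrm_finite_level.
Qed.

Lemma shift_continuous_Lp f : measurable_fun setT f -> (N f < +oo)%E ->
  shift_continuous p f.
Proof.
move=> mf Nf.
pose a x := Num.max (f x) 0; pose b x := Num.max (- f x) 0.
have ma : measurable_fun setT a by exact: measurable_maxr.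
have mb : measurable_fun setT b by apply: measurable_maxr => //; exact: measurable_funN.
have fE : f = a + (-1) *: b.
  apply/funext => x; rewrite !fctE /a /b /GRing.scale/= mulN1r.
  have [f0|f0] := leP (f x) 0; first by rewrite max_l ?oppr_ge0// sub0r opprK.
  by rewrite max_r ?oppr_le0 ?(ltW f0)// subr0.
have Na : (N a < +oo)%E.
  apply: le_lt_trans Nf; apply: nrm_le => // x; rewrite /a.
  by have [f0|f0] := leP (f x) 0; rewrite ?normr0.
have Nb : (N b < +oo)%E.
  apply: le_lt_trans Nf; apply: nrm_le => // x; rewrite /b.
  by have [f0|f0] := leP (- f x) 0; rewrite ?normr0 ?normrN.
rewrite fE; apply: shift_continuousD => //.
- by apply: measurable_funM.
- by apply: shift_continuous_ge0 => // x; rewrite le_max lexx orbT.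
- apply: shift_continuousZ => //.
  by apply: shift_continuous_ge0 => // x; rewrite le_max lexx orbT.
Qed.

End translation_Lp.

(** * Test functions and mollification *)

Section test_functions.
Context {R : realType} {n : nat}.
Local Notation V := 'rV[R]_n.
Local Notation mu := (lebesgue_rV R n).
Local Notation e := (delta_mx ord0).
Implicit Types (f g phi psi rho : V -> R) (h x y z : V) (i : 'I_n) (r c : R).

Lemma norm_continuousP f :
  (forall x (d : R), 0 < d -> exists2 r, 0 < r & forall y, `|x - y| < r -> `|f x - f y| <= d) ->
  continuous f.
Proof.
move=> H.
have K (y : V) : f z @[z --> y] --> f y.
  have F' : Filter (nbhs y) by exact: (@nbhs_filter V y).
  apply/(@cvgrPdist_le _ _ _ _ F') => d d0; have [r r0 Hr] := H y d d0.
  by apply/nbhs_ballP; exists r => //= z; rewrite mx_norm_ball; exact: Hr.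
exact: K.
Qed.

Definition vanish_off (K : set V) f := forall x, ~ K x -> f x = 0.

(** The class C_c^oo of the whole space, with a cube in place of a compact support: cubes pass
    easily through products, derivatives and translations. [test_functionT] identifies it with
    [test_function setT]. *)
Definition Ctest phi := Csmooth phi /\ exists r, vanish_off (cube r) phi.

Lemma cube_le r (s : R) : r <= s -> cube r `<=` (cube s : set V).
Proof. by move=> rs x /cubeP H; apply/cubeP => i; exact: le_trans (H i) rs. Qed.

Lemma vanish_off_le r (s : R) f : r <= s -> vanish_off (cube r) f -> vanish_off (cube s) f.
Proof. by move=> rs Hf x xs; apply: Hf => xr; apply: xs; exact: cube_le xr. Qed.

Lemma compact_cube r : compact (cube r : set V).
Proof. by apply: (@rV_compact R n (fun=> `[- r, r]%classic)) => _; exact: segment_compact. Qed.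

Lemma closed_cube r : closed (cube r : set V).
Proof. by apply: compact_closed; [exact: norm_hausdorff|exact: compact_cube]. Qed.

Lemma bounded_sub_cube (K : set V) : compact K -> exists2 r, 0 <= r & K `<=` cube r.
Proof.
move=> /compact_bounded[M [_ HM]]; exists (`|M| + 1).
  by rewrite addr_ge0.
move=> x Kx; apply/cubeP => i; apply: le_trans (norm_coord _ _) _.
by apply: HM => //; rewrite ltr_pwDr// ler_norm.
Qed.

Lemma partial_eq0_open (U : set V) i f : open U -> (forall x, U x -> f x = 0) ->
  forall x, U x -> partial i f x = 0.
Proof.
move=> oU f0 x Ux; rewrite /partial (@near_eq_derive _ _ _ f (cst 0)) ?derive_cst//.
have : nbhs x U by exact: open_nbhs_nbhs.
by apply: filterS => y /f0.
Qed.

Lemma vanish_off_partial (K : set V) i f : closed K -> vanish_off K f ->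
  vanish_off K (partial i f).
Proof.
by move=> cK Hf x; apply: (@partial_eq0_open (~` K)) => //; exact: closed_openC.
Qed.

Lemma vanish_off_partials (K : set V) s f : closed K -> vanish_off K f ->
  vanish_off K (partials s f).
Proof. by move=> cK Hf; elim: s => //= i s; exact: vanish_off_partial. Qed.

Lemma Ctest_partial i phi : Ctest phi -> Ctest (partial i phi).
Proof.
move=> [sp [r Hr]]; split; first exact: smooth_partial.
by exists r; apply: vanish_off_partial => //; exact: closed_cube.
Qed.

Lemma Ctest_partials s phi : Ctest phi -> Ctest (partials s phi).
Proof. by move=> tp; elim: s => //= i s; exact: Ctest_partial. Qed.

Lemma CtestMl f phi : Csmooth f -> Ctest phi -> Ctest (f * phi).
Proof.
move=> sf [sp [r Hr]]; split; first exact: smoothM.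
by exists r => x xr; rewrite fctE Hr// mulr0.
Qed.

Lemma CtestZ c phi : Ctest phi -> Ctest (c *: phi).
Proof.
move=> [sp [r Hr]]; split; first exact: smoothZ.
by exists r => x xr; rewrite fctE Hr// scaler0.
Qed.

Lemma CtestN phi : Ctest phi -> Ctest (- phi).
Proof. by rewrite -scaleN1r; exact: CtestZ. Qed.

Lemma vanish_off_shift h r phi : vanish_off (cube r) phi ->
  vanish_off (cube (r + `|h|)) (fun x => phi (x + h)).
Proof.
move=> Hr x xr; apply: Hr => /cubeP H; apply: xr; apply/cubeP => i.
have := H i; rewrite mxE => Hi.
rewrite -[x ord0 i](addrK (h ord0 i)) (le_trans (ler_normB _ _))// lerD//.
exact: norm_coord.
Qed.

Lemma Ctest_shift h phi : Ctest phi -> Ctest (fun x => phi (x + h)).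
Proof.
move=> [sp [r Hr]]; split; first exact: smooth_shift.
by exists (r + `|h|); exact: vanish_off_shift.
Qed.

Lemma Ctest_supp phi : Ctest phi -> exists2 r, 0 <= r & vanish_off (cube r) phi.
Proof.
move=> [_ [r Hr]]; exists (Num.max r 0); first by rewrite le_max lexx orbT.
by apply: vanish_off_le Hr; rewrite le_max lexx.
Qed.

Lemma Ctest_bounded phi : Ctest phi -> exists2 M, 0 <= M & forall x, `|phi x| <= M.
Proof.
move=> tp; have [r r0 Hr] := Ctest_supp tp.
have [|||c cr Hc] := @EVT_max_rV R n (fun x => `|phi x|) (cube r).
- by exists 0; apply/cubeP => i; rewrite mxE normr0.
- exact: compact_cube.
- apply: continuous_subspaceT => x.
  by apply: continuous_comp; [exact: (smooth_continuous tp.1)|exact: norm_continuous].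
exists `|phi c| => // x; have [xr|xr] := pselect (cube r x).
  by apply: Hc; rewrite inE.
by rewrite Hr// normr0.
Qed.

(** The increment is decomposed by moving one coordinate at a time, each move being controlled by
    the mean value theorem; this accounts for the factor [n]. *)
Lemma Csmooth_lip phi (M : R) : Csmooth phi ->
  (forall i y, `|partial i phi y| <= M) ->
  forall x h, `|phi (x + h) - phi x| <= n%:R * M * `|h|.
Proof.
move=> sp HM x h.
have M0 i : 0 <= M by exact: le_trans (HM i 0).
have H (s : seq 'I_n) :
    `|phi (x + \sum_(i <- s) h ord0 i *: e i) - phi x| <= (size s)%:R * M * `|h|.
  elim: s => [|i s ih].
    by rewrite big_nil addr0 subrr normr0 mul0r mul0r.
  rewrite big_cons [_ *: _ + _]addrC addrA /=.
  apply: le_trans (ler_distD (phi (x + \sum_(j <- s) h ord0 j *: e j)) _ _) _.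
  rewrite -[(size s).+1]addn1 natrD 2!mulrDl mul1r [leRHS]addrC lerD//.
  apply: le_trans (smooth_line_lip _ _ sp (HM i)) _.
  by rewrite ler_wpM2l ?(M0 i)// norm_coord.
have := H (index_enum 'I_n); rewrite -row_sum_delta.
suff -> : size (index_enum 'I_n) = n by [].
by rewrite -[RHS]card_ord cardE enumT.
Qed.

Lemma Ctest_lip phi : Ctest phi ->
  exists2 L, 0 <= L & forall x y, `|phi x - phi y| <= L * `|x - y|.
Proof.
move=> tp.
have /choice[M HM] : forall i, exists M : R, forall y, `|partial i phi y| <= M.
  by move=> i; have [M _ HM] := Ctest_bounded (Ctest_partial i tp); exists M.
have M0 i : 0 <= M i by exact: le_trans (HM i 0).
have HMS i y : `|partial i phi y| <= \sum_j M j.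
  by apply: le_trans (HM i y) _; rewrite (bigD1 i)//= lerDl sumr_ge0.
exists (n%:R * \sum_j M j); first by rewrite mulr_ge0// sumr_ge0.
move=> x y; have := Csmooth_lip tp.1 HMS y (x - y).
by rewrite [y + _]addrC subrK.
Qed.

(** Local integrability tested on cubes only; [L1locT] shows that nothing is lost with respect to
    compact sets. *)
Definition lint f := measurable_fun setT f /\
  forall r, mu.-integrable (cube r) (EFin \o f).

Lemma lint_cst c : lint (cst c).
Proof.
split=> // r; apply: measurable_bounded_integrable.
- exact: measurable_cube.
- by rewrite -ge0_fin_numE//; exact: lebesgue_cube_fin.
- exact: measurable_cst.
- exact: bounded_cst.
Qed.

Lemma Csmooth_measurable f : Csmooth f -> measurable_fun setT f.
Proof. by move=> sf; apply: measurable_continuous; exact: smooth_continuous. Qed.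

Lemma integrable_patch_cube f r : lint f ->
  mu.-integrable setT (EFin \o (f \_ (cube r))).
Proof.
move=> [mf Hf]; have := (integrable_mkcond (EFin \o f) (measurable_cube r)).1 (Hf r).
apply: eq_integrable => // x _; rewrite /= /patch; by case: ifP.
Qed.

Lemma integrable_mul f g r (M : R) : lint f -> measurable_fun setT g ->
  (forall x, `|g x| <= M) -> vanish_off (cube r) g ->
  mu.-integrable setT (EFin \o (f * g)).
Proof.
move=> lf mg gM g0; have [mf _] := lf.
have := integrableZl measurableT M (integrable_patch_cube r lf).
apply: le_integrable => //.
  by apply/measurable_EFinP; exact: measurable_funM.
move=> x _ /=; rewrite lee_fin !normrM; rewrite /patch; case: ifPn => xr.
  by rewrite mulrC ler_wpM2r// (le_trans (gM x))// ler_norm.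
by rewrite g0 ?normr0 ?mulr0// => H; move: xr; rewrite mem_set.
Qed.

Lemma integrable_test f phi : lint f -> Ctest phi -> mu.-integrable setT (EFin \o (f * phi)).
Proof.
move=> lf tp; have [M _ HM] := Ctest_bounded tp; have [r _ Hr] := Ctest_supp tp.
by apply: integrable_mul HM Hr => //; exact: (Csmooth_measurable tp.1).
Qed.

(** The factor [c] allows two uses: [c = 1] for the invariance of the integral under translations,
    [c = -1] for mollification, where the variable enters the kernel with a minus sign. *)
Lemma diff_under_integral f phi i c : lint f -> Ctest phi ->
  derivable (fun s : R => \int[mu]_z (f z * phi (z + (c * s) *: e i))) 0 1 /\
  derive1 (fun s : R => \int[mu]_z (f z * phi (z + (c * s) *: e i))) 0 =
    c * \int[mu]_z (f z * partial i phi z).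
Proof.
move=> lf tp; have [mf _] := lf.
have [r r0 Hr] := Ctest_supp tp.
have tdp := Ctest_partial i tp.
have [M M0 HM] := Ctest_bounded tdp.
have Hdr : vanish_off (cube r) (partial i phi).
  by apply: vanish_off_partial => //; exact: closed_cube.
pose F (s : R) (z : V) := f z * phi (z + (c * s) *: e i).
have dF (s : R) z : is_derive s (1 : R) (F ^~ z) (f z * (c * partial i phi (z + (c * s) *: e i))).
  have [dE DE] := derive_line phi (e i) z (c * s).
  have dL : is_derive (c * s) (1 : R) (fun s : R => phi (z + s *: e i))
      (partial i phi (z + (c * s) *: e i)).
    by split; [rewrite dE; apply: smooth_derivable; exact: tp.1|rewrite DE].
  have dc : is_derive s (1 : R) (fun s : R => c * s) c.
    by rewrite -[X in is_derive _ _ _ X]mulr1; exact: (@is_deriveZ _ _ _ id c s 1 1).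
  have dC := @is_derive1_comp _ (fun s : R => phi (z + s *: e i)) (fun s => c * s) s _ _ dL dc.
  rewrite [c * _]mulrC; exact: (@is_deriveZ _ _ _ _ (f z) s 1 _ dC).
(* For |s| < 1 the translates of [partial i phi] all vanish off the cube of size [r + |c|], which
   gives a dominating function independent of [s]. *)
pose G (z : V) : R := M * `|c| * `|(f \_ (cube (r + `|c|))) z|.
have G0 z : 0 <= G z by rewrite !mulr_ge0.
have iG : mu.-integrable setT (EFin \o G).
  have := integrableZl measurableT (M * `|c|) (integrable_abse (integrable_patch_cube (r + `|c|) lf)).
  by apply: eq_integrable => // z _; rewrite /= EFinM.
have iF (s : R) : `]-1, 1[%classic s -> mu.-integrable setT (EFin \o F s).
  by move=> _; apply: integrable_test => //; exact: Ctest_shift.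
have derF (s : R) z : `]-1, 1[%classic s -> setT z -> derivable (F ^~ z) s 1.
  by move=> _ _; have [] := dF s z.
have d1F (s : R) z : partial1of2 F s z = f z * (c * partial i phi (z + (c * s) *: e i)).
  by rewrite partial1of2E; have [_ ->] := dF s z.
have Gub (s : R) z : `]-1, 1[%classic s -> setT z -> `|partial1of2 F s z| <= G z.
  rewrite /= in_itv/= => /andP[s1 s2] _; rewrite d1F !normrM /G /patch.
  case: ifPn => zr.
    rewrite mulrC [M * _]mulrC ler_wpM2r// ler_wpM2l//.
  rewrite Hdr ?normr0 ?mulr0// => /cubeP H; move: zr; rewrite mem_set//.
  apply/cubeP => j; have := H j; rewrite mxE => Hj.
  rewrite -[z ord0 j](addrK (((c * s) *: e i : V) ord0 j)) (le_trans (ler_normB _ _))// lerD//.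
  rewrite (le_trans (norm_coord _ _))// normrZ normr_delta mulr1 normrM.
  by rewrite ler_piMr// ler_norml !ltW.
have I0 : `]-1, 1[%classic (0 : R) by rewrite /= in_itv/= ltr01 oppr_lt0 ltr01.
split; first exact: (@derivable_under_integral R _ _ mu F setT measurableT 0 (-1) 1 I0 iF derF G G0 iG Gub).
rewrite (@differentiation_under_integral R _ _ mu F setT measurableT 0 (-1) 1 I0 iF derF G G0 iG Gub).
rewrite -RintegralZl//; last exact: integrable_test.
apply: eq_Rintegral => z _; rewrite d1F mulr0 scale0r addr0.
by rewrite !mulrA [f z * c]mulrC.
Qed.

(* The integral of a translate of [phi] does not depend on the translation. *)
Lemma integral_partial phi i : Ctest phi -> \int[mu]_z partial i phi z = 0.
Proof.
move=> tp.
have [_] := diff_under_integral i 1 (lint_cst 1) tp.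
rewrite mul1r; under [in RHS]eq_Rintegral do rewrite mul1r.
move=> <-.
have -> : (fun s : R => \int[mu]_z (cst 1 z * phi (z + (1 * s) *: e i))) =
    cst (\int[mu]_z phi z).
  apply/funext => s.
  transitivity (\int[mu]_z phi (z + (1 * s) *: e i)).
    by apply: eq_Rintegral => z _; rewrite [LHS]mul1r.
  apply: (Rintegral_shift ((1 * s) *: e i)).
  have := integrable_test (lint_cst 1) tp.
  by apply: eq_integrable => // x _; rewrite /= mul1r.
by rewrite derive1_cst.
Qed.

Lemma integrable_Ctest phi : Ctest phi -> mu.-integrable setT (EFin \o phi).
Proof.
move=> /(integrable_test (lint_cst 1)); apply: eq_integrable => // x _.
by rewrite /= [X in X%:E]mul1r.
Qed.

Definition weak_partial i f g := forall phi, Ctest phi ->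
  \int[mu]_z (f z * partial i phi z) = - \int[mu]_z (g z * phi z).

(** Integration by parts: the product [f * phi] is a test function, so its partial derivative has
    integral 0. *)
Lemma weak_partial_smooth i f : Csmooth f -> weak_partial i f (partial i f).
Proof.
move=> sf phi tp.
have tfp := CtestMl sf tp.
have := integral_partial i tfp; rewrite partialM//; last exact: tp.1.
have i1 : mu.-integrable setT (EFin \o (f * partial i phi)).
  by apply/integrable_Ctest/CtestMl => //; exact: Ctest_partial.
have i2 : mu.-integrable setT (EFin \o (phi * partial i f)).
  rewrite mulrC; apply/integrable_Ctest/CtestMl => //; exact: smooth_partial.
rewrite -[X in Rintegral _ _ X]/(fun z => (f * partial i phi) z + (phi * partial i f) z).
rewrite RintegralD// => /eqP; rewrite addr_eq0 => /eqP ->.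
by congr (- _); apply: eq_Rintegral => z _; rewrite [LHS]mulrC.
Qed.

(** A correlation, that is, the convolution with the reflected kernel. Each derivative passed to
    [rho] brings a minus sign, which cancels the one in the definition of weak derivatives. *)
Definition mollify f rho : V -> R := fun x => \int[mu]_z (f z * rho (z - x)).

Lemma convE f rho x : lint f -> Ctest rho ->
  mollify f rho x = \int[mu]_y (f (x + y) * rho y).
Proof.
move=> lf tr.
apply: etrans (esym (Rintegral_shift x (integrable_test lf (Ctest_shift (- x) tr)))) _.
by apply: eq_Rintegral => y _; rewrite !fctE addrK addrC.
Qed.

Lemma conv_out f rho x r : vanish_off (cube r) rho ->
  (forall h, cube r h -> f (x + h) = 0) -> mollify f rho x = 0.
Proof.
move=> Hr fx; rewrite /mollify (_ : (fun z => _) = cst 0); last first.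
  apply/funext => z /=; have [zr|zr] := pselect (cube r (z - x)).
    by have := fx _ zr; rewrite addrC subrK => ->; rewrite mul0r.
  by rewrite Hr// mulr0.
by rewrite /Rintegral integral0.
Qed.

Lemma conv_continuous f rho : lint f -> Ctest rho -> continuous (mollify f rho).
Proof.
move=> lf tr; apply: norm_continuousP => x.
have [L L0 HL] := Ctest_lip tr; have [r r0 Hr] := Ctest_supp tr.
(* For [y] within distance 1 of [x], both translated kernels vanish off the cube of size [c]. *)
pose c := r + `|x| + 1.
have ip := integrable_abse (integrable_patch_cube c lf).
pose I := \int[mu]_z `|(f \_ (cube c)) z|.
have I0 : 0 <= I by apply: Rintegral_ge0.
have key y : `|x - y| <= 1 -> `|mollify f rho x - mollify f rho y| <= L * `|x - y| * I.
  move=> xy1.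
  have ix := integrable_test lf (Ctest_shift (- x) tr).
  have iy := integrable_test lf (Ctest_shift (- y) tr).
  have -> : mollify f rho x - mollify f rho y =
      \int[mu]_z ((f * (fun z => rho (z - x))) z - (f * (fun z => rho (z - y))) z).
    by rewrite RintegralB.
  apply: le_trans (le_normr_Rintegral _ _) _ => //.
    have := integrableB measurableT ix iy.
    by apply: eq_integrable => // z _; rewrite /= EFinB.
  rewrite -RintegralZl//.
  apply: le_Rintegral => //.
  - have := integrable_abse (integrableB measurableT ix iy).
    by apply: eq_integrable => // z _; rewrite /= EFinB.
  - have := integrableZl measurableT (L * `|x - y|) ip.
    by apply: eq_integrable => // z _; rewrite /= EFinM.
  move=> z _; rewrite !fctE -mulrBr normrM mulrC.
  rewrite /patch; case: ifPn => zc.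
    rewrite ler_wpM2r// (le_trans (HL _ _))//.
    have -> : z - x - (z - y) = y - x by rewrite opprB addrC addrA subrK.
    by rewrite distrC.
  have out (w : V) : `|x - w| <= 1 -> rho (z - w) = 0.
    move=> w1; apply: Hr => /cubeP H; move: zc; rewrite mem_set//.
    rewrite cubeE ?addr_ge0//=.
    have zw : `|z - w| <= r by exact: norm_coord_le.
    have h1 : `|z| <= `|z - w| + `|w| by rewrite -{1}(subrK w z) ler_normD.
    have h2 : `|w| <= `|x| + `|x - w| by rewrite -{1}[w](subKr x) ler_normB.
    by rewrite /c -addrA (le_trans h1)// lerD// (le_trans h2)// lerD.
  by rewrite !out ?subrr ?normr0 ?mul0r ?mulr_ge0.
move=> d d0.
have LI : 0 < L * I + 1 by rewrite ltr_wpDl// mulr_ge0.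
exists (Num.min 1 (d / (L * I + 1))); first by rewrite lt_min ltr01 divr_gt0.
move=> y; rewrite lt_min => /andP[/ltW xy1 xy2].
apply: le_trans (key y xy1) _.
rewrite mulrAC; apply: (@le_trans _ _ ((L * I + 1) * `|x - y|)).
  by rewrite ler_wpM2r// lerDl.
by rewrite mulrC -ler_pdivlMr// ltW.
Qed.

Lemma conv_derive f rho i x : lint f -> Ctest rho ->
  derivable (mollify f rho) x (e i) /\ partial i (mollify f rho) x = mollify f (- partial i rho) x.
Proof.
move=> lf tr.
have [dE DE] := derive_line (mollify f rho) (e i) x 0.
rewrite scale0r addr0 in dE DE.
have trx := Ctest_shift (- x) tr.
have [dI DI] := diff_under_integral i (-1) lf trx.
have EE : (fun s : R => mollify f rho (x + s *: e i)) =
    (fun s : R => \int[mu]_z (f z * rho (z + (-1 * s) *: e i - x))).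
  apply/funext => s; apply: eq_Rintegral => z _; congr (f z * rho _).
  by rewrite opprD addrA addrAC mulN1r scaleNr.
split; first by rewrite -dE EE.
rewrite -[LHS]/('D_(e i) (mollify f rho) x) -DE EE -derive1E DI.
have ii := integrable_test lf (Ctest_partial i trx).
apply: etrans (esym (RintegralZl (-1) measurableT ii)) _.
apply: eq_Rintegral => z _; rewrite (partial_shift i (- x) tr.1) !fctE.
by rewrite mulN1r mulrN.
Qed.

Lemma smooth_conv f rho : lint f -> Ctest rho -> Csmooth (mollify f rho).
Proof.
move=> lf tr.
apply: (@smooth_coind _ _ [set g | exists2 rho, Ctest rho & g = mollify f rho]); last by exists rho.
move=> _ [{tr}rho tr ->]; split; first exact: conv_continuous.
move=> i; split=> [|x]; last by have [] := conv_derive i x lf tr.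
exists (- partial i rho); first exact/CtestN/Ctest_partial.
by apply/funext => x; have [] := conv_derive i x lf tr.
Qed.

Lemma partial_conv f rho i : lint f -> Ctest rho ->
  partial i (mollify f rho) = mollify f (- partial i rho).
Proof. by move=> lf tr; apply/funext => x; have [] := conv_derive i x lf tr. Qed.

Lemma partials_conv f rho s : lint f -> Ctest rho ->
  partials s (mollify f rho) = mollify f ((-1) ^+ size s *: partials s rho).
Proof.
move=> lf tr; elim: s => [|i s ih] /=; first by rewrite expr0 scale1r.
rewrite ih partial_conv//; last exact/CtestZ/Ctest_partials.
rewrite partialZ; last by have [] := Ctest_partials s tr.
by rewrite exprS mulN1r scaleNr.
Qed.

(** The weak derivative is tested against the kernel centred at [x], which is itself a test
    function. *)
Lemma conv_weak_partial f g rho i : lint f -> lint g -> weak_partial i f g ->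
  Ctest rho -> partial i (mollify f rho) = mollify g rho.
Proof.
move=> lf lg fg tr; rewrite partial_conv//; apply/funext => x.
have tx := Ctest_shift (- x) tr.
have := fg _ tx; rewrite (partial_shift i (- x) tr.1) => /(congr1 -%R).
rewrite opprK => H; apply: etrans H.
have ii := integrable_test lf (Ctest_shift (- x) (Ctest_partial i tr)).
have EE := RintegralZl (-1) measurableT ii; rewrite mulN1r in EE.
refine (etrans _ EE).
by apply: eq_Rintegral => z _; rewrite !fctE mulN1r -mulrN.
Qed.

End test_functions.

(** * Mollification in L^p *)

Section mollification.
Context {R : realType} {n : nat}.
Local Notation V := 'rV[R]_n.
Local Notation mu := (lebesgue_rV R n).
Implicit Types (f g phi psi rho : V -> R) (h x y z : V) (i : 'I_n) (r c : R).

Definition mollifier eta rho := [/\ Ctest rho, forall x, 0 <= rho x,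
  \int[mu]_x rho x = 1 & vanish_off (cube eta) rho].

Section Lp.
Variable p : R.
Hypothesis p1 : 1 <= p.
Let p0 : 0 < p. Proof. exact: lt_le_trans p1. Qed.
Local Notation N := (nrm mu p).

(** The convex function a^p lies above its tangent at [b]. For p > 1 this is Young's inequality with
    exponents p and p/(p-1) applied to [a] and b^(p-1). *)
Lemma powR_tangent (a b : R) : 0 <= a -> 0 <= b ->
  p * (a * b `^ (p - 1)) <= a `^ p + (p - 1) * b `^ p.
Proof.
move=> a0 b0; have [p_gt1|] := ltP 1 p; last first.
  move=> p_le1; have -> : p = 1 by apply/eqP; rewrite eq_le p_le1.
  by rewrite subrr mul0r addr0 powRr0 mulr1 mul1r powRr1.
have q0 : 0 < p / (p - 1) by rewrite divr_gt0// subr_gt0.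
have pn0 : p != 0 by rewrite gt_eqF.
have p1n0 : p - 1 != 0 by rewrite subr_eq0 gt_eqF.
have := conjugate_powR a0 (powR_ge0 b (p - 1)) p0 q0.
have -> : p^-1 + (p / (p - 1))^-1 = 1 by field; rewrite pn0 p1n0.
have -> : (b `^ (p - 1)) `^ (p / (p - 1)) = b `^ p.
  by rewrite -powRrM mulrC divfK.
move=> /(_ erefl) H; rewrite -ler_pdivlMl//; apply: le_trans H _.
move: (a `^ p) (b `^ p) => u v; rewrite le_eqVlt; apply/orP; left; apply/eqP.
by field; rewrite pn0 p1n0.
Qed.

(** On cubes, of finite measure, |f| <= 1 + |f|^p. *)
Lemma lint_Lp f : measurable_fun setT f -> (N f < +oo)%E -> lint f.
Proof.
move=> mf Nf; split => // r.
have ifp : mu.-integrable (cube r) (EFin \o (fun x => `|f x| `^ p)).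
  apply/integrableP; split.
    by apply: measurable_funTS; exact: measurable_abs_powR.
  apply: (@le_lt_trans _ _ (\int[mu]_x (`|f x| `^ p)%:E)%E).
    rewrite (eq_integral (fun x => (`|f x| `^ p)%:E)); last first.
      by move=> x _ /=; rewrite ger0_norm// powR_ge0.
    apply: ge0_subset_integral => //; first exact: measurable_cube.
    exact: measurable_abs_powR.
  by rewrite -(poweR_nrm mu p1); exact: poweR_lty.
have [_ /(_ r) i1] := @lint_cst R n 1.
have := integrableD (measurable_cube r) i1 ifp; apply: le_integrable.
- exact: measurable_cube.
- by apply: measurable_funTS; exact/measurable_EFinP.
move=> x _ /=; rewrite lee_fin [leRHS]ger0_norm ?addr_ge0 ?powR_ge0//.
have [f1|f1] := leP 1 `|f x|.
  by apply: (le_trans (le1r_powR f1 p1)); rewrite lerDr.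
by rewrite (le_trans (ltW f1))// lerDl powR_ge0.
Qed.

(** Jensen's inequality for the probability density [rho]: the tangent inequality at the mean [b] of
    |g| is integrated against [rho]. *)
Lemma jensen_mollifier eta rho (g : V -> R) : mollifier eta rho -> measurable_fun setT g ->
  mu.-integrable setT (EFin \o (g * rho)) ->
  ((`|\int[mu]_y (g y * rho y)| `^ p)%:E <= \int[mu]_y (`|g y| `^ p * rho y)%:E)%E.
Proof.
move=> [tr rho0 rho1 _] mg igr.
have mr : measurable_fun setT rho by apply: Csmooth_measurable; exact: tr.1.
have mgp : measurable_fun setT (fun y => `|g y| `^ p * rho y).
  by apply: measurable_funM => //; apply/measurable_EFinP; exact: measurable_abs_powR.
have ge0p y : 0 <= `|g y| `^ p * rho y by rewrite mulr_ge0// powR_ge0.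
have [oo|fin] := eqVneq (\int[mu]_y (`|g y| `^ p * rho y)%:E)%E +oo%E.
  by rewrite oo leey.
have Ip : mu.-integrable setT (EFin \o (fun y => `|g y| `^ p * rho y)).
  apply/integrableP; split; first exact/measurable_EFinP.
  under eq_integral do rewrite /= ger0_norm//.
  by rewrite ltey.
have Ir : mu.-integrable setT (EFin \o rho) by exact: integrable_Ctest.
pose b := \int[mu]_y (`|g y| * rho y).
have Ia : mu.-integrable setT (EFin \o (fun y => `|g y| * rho y)).
  have := integrable_abse igr; apply: eq_integrable => // y _ /=.
  by rewrite normrM (ger0_norm (rho0 y)).
have b0 : 0 <= b by apply: Rintegral_ge0 => y _; rewrite mulr_ge0.
have lb : `|\int[mu]_y (g y * rho y)| <= b.
  apply: le_trans (le_normr_Rintegral measurableT igr) _.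
  rewrite le_eqVlt; apply/orP; left; apply/eqP; apply: eq_Rintegral => y _.
  by rewrite normrM (ger0_norm (rho0 y)).
have key : b `^ p <= \int[mu]_y (`|g y| `^ p * rho y).
  have I1 : mu.-integrable setT (EFin \o (fun y => p * b `^ (p - 1) * (`|g y| * rho y))).
    have := integrableZl measurableT (p * b `^ (p - 1)) Ia.
    by apply: eq_integrable => // y _; rewrite /= EFinM.
  have I2 : mu.-integrable setT (EFin \o (fun y => (p - 1) * b `^ p * rho y)).
    have := integrableZl measurableT ((p - 1) * b `^ p) Ir.
    by apply: eq_integrable => // y _; rewrite /= EFinM.
  have : \int[mu]_y (p * b `^ (p - 1) * (`|g y| * rho y)) <=
      \int[mu]_y (`|g y| `^ p * rho y + (p - 1) * b `^ p * rho y).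
    apply: le_Rintegral => //.
      have := integrableD measurableT Ip I2.
      by apply: eq_integrable => // y _; rewrite /= EFinD.
    move=> y _; rewrite -mulrDl mulrA ler_wpM2r//.
    have := powR_tangent (normr_ge0 (g y)) b0.
    by rewrite -mulrA [b `^ (p - 1) * _]mulrC.
  rewrite (RintegralZl _ measurableT Ia) (RintegralD measurableT Ip I2).
  rewrite (RintegralZl _ measurableT Ir) rho1 mulr1 -/b.
  rewrite -mulrA [b `^ (p - 1) * b]mulrC mulr_powRB1//.
  by move: (\int[mu]_y _) (b `^ p) => u v; lra.
apply: (@le_trans _ _ (\int[mu]_y (`|g y| `^ p * rho y))%:E).
  by rewrite lee_fin; apply: le_trans key; exact: ler_powR_base.
by rewrite /Rintegral fineK//; exact: integrable_fin_num Ip.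
Qed.

(** The error is the average, with weight [rho], of the differences between [f] and its translates
    by vectors of size at most [eta]. Jensen's inequality puts the p-th power inside the average and
    Tonelli's theorem exchanges the integrals. *)
Lemma conv_approx f eta rho (d : R) : lint f -> mollifier eta rho -> 0 <= d -> 0 <= eta ->
  (forall h, `|h| <= eta -> (N (shiftf h f - f) <= d%:E)%E) ->
  (N (mollify f rho - f) <= d%:E)%E.
Proof.
move=> lf kr d0 eta0 H; have [tr rho0 rho1 rhov] := kr; have [mf _] := lf.
have Ir : mu.-integrable setT (EFin \o rho) by exact: integrable_Ctest.
have mr : measurable_fun setT rho by apply: Csmooth_measurable; exact: tr.1.
pose F (z : V * V) := (`|f (z.1 + z.2) - f z.1| `^ p * rho z.2)%:E.
have mF : measurable_fun setT F.
  apply/measurable_EFinP; apply: measurable_funM.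
    apply: (@measurableT_comp _ _ _ _ _ _ (@powR R ^~ p)) => //.
    apply: measurableT_comp => //; apply: measurable_funB.
      by apply: (measurableT_comp mf); exact: measurable_add2.
    by apply: (measurableT_comp mf); exact: measurable_fst.
  by apply: (measurableT_comp mr); exact: measurable_snd.
have F0 (z : V * V) : (0 <= F z)%E by rewrite lee_fin mulr_ge0// powR_ge0.
rewrite nrm_le_pow//.
have -> : ((d `^ p)%:E = \int[mu]_y ((d `^ p)%:E * (rho y)%:E))%E.
  rewrite integralZl//.
  have E : (\int[mu]_x (rho x)%:E = 1)%E.
    have := fineK (integrable_fin_num measurableT Ir).
    by rewrite -[fine _]/(\int[mu]_x rho x) rho1 => <-.
  by rewrite E mule1.
apply: (@le_trans _ _ (\int[mu]_x \int[mu]_y F (x, y))%E).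
  apply: ge0_le_integral => //.
  - apply/measurable_abs_powR/measurable_funB => //.
    by apply: Csmooth_measurable; exact: smooth_conv.
  - exact: (measurable_fun_fubini_tonelli_F F).
  move=> x _; rewrite !fctE convE//.
  pose g y := f (x + y) - f x.
  have mg : measurable_fun setT g.
    apply: measurable_funB => //; apply: (measurableT_comp mf).
    have -> : +%R x = (fun y : V => y + x) by apply/funext => y; rewrite addrC.
    exact: measurable_addr.
  have I1 : mu.-integrable setT (EFin \o (fun y => f (x + y) * rho y)).
    have := integrable_shift x (integrable_test lf (Ctest_shift (- x) tr)).
    by apply: eq_integrable => // y _; rewrite /= !fctE addrK addrC.
  have I2 : mu.-integrable setT (EFin \o (fun y => f x * rho y)).
    have := integrableZl measurableT (f x) Ir.
    by apply: eq_integrable => // y _; rewrite /= EFinM.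
  have Ig : mu.-integrable setT (EFin \o (g * rho)).
    have := integrableB measurableT I1 I2.
    by apply: eq_integrable => // y _; rewrite /= /g !fctE mulrBl EFinB.
  have -> : \int[mu]_y (f (x + y) * rho y) - f x = \int[mu]_y (g y * rho y).
    rewrite -[f x in LHS]mulr1 -rho1 -(RintegralZl _ measurableT Ir).
    rewrite -(RintegralB measurableT I1 I2).
    by apply: eq_Rintegral => y _; rewrite /g mulrBl.
  exact: (jensen_mollifier kr).
rewrite (fubini_tonelli F)//.
apply: ge0_le_integral => //.
- by move=> y _; exact: integral_ge0.
- exact: (measurable_fun_fubini_tonelli_G F).
- by apply/measurable_EFinP; exact: measurable_funM.
move=> y _; rewrite /F/=.
have [yeta|yeta] := pselect (cube eta y); last first.
  rewrite (rhov _ yeta) mule0 [leLHS](_ : _ = 0%E)//.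
  by apply: integral0_eq => x _; rewrite mulr0.
under eq_integral do rewrite mulrC EFinM.
rewrite ge0_integralZl//; last 2 first.
- apply: measurable_abs_powR; apply: measurable_funB => //.
  exact: measurable_shiftf.
- by rewrite lee_fin.
rewrite muleC lee_wpmul2r ?lee_fin//.
have := H y; rewrite nrm_le_pow//; apply.
by move: yeta; rewrite cubeE.
Qed.

End Lp.

Lemma lebesgue_cubeE (r : R) : 0 <= r -> mu (cube r) = ((r *+ 2) ^+ n)%:E.
Proof.
move=> r0; rewrite lebesgue_rV_box; last by move=> i; exact: measurable_itv.
rewrite (eq_bigr (fun=> (r *+ 2)%:E)); last first.
  move=> i _; rewrite lebesgue_measure_itv/= lte_fin.
  case: ltP => [_|r1]; first by rewrite -EFinD opprK mulr2n.
  have -> : r = 0 by lra.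
  by rewrite mul0rn.
by rewrite prodEFin prodr_const card_ord.
Qed.

Lemma Rintegral_indic_cube (M r : R) : 0 <= r ->
  mu.-integrable setT (EFin \o (fun x : V => M * \1_(cube r) x)) /\
  \int[mu]_x (M * \1_(cube r) x) = M * (r *+ 2) ^+ n.
Proof.
move=> r0.
have I : mu.-integrable setT (EFin \o (\1_(cube r) : V -> R)).
  have := integrable_patch_cube r (lint_cst 1 : lint (cst 1 : V -> R)).
  by apply: eq_integrable => // x _; rewrite /= patchE indicE; case: ifP.
split.
  have := integrableZl measurableT M I.
  by apply: eq_integrable => // x _; rewrite /= EFinM.
rewrite (RintegralZl M measurableT I) /Rintegral integral_indic//; last exact: measurable_cube.
transitivity (M * fine (mu (cube r))); last by rewrite lebesgue_cubeE.
by congr (_ * fine (mu _)); rewrite setIT.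
Qed.

Lemma cube_scale (r t : R) x : 0 < t -> cube r (t *: x) <-> cube (r / t) x.
Proof.
move=> t0; split => /cubeP H; apply/cubeP => i; have := H i.
  by rewrite mxE normrM (gtr0_norm t0) ler_pdivlMr// mulrC.
by rewrite mxE normrM (gtr0_norm t0) ler_pdivlMr// mulrC.
Qed.

(* The bump function rescaled to the cube of size [eta]; its integral is at
   least [e0 * eta ^+ n], where [e0] bounds it below on the half-sized cube. *)
Lemma mollifier_scale : exists2 C : seq 'I_n -> R, (forall s, 0 <= C s) &
  forall eta : R, 0 < eta -> exists2 rho, mollifier eta rho &
    forall s, mu.-integrable setT (EFin \o partials s rho) /\
      \int[mu]_x `|partials s rho x| <= C s / eta ^+ size s.
Proof.
have tb : Ctest (bump : V -> R).
  by split; [exact: smooth_bump|exists 1 => x; exact: bump_out].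
have /choice[M HM] : forall s, exists M : R, 0 <= M /\
    forall y, `|partials s (bump : V -> R) y| <= M.
  by move=> s; have [M M0 HM] := Ctest_bounded (Ctest_partials s tb); exists M.
pose e0 : R := (expR (- 2) ^+ 2) ^+ n.
have e00 : 0 < e0 by rewrite !exprn_gt0// expR_gt0.
exists (fun s => M s * 2 ^+ n / e0).
  by move=> s; rewrite divr_ge0 ?(ltW e00)// mulr_ge0 ?exprn_ge0//; have [] := HM s.
move=> eta eta0.
pose b : V -> R := fun x => bump (eta^-1 *: x + 0).
have sb : Csmooth b by apply: smooth_affine; exact: smooth_bump.
have i0 : 0 < eta^-1 by rewrite invr_gt0.
have outb x : ~ cube eta x -> ~ cube 1 (eta^-1 *: x + 0).
  by apply: contra_not; rewrite addr0 => /(cube_scale _ _ i0); rewrite invrK mul1r.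
have vb : vanish_off (cube eta) b by move=> x /outb; exact: bump_out.
have tbb : Ctest b by split => //; exists eta.
have b0 x : 0 <= b x by exact: bump_ge0.
have Ib := integrable_Ctest tbb.
pose c := \int[mu]_x b x.
have ce : e0 * eta ^+ n <= c.
  have e2 : 0 <= eta / 2 by rewrite divr_ge0// ltW.
  have [I1 E1] := Rintegral_indic_cube e0 e2.
  have -> : e0 * eta ^+ n = e0 * (eta / 2 *+ 2) ^+ n.
    by congr (_ * _ ^+ _); rewrite -mulr_natr divfK.
  rewrite -E1; apply: le_Rintegral => // x _.
  rewrite indicE; have [xin|xout] := boolP (x \in _); last by rewrite mulr0.
  rewrite mulr1; apply: bump_in; rewrite addr0; apply/(cube_scale _ _ i0).
  by rewrite invrK mulrC; exact: set_mem.
have c0 : 0 < c by apply: lt_le_trans ce; rewrite mulr_gt0// exprn_gt0.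
have tr : Ctest (c^-1 *: b) by exact: CtestZ.
exists (c^-1 *: b).
  split => //.
  - by move=> x; rewrite fctE mulr_ge0// invr_ge0 ltW.
  - have -> : \int[mu]_x (c^-1 *: b) x = c^-1 * c by rewrite -RintegralZl.
    by rewrite mulVf// gt_eqF.
  - by move=> x xo; rewrite fctE vb// scaler0.
move=> s.
have tps := Ctest_partials s tr.
split; first exact: integrable_Ctest.
have vs : vanish_off (cube eta) (partials s (c^-1 *: b)).
  apply: vanish_off_partials; first exact: closed_cube.
  by move=> x xo; rewrite fctE vb// scaler0.
have Es x : `|partials s (c^-1 *: b) x| <= c^-1 * (eta^-1 ^+ size s * M s).
  rewrite partialsZ// fctE normrM ger0_norm ?invr_ge0 ?(ltW c0)//.
  rewrite ler_wpM2l ?invr_ge0 ?(ltW c0)//.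
  rewrite [partials s b](partials_affine _ _ _ tb.1) fctE normrM.
  rewrite ger0_norm ?exprn_ge0 ?(ltW i0)// ler_wpM2l ?exprn_ge0 ?(ltW i0)//.
  by have [_] := HM s; apply.
have [I2 E2] := Rintegral_indic_cube (c^-1 * (eta^-1 ^+ size s * M s)) (ltW eta0).
apply: (@le_trans _ _ (c^-1 * (eta^-1 ^+ size s * M s) * (eta *+ 2) ^+ n)).
  rewrite -E2; apply: le_Rintegral => //.
    by have := integrable_norm (integrable_Ctest tps).
  move=> x _; rewrite indicE; have [xin|/negP xout] := boolP (x \in _).
    by rewrite mulr1.
  by rewrite mulr0 vs ?normr0// => xx; apply: xout; exact: mem_set.
have M0 : 0 <= M s by have [] := HM s.
have -> : (eta *+ 2) ^+ n = eta ^+ n * 2 ^+ n by rewrite -exprMn mulr_natr.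
rewrite exprVn.
set es := eta ^+ size s; set en := eta ^+ n in ce *.
have es0 : 0 < es by rewrite exprn_gt0.
have en0 : 0 < en by rewrite exprn_gt0.
have -> : c^-1 * (es^-1 * M s) * (en * 2 ^+ n) = (M s * 2 ^+ n / es) * (en / c) by ring.
have -> : M s * 2 ^+ n / e0 / es = (M s * 2 ^+ n / es) * e0^-1 by ring.
apply: ler_wpM2l; first by rewrite divr_ge0 ?(ltW es0)// mulr_ge0// exprn_ge0.
by rewrite ler_pdivrMr// mulrC ler_pdivlMr// mulrC.
Qed.
End mollification.

(** * Functions orthogonal to all test functions vanish *)

Section fundamental_lemma.
Context {R : realType} {n : nat}.
Local Notation V := 'rV[R]_n.
Local Notation mu := (lebesgue_rV R n).
Implicit Types (f g phi v : V -> R) (x y z : V) (U K : set V).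

Lemma rat_approx x (r : R) : 0 < r ->
  exists q : 'rV[rat]_n, `|x - map_mx ratr q| <= r.
Proof.
move=> r0.
have /choice[q Hq] : forall i, exists a : rat, `|x ord0 i - ratr a| < r.
  move=> i; have [] := @rat_in_itvoo R (x ord0 i - r) (x ord0 i + r).
    by rewrite ltrD2l gtrN.
  move=> a; rewrite in_itv/= => /andP[a1 a2]; exists a.
  rewrite distrC ltr_distlC.
  by rewrite ltrBlDr -ltrBlDl; apply/andP; split; lra.
exists (\row_i q i); apply: norm_coord_le; first exact: ltW.
by move=> i; rewrite !mxE; exact: ltW.
Qed.

(** Lindelöf's argument: every point lies in a ball with rational centre and radius 1/(m+1) that is
    contained in the ball given by the hypothesis, and there are countably many such balls. *)
Lemma ae_local U (P : V -> Prop) :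
  (forall x, U x -> exists2 r : R, 0 < r & {ae mu, forall y, `|y - x| < r -> P y}) ->
  {ae mu, forall x, U x -> P x}.
Proof.
move=> H.
pose B (c : 'rV[rat]_n * nat) : set V := [set y | `|y - map_mx ratr c.1| < c.2.+1%:R^-1].
pose Z (c : 'rV[rat]_n * nat) : set V := ~` [set y | B c y -> P y].
(* The rational balls on which [P] fails on a set that is not negligible are discarded, so that
   every member of the family is negligible. *)
pose F m : set V := if (unpickle m : option ('rV[rat]_n * nat)) is Some c then
  if `[< mu.-negligible (Z c) >] then Z c else set0 else set0.
have /negligible_bigcup nF : forall m, mu.-negligible (F m).
  move=> m; rewrite /F; case: unpickle => [c|]; last exact: negligible_set0.
  by case: asboolP => // _; exact: negligible_set0.
apply: negligibleS nF => x /= /not_implyP[Ux Px].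
have [r r0 Hr] := H _ Ux.
have [k kr] : exists k : nat, k.+1%:R^-1 < r / 2.
  have [k] := ltr_add_invr (divr_gt0 r0 (ltr0Sn R 1)).
  by rewrite add0r; exists k.
have k0 : (0 : R) < k.+1%:R^-1 by rewrite invr_gt0.
have [q Hq] := rat_approx x (divr_gt0 k0 (ltr0Sn R 1)).
have xB : B (q, k) x.
  by apply: (le_lt_trans Hq); rewrite /= ltr_pdivrMr// ltr_pMr// ltr1n.
have nZ : mu.-negligible (Z (q, k)).
  apply: negligibleS Hr => y /= /not_implyP[By Py]; apply/not_implyP; split => //.
  have By' : `|y - map_mx ratr q| < k.+1%:R^-1 := By.
  have := ler_distD (map_mx ratr q) y x.
  rewrite [ `|map_mx ratr q - x|]distrC.
  move: By' Hq kr; move: (k.+1%:R^-1) `|_| `|_| `|_| => a b c d; lra.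
exists (pickle (q, k)) => //; rewrite /F pickleK asboolT//.
by apply/not_implyP.
Qed.

(** Any compact set off which [phi] vanishes may replace the closure of the set where it is nonzero,
    so that no support has to be computed. *)
Lemma test_functionP U phi : test_function U phi <->
  Csmooth phi /\ exists K, [/\ compact K, K `<=` U & vanish_off K phi].
Proof.
split=> [[sp cp pU]|[sp [K [cK KU vK]]]].
  split; first by rewrite Csmooth.unlock.
  exists (closure [set x | phi x != 0]); split => // x xK.
  by apply/eqP/negPn/negP => /(@subset_closure V) /xK.
have HK : closure [set x | phi x != 0] `<=` K.
  have /closure_id -> : closed K by apply: compact_closed => //; exact: norm_hausdorff.
  by apply: closure_subset => x /= /eqP p0; apply: contrapT => /vK.
split; first by move: sp; rewrite Csmooth.unlock.
  by apply: subclosed_compact cK HK; exact: closed_closure.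
exact: subset_trans HK KU.
Qed.

Lemma test_functionT phi : test_function setT phi <-> Ctest phi.
Proof.
rewrite test_functionP; split=> -[sp].
  move=> [K [cK _ vK]]; split => //; have [r _ Kr] := bounded_sub_cube cK.
  by exists r => x xr; apply: vK => /Kr.
by move=> [r vr]; split => //; exists (cube r); split => //; exact: compact_cube.
Qed.

Lemma test_function_Ctest U phi : test_function U phi -> Ctest phi.
Proof.
move=> /test_functionP[sp [K [cK _ vK]]]; apply/test_functionT/test_functionP.
by split => //; exists K.
Qed.

(** Near a point of [U], truncate [v] to a compact set [K] inside [U]. The mollifications of the
    truncation vanish near the point, since the translated kernels are test functions of [U]; they
    also converge to the truncation in L^1. *)
Lemma du_bois_reymond U v : open U -> L1loc U v ->
  (forall phi, test_function U phi -> \int[mu]_(x in U) (v x * phi x) = 0) ->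
  {ae mu, forall x, U x -> v x = 0}.
Proof.
move=> oU [mv lv] H; apply: ae_local => x Ux.
have /nbhs_ballP[r0 /= r00 Hr0] : nbhs x U by exact: open_nbhs_nbhs.
(* The cube [K] of size 2r about [x] stays in the ball of radius [r0], and it contains the support
   of every kernel of size at most [r] centred within [r] of [x]. *)
pose r := r0 / 4; have rp : 0 < r by rewrite divr_gt0.
exists r => //.
pose K : set V := [set y | cube (r *+ 2) (y - x)].
have r2 : 0 <= r *+ 2 by rewrite mulrn_wge0// ltW.
have KE y : K y <-> `|y - x| <= r *+ 2 by rewrite /K/= cubeE.
have KU : K `<=` U.
  move=> y /KE yx; apply: Hr0; rewrite mx_norm_ball /ball_/= distrC.
  by apply: le_lt_trans yx _; rewrite mulr2n /r; lra.
have cK : compact K.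
  rewrite (_ : K = (fun y => y + x) @` cube (r *+ 2)); last first.
    apply/seteqP; split => [y Ky|_ [y yc <-]].
      by exists (y - x) => //; rewrite subrK.
    by rewrite /K/= addrK.
  apply: continuous_compact; last exact: compact_cube.
  by apply: continuous_subspaceT => y; exact: (cvgD (@cvg_id _ (nbhs y)) (cvg_cst x)).
have mK : measurable K.
  rewrite -(setCK K); apply: measurableC; apply: open_measurable_rV.
  by apply: closed_openC; apply: compact_closed => //; exact: norm_hausdorff.
have mU : measurable U by exact: open_measurable_rV.
pose w := v \_ K.
have mw : measurable_fun setT w.
  by apply/(measurable_restrictT _ mK); exact: measurable_funS mU KU mv.
have Iw : mu.-integrable setT (EFin \o w).
  have := (integrable_mkcond (EFin \o v) mK).1 (lv _ cK KU).
  by apply: eq_integrable => // y _; rewrite /= /w /patch; case: ifP.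
have lw : lint w.
  by split => // s; apply: integrableS Iw => //; exact: measurable_cube.
have Nw : (nrm mu 1 w < +oo)%E.
  by rewrite nrm1E; have /integrableP[] := Iw.
pose B := [set y | `|y - x| < r].
have oB : open B.
  rewrite (_ : B = ball x r); first exact: ball_open.
  by apply/seteqP; split=> y; rewrite mx_norm_ball /ball_/= distrC.
have mB : measurable B by exact: open_measurable_rV.
have mwB : measurable_fun setT (w \_ B).
  by apply/(measurable_restrictT _ mB); exact: measurable_funS mw.
have BK y : B y -> K y.
  by move=> By; apply/KE/ltW/(lt_le_trans By); rewrite mulr2n lerDl ltW.
have : {ae mu, forall y, (w \_ B) y = 0}.
  apply: (nrm_eq0 (m := mu) (p := 1)) => // e e0.
  have [s s0 Hs] := shift_continuous_Lp (lexx 1) mw Nw e0.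
  pose eta := Num.min s r.
  have eta0 : 0 < eta by rewrite lt_min s0.
  have [C C0 /(_ _ eta0)[rho kr _]] := @mollifier_scale R n.
  have He : (nrm mu 1 (mollify w rho - w) <= e%:E)%E.
    apply: (conv_approx (lexx 1) lw kr (ltW e0) (ltW eta0)) => h hs.
    by apply: Hs; apply: le_trans hs _; rewrite ge_min lexx.
  apply: le_trans He; apply: nrm_le => //.
    apply: measurable_funB => //; apply: Csmooth_measurable; apply: smooth_conv => //.
    by case: kr.
  move=> y; rewrite patchE; case: ifPn => [/set_mem By|_]; last by rewrite normr0.
  suff E : mollify w rho y = 0 by rewrite !fctE E sub0r normrN.
  have [tr _ _ vr] := kr.
  have vy z : rho (z - y) != 0 -> K z.
    move=> /eqP rz; have : cube eta (z - y) by apply: contrapT => /vr.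
    rewrite cubeE ?(ltW eta0)// => zy; apply/KE.
    have zr : `|z - y| <= r by apply: le_trans zy _; rewrite ge_min lexx orbT.
    have := ler_distD y z x; move: By zr; rewrite /B/= mulr2n.
    by move: `|_| `|_| `|_| => a b c; lra.
  have := H (fun z => rho (z - y)) _.
  rewrite Rintegral_mkcond => <-.
    apply: eq_Rintegral => z _; rewrite /w !patchE.
    have [/eqP r0'|/vy Kz] := eqVneq (rho (z - y)) 0.
      by rewrite (eqP r0') !mulr0; case: ifP.
    by rewrite mem_set// mem_set//; exact: KU.
  apply/test_functionP; split.
    by have [] := Ctest_shift (- y) tr.
  exists K; split => // z Kz; apply: contrapT => /eqP /vy; exact: Kz.
apply: filterS => y + yx; rewrite /w !patchE !mem_set//.
exact: BK.
Qed.

End fundamental_lemma.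

(** * Weak derivatives on the whole space *)

Section weak_derivatives.
Context {R : realType} {n : nat}.
Local Notation V := 'rV[R]_n.
Local Notation mu := (lebesgue_rV R n).
Implicit Types (f g phi psi rho : V -> R) (x y z : V) (S K : set V) (i : 'I_n).
Implicit Types (t C d : R) (s : seq 'I_n).

Lemma Rintegral_test_D f g phi : lint f -> lint g -> Ctest phi ->
  \int[mu]_x ((f + g) x * phi x) = \int[mu]_x (f x * phi x) + \int[mu]_x (g x * phi x).
Proof.
move=> lf lg tp; rewrite -(RintegralD measurableT (integrable_test lf tp) (integrable_test lg tp)).
by apply: eq_Rintegral => x _; rewrite !fctE mulrDl.
Qed.

Lemma Rintegral_test_Z c f phi : lint f -> Ctest phi ->
  \int[mu]_x ((c *: f) x * phi x) = c * \int[mu]_x (f x * phi x).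
Proof.
move=> lf tp; rewrite -(RintegralZl c measurableT (integrable_test lf tp)).
by apply: eq_Rintegral => x _; rewrite !fctE -mulrA.
Qed.

Lemma weak_partialD i f g f' g' : lint f -> lint g -> lint f' -> lint g' ->
  weak_partial i f g -> weak_partial i f' g' -> weak_partial i (f + f') (g + g').
Proof.
move=> lf lg lf' lg' w w' phi tp.
rewrite Rintegral_test_D// ?w// ?w'// ?Rintegral_test_D//; last exact: Ctest_partial.
by rewrite opprD.
Qed.

Lemma weak_partialZ c i f g : lint f -> lint g ->
  weak_partial i f g -> weak_partial i (c *: f) (c *: g).
Proof.
move=> lf lg w phi tp.
by rewrite !Rintegral_test_Z// ?w// ?mulrN//; exact: Ctest_partial.
Qed.

(** Test the weak derivative of [f] against [psi * phi] and expand by the product rule for smooth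
    functions. *)
Lemma weak_partialM i psi f g : Csmooth psi -> lint f -> lint g ->
  weak_partial i f g -> weak_partial i (psi * f) (partial i psi * f + psi * g).
Proof.
move=> sp lf lg w phi tp.
have tpi := Ctest_partial i tp.
have t1 : Ctest (psi * phi) by exact: CtestMl.
have t2 : Ctest (partial i psi * phi).
  by apply: CtestMl => //; exact: smooth_partial.
have t3 : Ctest (psi * partial i phi) by exact: CtestMl.
have E : partial i (psi * phi) = partial i psi * phi + psi * partial i phi.
  by rewrite (partialM i sp tp.1) addrC [phi * _]mulrC.
have := w _ t1; rewrite E.
have -> : \int[mu]_x (f x * (partial i psi * phi + psi * partial i phi) x) =
    \int[mu]_x (f x * (partial i psi * phi) x) + \int[mu]_x (f x * (psi * partial i phi) x).
  rewrite -(RintegralD measurableT (integrable_test lf t2) (integrable_test lf t3)).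
  by apply: eq_Rintegral => x _; rewrite !fctE mulrDr.
have -> : \int[mu]_x ((psi * f) x * partial i phi x) = \int[mu]_x (f x * (psi * partial i phi) x).
  by apply: eq_Rintegral => x _; rewrite !fctE mulrCA mulrA.
have -> : \int[mu]_x ((partial i psi * f + psi * g) x * phi x) =
    \int[mu]_x (f x * (partial i psi * phi) x) + \int[mu]_x (g x * (psi * phi) x).
  rewrite -(RintegralD measurableT (integrable_test lf t2) (integrable_test lg t1)).
  by apply: eq_Rintegral => x _; rewrite !fctE; ring.
by move=> H; rewrite opprD -H addrA addNr add0r.
Qed.

Lemma cube_bounded f (r : R) : continuous f ->
  exists2 M, 0 <= M & forall x, cube r x -> `|f x| <= M.
Proof.
move=> cf.
have [|||c cr Hc] := @EVT_max_rV R n (fun x => `|f x|) (cube `|r|).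
- by exists 0; apply/cubeP => i; rewrite mxE normr0.
- exact: compact_cube.
- apply: continuous_subspaceT => x.
  by apply: continuous_comp; [exact: cf|exact: norm_continuous].
exists `|f c| => // x xr; apply: Hc; rewrite inE.
exact: cube_le (ler_norm r) _ xr.
Qed.

Lemma Csmooth_lint f : Csmooth f -> lint f.
Proof.
move=> sf; have mf := Csmooth_measurable sf; split => // r.
have [M M0 HM] := cube_bounded r (smooth_continuous sf).
have [_ /(_ r)] := lint_cst M : lint (cst M : V -> R).
apply: le_integrable => //; first exact: measurable_cube.
  by apply/measurable_EFinP; exact: measurable_funS mf.
by move=> x xr /=; rewrite lee_fin (ger0_norm M0); exact: HM.
Qed.

Section Lp.
Variable p : R.
Hypothesis p1 : 1 <= p.
Let p0 : 0 < p. Proof. exact: lt_le_trans p1. Qed.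
Local Notation N := (nrm mu p).

Definition Lpf f := measurable_fun setT f /\ (N f < +oo)%E.

Lemma Lpf_lint f : Lpf f -> lint f.
Proof. by case; exact: lint_Lp. Qed.

Lemma LpfD f g : Lpf f -> Lpf g -> Lpf (f + g).
Proof.
move=> [mf Nf] [mg Ng]; split; first exact: measurable_funD.
by apply: le_lt_trans (nrmD mu p1 mf mg) _; exact: lte_add_pinfty.
Qed.

Lemma LpfZ c f : Lpf f -> Lpf (c *: f).
Proof.
move=> [mf Nf]; split; first exact: measurable_funM.
by rewrite nrmZ// lte_mul_pinfty// ge0_fin_numE.
Qed.

Lemma LpfM psi f M : measurable_fun setT psi -> (forall x, `|psi x| <= M) ->
  Lpf f -> Lpf (psi * f).
Proof.
move=> mp HM Lf; have [mMf NMf] := LpfZ M Lf; have [mf Nf] := Lf.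
have mpf : measurable_fun setT (psi * f) by exact: measurable_funM.
split=> //; apply: le_lt_trans NMf; apply: nrm_le => // x.
rewrite !fctE !normrM ler_wpM2r//.
by apply: le_trans (HM x) _; exact: ler_norm.
Qed.

Lemma measurable_patch S f : measurable S -> measurable_fun setT f ->
  measurable_fun setT (f \_ S).
Proof.
by move=> mS mf; apply/(measurable_restrictT _ mS); exact: measurable_funS mf.
Qed.

Lemma patch_rE S f x : (f \_ S) x = if x \in S then f x else 0.
Proof. by []. Qed.

Lemma norm_patch S f x : `|(f \_ S) x| <= `|f x|.
Proof. by rewrite patchE; case: ifP => // _; rewrite normr0. Qed.

Lemma patchD S f g : (f + g) \_ S = f \_ S + g \_ S.
Proof.
apply/funext => x; change (((f + g) \_ S) x = (f \_ S) x + (g \_ S) x).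
by rewrite !patch_rE; case: ifP => // _; rewrite addr0.
Qed.

Lemma patchZ S c f : (c *: f) \_ S = c *: (f \_ S).
Proof.
apply/funext => x; change (((c *: f) \_ S) x = c *: (f \_ S) x).
by rewrite !patch_rE; case: ifP => // _; rewrite scaler0.
Qed.

(* [f] has weak derivatives of order at most [k] in L^p, and those of order
   [m] have norm at most [d t^(k+j-m)] on [S]. *)
Fixpoint sob k j t d S f : Prop :=
  (Lpf f /\ (N (f \_ S)%R <= (d * t ^+ (k + j))%:E)%E) /\
  if k is k'.+1 then forall i, exists g, weak_partial i f g /\ sob k' j t d S g
  else True.

(** With [t = 1] and no localization the weights of [sob] disappear, leaving one bound for all
    orders up to [k]. *)
Definition small k d f := sob k 0 1 d setT f.

Lemma sob_Lpf k j t d S f : sob k j t d S f -> Lpf f.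
Proof. by case: k => [|k] [[]]. Qed.

Lemma sobD k j t d d' S f f' : measurable S ->
  sob k j t d S f -> sob k j t d' S f' -> sob k j t (d + d') S (f + f').
Proof.
move=> mS; elim: k f f' => [|k ih] f f' [[Lf Nf] H] [[Lf' Nf'] H'].
  split => //; split; first exact: LpfD.
  rewrite patchD (le_trans (nrmD mu p1 _ _))//; try by apply: measurable_patch => //; case: Lf Lf' => ? ? [].
  by rewrite mulrDl EFinD leeD.
split.
  split; first exact: LpfD.
  rewrite patchD (le_trans (nrmD mu p1 _ _))//; try by apply: measurable_patch => //; case: Lf Lf' => ? ? [].
  by rewrite mulrDl EFinD leeD.
move=> i; have [g [w sg]] := H i; have [g' [w' sg']] := H' i.
exists (g + g'); split; last exact: ih.
by apply: weak_partialD => //; apply: Lpf_lint => //; [exact: sob_Lpf sg|exact: sob_Lpf sg'].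
Qed.

Lemma sobZ k j t c d S f : measurable S ->
  sob k j t d S f -> sob k j t (`|c| * d) S (c *: f).
Proof.
move=> mS; elim: k f => [|k ih] f [[Lf Nf] H].
  split => //; split; first exact: LpfZ.
  rewrite patchZ nrmZ//; last by apply: measurable_patch => //; case: Lf.
  by rewrite -mulrA EFinM lee_wpmul2l// lee_fin.
split.
  split; first exact: LpfZ.
  rewrite patchZ nrmZ//; last by apply: measurable_patch => //; case: Lf.
  by rewrite -mulrA EFinM lee_wpmul2l// lee_fin.
move=> i; have [g [w sg]] := H i; exists (c *: g); split; last exact: ih.
by apply: weak_partialZ => //; apply: Lpf_lint => //; exact: sob_Lpf sg.
Qed.

(** The exponents depend on [k + j] only, so giving up the top order while raising [j] keeps every
    bound. This is the form needed when a derivative falls on a cutoff. *)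
Lemma sob_drop k j t d S f : sob k.+1 j t d S f -> sob k j.+1 t d S f.
Proof.
elim: k f => [|k ih] f [[Lf Nf] H]; split => //; try by rewrite addnS -addSn.
by move=> i; have [g [w sg]] := H i; exists g; split => //; exact: ih.
Qed.

Lemma nrm_cutoff psi f S (B : R) : measurable S -> measurable_fun setT psi ->
  measurable_fun setT f -> (forall x, `|psi x| <= B) -> vanish_off S psi ->
  (N (psi * f)%R <= B%:E * N (f \_ S)%R)%E.
Proof.
move=> mS mp mf HB vS; have B0 : 0 <= B by exact: le_trans (HB 0).
have mfS := measurable_patch mS mf.
rewrite -[in leRHS](ger0_norm B0) -(nrmZ mu p1 B mfS); apply: nrm_le => //.
- exact: measurable_funM.
- exact: measurable_funM.
move=> x; change (`|psi x * f x| <= `|B * (f \_ S) x|).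
rewrite patch_rE; case: ifPn => [_|/negP xS].
  by rewrite !normrM (ger0_norm B0) ler_wpM2r.
by rewrite vS ?mul0r ?normr0// => Sx; apply: xS; exact: mem_set.
Qed.

(** Leibniz's rule by induction on [k]. A derivative falling on [psi] costs 1/t and raises [j]; one
    falling on [f] lowers [k]. In both cases the weights in [t] balance, and the two terms of each
    product rule account for 2^k. *)
Lemma cutoff k j t C d S psi f : 0 < t -> t <= 1 -> 0 <= C -> 0 <= d ->
  measurable S -> Csmooth psi ->
  (forall s, vanish_off S (partials s psi)) ->
  (forall s x, (size s <= k)%N -> `|partials s psi x| <= C / t ^+ (j + size s)) ->
  sob k j t d S f -> small k (2 ^+ k * C * d) (psi * f).
Proof.
move=> t0 t1 C0 d0 mS.
(* For a single product, C / t^j times d t^(k+j) leaves C d t^k, at most C d since t <= 1. *)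
have H0 k' j' psi' f' : Csmooth psi' -> vanish_off S psi' ->
    (forall x, `|psi' x| <= C / t ^+ j') -> Lpf f' ->
    (N (f' \_ S) <= (d * t ^+ (k' + j'))%:E)%E ->
    Lpf (psi' * f') /\
    (N ((psi' * f') \_ setT)%R <= (2 ^+ k' * C * d * 1 ^+ (k' + 0))%:E)%E.
  move=> sp vp bp Lf Nf; have [mf _] := Lf; have mp := Csmooth_measurable sp.
  have Lpf' := LpfM mp bp Lf; split => //; have [mpf _] := Lpf'.
  apply: (@le_trans _ _ (N (psi' * f')%R)).
    by apply: nrm_le => //; [exact: measurable_patch|move=> x; exact: norm_patch].
  apply: (le_trans (nrm_cutoff mS mp mf bp vp)).
  apply: (@le_trans _ _ ((C / t ^+ j')%:E * (d * t ^+ (k' + j'))%:E)%E).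
    by apply: lee_wpmul2l => //; rewrite lee_fin divr_ge0// exprn_ge0// ltW.
  rewrite -EFinM lee_fin expr1n mulr1.
  have tj : t ^+ j' != 0 by rewrite expf_eq0 gt_eqF// andbF.
  have -> : C / t ^+ j' * (d * t ^+ (k' + j')) = t ^+ k' * (C * d).
    by rewrite exprD; field.
  rewrite -[leRHS]mulrA ler_wpM2r ?mulr_ge0//.
  by rewrite (@le_trans _ _ 1) ?exprn_ile1 ?exprn_ege1 ?(ltW t0)// ler1n.
elim: k j psi f => [|k ih] j psi f sp vp bp [[Lf Nf] H].
  split => //; apply: (H0 _ j) => //; first exact: (vp [::]).
  by move=> x; have := bp [::] x; rewrite addn0; exact.
split.
  apply: (H0 _ j) => //; first exact: (vp [::]).
  by move=> x; have := bp [::] x; rewrite addn0; exact.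
move=> i; have [g [w sg]] := H i.
exists (partial i psi * f + psi * g); split.
  by apply: weak_partialM => //; apply: Lpf_lint => //; exact: sob_Lpf sg.
have -> : 2 ^+ k.+1 * C * d = 2 ^+ k * C * d + 2 ^+ k * C * d by rewrite exprS; ring.
apply: sobD => //; last by apply: (ih j) => // s x sk; apply: bp; exact: leqW.
apply: (ih j.+1) => //.
- exact: smooth_partial.
- by move=> s; rewrite -partials_rcons.
- by move=> s x sk; rewrite -partials_rcons; have := bp (rcons s i) x; rewrite size_rcons addnS; exact.
by apply: sob_drop; split.
Qed.

Lemma finite_scale (I : finType) (P : I -> R -> Prop) :
  (forall a, exists r : R, 0 < r /\ forall t, 0 < t -> t <= r -> P a t) ->
  exists r : R, 0 < r /\ forall t, 0 < t -> t <= r -> forall a, P a t.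
Proof.
move=> /choice[r Hr].
have [q [q0 Hq]] : exists q : R, 0 < q /\ forall a, a \in enum I -> q <= r a.
  elim: (enum I) => [|a s [q [q0 Hq]]]; first by exists 1.
  exists (Num.min q (r a)); split; first by rewrite lt_min q0; have [] := Hr a.
  by move=> b; rewrite inE ge_min => /predU1P[->|/Hq ->//]; rewrite lexx orbT.
exists q; split => // t t0 tq a; have [_] := Hr a; apply => //.
by apply: le_trans tq _; apply: Hq; rewrite mem_enum.
Qed.

(** Mollification commutes with weak derivatives, and there are finitely many of them, so one scale
    makes all the errors small. *)
Lemma small_mollify k E f d : small k E f -> 0 < d ->
  exists r : R, 0 < r /\ forall eta, 0 < eta -> eta <= r -> forall rho,
    mollifier eta rho -> small k d (mollify f rho - f).
Proof.
have H0 f' k' : Lpf f' -> 0 < d -> exists r : R, 0 < r /\ forall eta, 0 < eta -> eta <= r ->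
    forall rho, mollifier eta rho -> Lpf (mollify f' rho - f') /\
    (N ((mollify f' rho - f') \_ setT)%R <= (d * 1 ^+ (k' + 0))%:E)%E.
  move=> Lf d0; have [mf Nf] := Lf.
  have [r r0 Hr] := shift_continuous_Lp p1 mf Nf d0.
  exists r; split => // eta eta0 etar rho kr.
  have lf := Lpf_lint Lf.
  have mfr : measurable_fun setT (mollify f' rho - f').
    apply: measurable_funB => //; apply: Csmooth_measurable; apply: smooth_conv => //.
    by case: kr.
  have H : (N (mollify f' rho - f')%R <= d%:E)%E.
    apply: (conv_approx p1 lf kr (ltW d0) (ltW eta0)) => h hr; apply: Hr.
    exact: le_trans hr etar.
  split; first by split => //; exact: le_lt_trans H (ltry _).
  rewrite expr1n mulr1; apply: le_trans H; apply: nrm_le => //; last exact: norm_patch.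
  exact: measurable_patch.
move=> + d0; elim: k f => [|k ih] f [[Lf Nf] H].
  have [r [r0 Hr]] := H0 f 0 Lf d0; exists r; split => // eta eta0 etar rho kr.
  by split => //; exact: Hr kr.
have [r [r0 Hr]] := H0 f k.+1 Lf d0.
have /finite_scale[r1 [r10 Hr1]] : forall i, exists r : R, 0 < r /\ forall t : R,
    0 < t -> t <= r -> forall rho, mollifier t rho ->
    exists g, weak_partial i (mollify f rho - f) g /\ small k d g.
  move=> i; have [g [w sg]] := H i; have [q [q0 Hq]] := ih _ sg.
  exists q; split => // t t0 tq rho kr; exists (mollify g rho - g); split; last exact: Hq kr.
  have Lg := sob_Lpf sg; have [tr _ _ _] := kr.
  have lm h : Lpf h -> lint (mollify h rho).
    by move=> Lh; apply: Csmooth_lint; apply: smooth_conv => //; exact: Lpf_lint.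
  have lN h : Lpf h -> lint ((- 1) *: h) by move=> Lh; apply: Lpf_lint; exact: LpfZ.
  rewrite -[X in mollify f rho + X]scaleN1r -[X in mollify g rho + X]scaleN1r.
  have lf := Lpf_lint Lf; have lg := Lpf_lint Lg.
  apply: weak_partialD (lm _ Lf) (lm _ Lg) (lN _ Lf) (lN _ Lg) _ (weak_partialZ _ lf lg w).
  rewrite -(conv_weak_partial lf lg w tr).
  by apply: weak_partial_smooth; exact: smooth_conv.
exists (Num.min r r1); split; first by rewrite lt_min r0.
move=> eta eta0; rewrite le_min => /andP[er er1] rho kr; split; first exact: Hr kr.
by move=> i; exact: Hr1 kr.
Qed.

(** Here the derivatives are named, one for each word of directions, whereas [sob] only asserts that
    they exist: hypotheses can thus bear on each of them. *)
Definition fam k (G : seq 'I_n -> V -> R) :=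
  (forall s, (size s <= k)%N -> Lpf (G s)) /\
  forall i s, (size s < k)%N -> weak_partial i (G s) (G (i :: s)).

Lemma fam_sob k t d S G : fam k G ->
  (forall s, (size s <= k)%N -> (N (G s \_ S)%R <= (d * t ^+ (k - size s))%:E)%E) ->
  sob k 0 t d S (G [::]).
Proof.
move=> [LG wG] H.
suff : forall m s, (m + size s = k)%N -> sob m 0 t d S (G s) by apply; rewrite addn0.
elim=> [|m ih] s ms.
  split => //; have sk : (size s <= k)%N by rewrite -ms.
  by split; [exact: LG|have := H _ sk; rewrite -ms add0n subnn].
have sk : (size s <= k)%N by rewrite -ms leq_addl.
split.
  by split; [exact: LG|have := H _ sk; rewrite -{1}ms addnK addn0].
move=> i; exists (G (i :: s)); split; first by apply: wG; rewrite -ms addSn ltnS leq_addl.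
by apply: ih; rewrite /= -ms addnS.
Qed.

(** Following the word [s], the first-order weak derivatives compose into a single one of order
    [size s]; each of them contributes one sign. *)
Lemma small_weak k d f s : (size s <= k)%N -> small k d f ->
  exists g, [/\ Lpf g, (N g <= d%:E)%E & forall phi, Ctest phi ->
    \int[mu]_x (f x * partials s phi x) = (- 1) ^+ size s * \int[mu]_x (g x * phi x)].
Proof.
have NT g : N (g \_ setT) = N g by rewrite patch_setT.
elim: s k f => [|i s ih] k f /=.
  move=> _ sf; exists f; split; first exact: sob_Lpf sf.
    by case: k sf => [|k] [[_]]; rewrite NT expr1n mulr1.
  by move=> phi tp; rewrite expr0 mul1r.
case: k => // k sk [_ /(_ i)[g [w /(ih _ _ sk)[h [Lh Nh H]]]]].
exists h; split => // phi tp; rewrite w; last exact: Ctest_partials.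
by rewrite H// exprS mulN1r mulNr.
Qed.

Lemma Ctest_Lpf phi : Ctest phi -> Lpf phi.
Proof.
move=> tp; have [M M0 HM] := Ctest_bounded tp; have [r r0 Hr] := Ctest_supp tp.
have mp : measurable_fun setT phi by apply: Csmooth_measurable; exact: tp.1.
have mi : measurable_fun setT (\1_(cube r) : V -> R).
  by apply: measurable_indic; exact: measurable_cube.
split=> //; apply: (@le_lt_trans _ _ (N (M *: (\1_(cube r) : V -> R)))).
  apply: nrm_le => //; first exact: measurable_funM.
  move=> x; change (`|phi x| <= `|M * \1_(cube r) x|); rewrite indicE.
  have [xr|/negP xr] := boolP (x \in _); first by rewrite mulr1 (ger0_norm M0).
  by rewrite Hr ?normr0// => xx; apply: xr; exact: mem_set.
rewrite (nrmZ mu p1 M mi) lte_mul_pinfty//.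
by rewrite (nrm_indic p1 (measurable_cube r)) poweR_lty// lebesgue_cubeE// ltry.
Qed.

End Lp.

(** Hölder's inequality with the conjugate exponent p/(p-1), finite since p > 1: pairing with a test
    function is continuous for the L^p norm, which is what lets weak derivatives pass to the
    limit. *)
Lemma test_small p phi d : 1 < p -> Ctest phi -> 0 < d ->
  exists2 r : R, 0 < r & forall f, measurable_fun setT f -> (nrm mu p f <= r%:E)%E ->
    `|\int[mu]_x (f x * phi x)| <= d.
Proof.
move=> p1' tp d0; pose q := p / (p - 1).
have p0 : 0 < p by exact: lt_trans p1'.
have p1 : 1 <= p by exact: ltW.
have q0 : 0 < q by rewrite divr_gt0// subr_gt0.
have pq : p^-1 + q^-1 = 1.
  have p0' : p != 0 by rewrite gt_eqF.
  have p1'' : p - 1 != 0 by rewrite gt_eqF// subr_gt0.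
  by rewrite /q invf_div; field.
have mp : measurable_fun setT phi by apply: Csmooth_measurable; exact: tp.1.
have Nq : ('N[mu]_q%:E[EFin \o phi] < +oo)%E.
  have q1 : 1 <= q by rewrite ler_pdivlMr ?subr_gt0// mul1r lerBlDr lerDl.
  by have [] := Ctest_Lpf q1 tp.
pose K := fine 'N[mu]_q%:E[EFin \o phi].
have KE : ('N[mu]_q%:E[EFin \o phi] = K%:E)%E.
  by rewrite /K fineK// ge0_fin_numE// Lnorm_ge0.
have K0 : 0 <= K by rewrite fine_ge0// Lnorm_ge0.
exists (d / (K + 1)); first by rewrite divr_gt0// ltr_wpDl.
move=> f mf Nf.
have If : mu.-integrable setT (EFin \o (f * phi)).
  apply: integrable_test => //; apply: (lint_Lp p1) => //.
  exact: le_lt_trans Nf (ltry _).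
rewrite -lee_fin /Rintegral.
apply: (@le_trans _ _ (\int[mu]_x `|(f x * phi x)%:E|)%E).
  have := le_abse_integral mu measurableT (measurable_int _ If).
  have := integrable_fin_num measurableT If.
  change (fun x => (EFin \o (f * phi)) x) with (fun x => (f x * phi x)%:E).
  by move: (\int[mu]_x (f x * phi x)%:E)%E => [].
have := hoelder mu mf mp p0 q0 pq.
rewrite Lnorm1 KE => H; apply: le_trans H _.
apply: (@le_trans _ _ ((d / (K + 1))%:E * K%:E)%E); first by rewrite lee_wpmul2r.
rewrite -EFinM lee_fin mulrAC ler_pdivrMr ?ltr_wpDl//.
by rewrite ler_wpM2l ?(ltW d0)// lerDl.
Qed.

End weak_derivatives.

(** * Translation estimates and a Poincaré inequality *)

Section translation_estimate.
Context {R : realType} {n : nat}.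
Local Notation V := 'rV[R]_n.
Local Notation mu := (lebesgue_rV R n).
Local Notation e := (delta_mx ord0).
Implicit Types (f g phi psi rho F : V -> R) (x y z h : V) (A B S U : set V) (i : 'I_n).
Implicit Types (t C d : R) (s : seq 'I_n).
Variable p : R.
Hypothesis p1 : 1 <= p.
Local Notation N := (nrm mu p).
Local Notation Lpf := (Lpf p).

Lemma nrm_patch_le f A B : measurable A -> measurable B -> measurable_fun setT f ->
  A `<=` B -> (N (f \_ A) <= N (f \_ B))%E.
Proof.
move=> mA mB mf AB; apply: nrm_le => //; try exact: measurable_patch.
move=> x; rewrite !patch_rE; case: ifPn => [/set_mem/AB xB|_]; last by rewrite normr0.
by rewrite mem_set.
Qed.

Lemma nrm_patch f A : measurable A -> measurable_fun setT f -> (N (f \_ A) <= N f)%E.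
Proof.
move=> mA mf; apply: nrm_le => //; last exact: norm_patch.
exact: measurable_patch.
Qed.

Lemma nrm_patchD f g A : measurable A -> measurable_fun setT f -> measurable_fun setT g ->
  (N ((f + g) \_ A)%R <= N (f \_ A) + N (g \_ A))%E.
Proof. by move=> mA mf mg; rewrite patchD; apply: nrmD => //; exact: measurable_patch. Qed.

Lemma nrm_tail f d : Lpf f -> 0 < d ->
  exists2 r, 0 < r & (N (f \_ (~` cube r)) <= d%:E)%E.
Proof.
move=> [mf Nf] d0.
have mc r : measurable (~` (cube r : set V)) by apply: measurableC; exact: measurable_cube.
have c0 x : (f \_ (~` cube k%:R)) x @[k --> \oo] --> (0 : R).
  apply: cvg_near_cst; have [k0 _ xk0] : (\bigcup_k cube k%:R : set V) x by rewrite bigcup_cube.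
  exists k0 => // k /= kk; rewrite patch_rE memNset//.
  by apply; apply: cube_le xk0; rewrite ler_nat.
have [k Hk] := nrm_dct p1 (fun k => measurable_patch (mc k%:R) mf) mf Nf
  (fun k x => norm_patch (~` cube k%:R) f x) c0 d0.
exists k.+1%:R; first by [].
exact: Hk.
Qed.

Lemma smooth_taylor F i x (a M : R) : Csmooth F -> 0 < a ->
  (forall c : R, 0 < c -> c < a -> `|partial i (partial i F) (x + c *: e i)| <= M) ->
  `|F (x + a *: e i) - F x - a * partial i F x| <= M * a ^+ 2.
Proof.
move=> sF a0 HM.
have [c] := smooth_line_MVT i x sF a0; rewrite in_itv/= => /andP[c0 ca] ->.
have [b] := smooth_line_MVT i x (smooth_partial i sF) c0.
rewrite in_itv/= => /andP[b0 bc] E.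
have -> : partial i F (x + c *: e i) * a - a * partial i F x =
    a * (partial i F (x + c *: e i) - partial i F x) by ring.
rewrite E !normrM (gtr0_norm a0) (gtr0_norm c0).
rewrite mulrCA expr2; apply: ler_pM; first exact: normr_ge0.
- by rewrite mulr_ge0// ltW.
- exact: HM (lt_trans bc ca).
by rewrite ler_wpM2l ?ltW.
Qed.

(** The translation is cut into steps of length h. By Taylor's formula each step costs h times the
    norm of the derivative plus an error O(h^2), uniform because [B] is bounded; tau / h steps leave
    a total error O(tau h), which tends to 0. *)
Lemma translation_smooth F i A B (r tau : R) : Csmooth F -> 0 < tau ->
  measurable A -> measurable B -> 0 <= r -> B `<=` cube r ->
  (forall x (c : R), A x -> 0 <= c -> c <= tau -> B (x + c *: e i)) ->
  (N ((shiftf (tau *: e i) F - F) \_ A)%R <= tau%:E * N (partial i F \_ B)%R)%E.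
Proof.
move=> sF tau0 mA mB r0 Br HAB.
have sFi := smooth_partial i sF.
have mF := Csmooth_measurable sF; have mFi := Csmooth_measurable sFi.
have [M M0 HM] := cube_bounded (r + tau) (smooth_continuous (smooth_partial i sFi)).
have mI : measurable_fun setT (\1_(cube r) : V -> R).
  by apply: measurable_indic; exact: measurable_cube.
have [K K0 NK] : exists2 K : R, 0 <= K & (N (\1_(cube r) : V -> R) <= K%:E)%E.
  exists (fine (N (\1_(cube r) : V -> R))); first by rewrite fine_ge0// nrm_ge0.
  rewrite fineK// ge0_fin_numE ?nrm_ge0//.
  by rewrite (nrm_indic p1 (measurable_cube r)) poweR_lty// lebesgue_cubeE// ltry.
have step (h : R) : 0 < h -> h <= tau ->
    (N ((shiftf (h *: e i) F - F) \_ B)%R <= h%:E * N (partial i F \_ B)%R + (M * h ^+ 2 * K)%:E)%E.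
  move=> h0 htau.
  have mw : measurable_fun setT (shiftf (h *: e i) F - F).
    by apply: measurable_funB => //; exact: measurable_shiftf.
  have mh : measurable_fun setT (h *: partial i F) by exact: measurable_funM.
  have {1}-> : shiftf (h *: e i) F - F = h *: partial i F + ((shiftf (h *: e i) F - F) - h *: partial i F).
    by rewrite [RHS]addrC subrK.
  have md : measurable_fun setT (shiftf (h *: e i) F - F - h *: partial i F).
    exact: measurable_funB.
  apply: (le_trans (nrm_patchD mB mh md)); apply: leeD.
    by rewrite patchZ (nrmZ mu p1 h (measurable_patch mB mFi)) (gtr0_norm h0).
  have Mh : 0 <= M * h ^+ 2 by rewrite mulr_ge0// exprn_ge0// ltW.
  apply: (@le_trans _ _ (N ((M * h ^+ 2) *: (\1_(cube r) : V -> R)))).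
    apply: nrm_le => //; [exact: measurable_patch|exact: measurable_funM|].
    move=> x; rewrite patch_rE; case: ifPn => [/set_mem xB|_]; last by rewrite normr0.
    change (`|F (x + h *: e i) - F x - h * partial i F x| <= `|M * h ^+ 2 * \1_(cube r) x|).
    rewrite indicE mem_set ?mulr1; last exact: Br.
    rewrite (ger0_norm Mh); apply: smooth_taylor => // c c0 ch; apply: HM.
    apply/cubeP => j; have /cubeP /(_ j) xj := Br _ xB.
    rewrite !mxE; apply: le_trans (ler_normD _ _) _; apply: lerD => //.
    rewrite normrM normr_nat (@le_trans _ _ `|c|)//.
      by rewrite ler_piMr// lern1 leq_b1.
    by rewrite (gtr0_norm c0); apply/ltW/(lt_le_trans ch).
  rewrite (nrmZ mu p1 _ mI) (ger0_norm Mh) (EFinM _ K).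
  by apply: lee_wpmul2l => //; rewrite lee_fin.
have NB0 := nrm_ge0 mu p (partial i F \_ B).
have steps (h : R) (j : nat) : 0 < h -> j%:R * h <= tau -> h <= tau ->
    (N ((shiftf ((j%:R * h) *: e i) F - F) \_ A)%R <=
     (j%:R * h)%:E * N (partial i F \_ B)%R + (j%:R * (M * h ^+ 2 * K))%:E)%E.
  move=> h0 + ht; elim: j => [|j ih] jh.
    rewrite !mul0r scale0r mul0e add0e (_ : (_ \_ A) = 0) ?nrm0//.
    by apply/funext => x; rewrite patch_rE !fctE /shiftf addr0 subrr; case: ifP.
  have jh' : j%:R * h <= tau.
    by apply: le_trans jh; rewrite ler_pM2r// ler_nat.
  have mw : measurable_fun setT (shiftf (h *: e i) F - F).
    by apply: measurable_funB => //; exact: measurable_shiftf.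
  have mwj := measurable_shiftf ((j%:R * h) *: e i) mw.
  have mj : measurable_fun setT (shiftf ((j%:R * h) *: e i) F - F).
    by apply: measurable_funB => //; exact: measurable_shiftf.
  have -> : shiftf ((j.+1%:R * h) *: e i) F - F =
      shiftf ((j%:R * h) *: e i) (shiftf (h *: e i) F - F) + (shiftf ((j%:R * h) *: e i) F - F).
    have Ex x : x + (j.+1%:R * h) *: e i = x + (j%:R * h) *: e i + h *: e i.
      by rewrite -addrA -scalerDl -natr1 mulrDl mul1r.
    by apply/funext => x; rewrite !fctE /shiftf Ex addrA subrK.
  apply: (le_trans (nrm_patchD mA mwj mj)).
  have -> : ((j.+1%:R * h)%:E * N (partial i F \_ B) + (j.+1%:R * (M * h ^+ 2 * K))%:E =
      (h%:E * N (partial i F \_ B) + (M * h ^+ 2 * K)%:E) +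
      ((j%:R * h)%:E * N (partial i F \_ B) + (j%:R * (M * h ^+ 2 * K))%:E))%E.
    rewrite addeACA -ge0_muleDl ?lee_fin ?mulr_ge0 ?(ltW h0)//.
    by rewrite -!EFinD -natr1 !mulrDl !mul1r [h + _]addrC [_ * K + _]addrC.
  apply: leeD (ih jh'); apply: le_trans (step _ h0 ht).
  have := nrm_shift p ((j%:R * h) *: e i) (measurable_patch mB mw) => <-.
  apply: nrm_le => //; [exact: measurable_patch|apply: measurable_shiftf; exact: measurable_patch|].
  move=> x; rewrite patch_rE; case: ifPn => [/set_mem xA|_]; last by rewrite normr0.
  rewrite /shiftf patch_rE mem_set//; apply: HAB => //.
  by rewrite mulr_ge0// ltW.
apply/lee_addgt0Pr => d d0.
have MK0 : 0 <= M * K * tau ^+ 2 / d.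
  by apply: divr_ge0 (ltW d0); apply: mulr_ge0; [exact: mulr_ge0|exact/exprn_ge0/ltW].
(* With m + 1 steps the total error is [M * K * tau ^+ 2 / m.+1%:R], at most [d] for this choice. *)
pose m := Num.bound (M * K * tau ^+ 2 / d).
have m0 : (0 : R) < m.+1%:R by [].
have Hm : M * K * tau ^+ 2 <= m.+1%:R * d.
  rewrite -ler_pdivrMr//; apply: le_trans (ltW (archi_boundP MK0)) _.
  by rewrite ler_nat.
have h0 : 0 < tau / m.+1%:R by rewrite divr_gt0.
have mh : m.+1%:R * (tau / m.+1%:R) = tau by rewrite mulrC divfK// gt_eqF.
have ht : tau / m.+1%:R <= tau by rewrite ler_pdivrMr// ler_peMr ?ler1n// ltW.
have := steps _ m.+1 h0 _ ht; rewrite mh => /(_ (lexx _)) H; apply: le_trans H _.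
rewrite leeD2l// lee_fin.
have -> : m.+1%:R * (M * (tau / m.+1%:R) ^+ 2 * K) = M * K * tau ^+ 2 / m.+1%:R.
  by field; rewrite gt_eqF.
by rewrite ler_pdivrMr// [d * _]mulrC.
Qed.

(** Mollifying reduces to smooth functions, and cutting [A] and [B] by cubes to bounded sets; every
    error is then sent to 0. *)
Lemma translation_weak_pos f g i A B (tau : R) : Lpf f -> Lpf g -> weak_partial i f g ->
  0 < tau -> measurable A -> measurable B ->
  (forall x (c : R), A x -> 0 <= c -> c <= tau -> B (x + c *: e i)) ->
  (N ((shiftf (tau *: e i) f - f) \_ A)%R <= tau%:E * N (g \_ B)%R)%E.
Proof.
move=> Lf Lg w tau0 mA mB HAB; have [mf Nf] := Lf; have [mg Ng] := Lg.
have lf := Lpf_lint p1 Lf; have lg := Lpf_lint p1 Lg.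
have msf := measurable_shiftf (tau *: e i) mf.
pose D := shiftf (tau *: e i) f - f.
have mD : measurable_fun setT D by exact: measurable_funB.
have LD : Lpf D.
  rewrite /D -scaleN1r; apply: (LpfD p1); last exact: (LpfZ p1).
  by split => //; rewrite nrm_shift.
apply/lee_addgt0Pr => d d0.
(* There are three errors [d']: two from replacing [f] by [F], one from the tail of [D]. A fourth
   one, from replacing [g] by [Fi], is multiplied by [tau]. *)
pose d' := d / (3 + tau); have d'0 : 0 < d' by rewrite divr_gt0// ltr_wpDl ?ltW.
have [r r0 Hr] := nrm_tail LD d'0.
have [a1 a10 Ha1] := shift_continuous_Lp p1 mf Nf d'0.
have [a2 a20 Ha2] := shift_continuous_Lp p1 mg Ng d'0.
pose eta := Num.min a1 a2; have eta0 : 0 < eta by rewrite lt_min a10.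
have [C C0 /(_ _ eta0)[rho kr _]] := @mollifier_scale R n; have [tr _ _ _] := kr.
pose F := mollify f rho; pose Fi := mollify g rho.
have sF : Csmooth F by exact: smooth_conv.
have mF := Csmooth_measurable sF.
have FiE : partial i F = Fi by exact: conv_weak_partial.
have mFi : measurable_fun setT Fi by apply: Csmooth_measurable; exact: smooth_conv.
have NF : (N (F - f)%R <= d'%:E)%E.
  apply: (conv_approx p1 lf kr (ltW d'0) (ltW eta0)) => h hs; apply: Ha1.
  by apply: le_trans hs _; rewrite ge_min lexx.
have NG : (N (Fi - g)%R <= d'%:E)%E.
  apply: (conv_approx p1 lg kr (ltW d'0) (ltW eta0)) => h hs; apply: Ha2.
  by apply: le_trans hs _; rewrite ge_min lexx orbT.
pose A' := A `&` cube r; pose B' := B `&` cube (r + tau).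
have mA' : measurable A' by apply: measurableI => //; exact: measurable_cube.
have mB' : measurable B' by apply: measurableI => //; exact: measurable_cube.
have HF : (N ((shiftf (tau *: e i) F - F) \_ A')%R <= tau%:E * N (Fi \_ B')%R)%E.
  rewrite -FiE; apply: (translation_smooth (r := r + tau)) => //.
  - by rewrite addr_ge0 ?ltW.
  - by move=> x [].
  move=> x c [xA /cubeP xr] c0 ct; split; first exact: HAB.
  apply/cubeP => j; rewrite !mxE; apply: le_trans (ler_normD _ _) _; apply: lerD => //.
  rewrite normrM normr_nat (@le_trans _ _ `|c|)//.
    by rewrite ler_piMr// lern1 leq_b1.
  by rewrite (ger0_norm c0).
pose E := f - F; have mE : measurable_fun setT E by exact: measurable_funB.
have msE := measurable_shiftf (tau *: e i) mE.
have msF := measurable_shiftf (tau *: e i) mF.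
have mDF : measurable_fun setT (shiftf (tau *: e i) F - F) by exact: measurable_funB.
have mEE : measurable_fun setT (shiftf (tau *: e i) E - E) by exact: measurable_funB.
have NE : (N E <= d'%:E)%E by rewrite -nrmN opprB.
have NEE : (N (shiftf (tau *: e i) E - E)%R <= d'%:E + d'%:E)%E.
  apply: (le_trans (nrmD mu p1 msE (measurable_funN mE))); apply: leeD; last by rewrite nrmN.
  by rewrite nrm_shift.
have DE : D = (shiftf (tau *: e i) F - F) + (shiftf (tau *: e i) E - E).
  by apply/funext => x; rewrite /D /E !fctE /shiftf; ring.
have ND' : (N (D \_ A') <= tau%:E * N (Fi \_ B') + (d'%:E + d'%:E))%E.
  rewrite {1}DE; apply: (le_trans (nrm_patchD mA' mDF mEE)); apply: leeD => //.
  by apply: le_trans NEE; exact: nrm_patch.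
have NFi : (N (Fi \_ B') <= N (g \_ B) + d'%:E)%E.
  have mFg : measurable_fun setT (Fi - g) by exact: measurable_funB.
  rewrite -{1}(subrK g Fi) addrC; apply: (le_trans (nrm_patchD mB' mg mFg)); apply: leeD.
    by apply: nrm_patch_le => // x [].
  by apply: le_trans NG; exact: nrm_patch.
have mcr : measurable (~` (cube r : set V)) by apply: measurableC; exact: measurable_cube.
have -> : D \_ A = D \_ A' + D \_ (A `&` ~` cube r).
  apply/funext => x; change ((D \_ A) x = (D \_ A') x + (D \_ (A `&` ~` cube r)) x).
  rewrite !patch_rE !in_setI in_setC.
  by case: (x \in A); case: (x \in cube r) => /=; rewrite ?addr0 ?add0r.
have mAc : measurable (A `&` ~` cube r) by exact: measurableI.
apply: (le_trans (nrmD mu p1 (measurable_patch mA' mD) (measurable_patch mAc mD))).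
apply: (@le_trans _ _ (tau%:E * (N (g \_ B) + d'%:E) + (d'%:E + d'%:E) + d'%:E)%E).
  apply: leeD.
    apply: (le_trans ND'); apply: leeD => //.
    by apply: lee_wpmul2l => //; rewrite lee_fin ltW.
  by apply: le_trans Hr; apply: nrm_patch_le => // x [].
rewrite ge0_muleDr ?nrm_ge0 ?lee_fin ?(ltW d'0)// -!addeA leeD2l//.
rewrite -EFinM -!EFinD lee_fin /d'.
rewrite [leLHS](_ : _ = d)//; field.
by rewrite gt_eqF// ltr_wpDl ?ltW.
Qed.

End translation_estimate.

(** * A Poincaré inequality from translations into a set *)

Section poincare.
Context {R : realType} {n : nat}.
Local Notation V := 'rV[R]_n.
Local Notation mu := (lebesgue_rV R n).
Local Notation e := (delta_mx ord0).
Implicit Types (f : V -> R) (g : 'I_n -> V -> R) (x y z h v : V) (A B S U : set V) (i : 'I_n).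
Implicit Types (t C d : R).
Variable p : R.
Hypothesis p1 : 1 <= p.
Local Notation N := (nrm mu p).
Local Notation Lpf := (Lpf p).

Lemma measurable_shift_set A h : measurable A -> measurable [set x : V | A (x + h)].
Proof.
move=> mA; rewrite -[X in measurable X]setTI.
exact: (measurable_addr h measurableT mA).
Qed.

Lemma translation_weak f f' i A B (tau : R) : Lpf f -> Lpf f' -> weak_partial i f f' ->
  measurable A -> measurable B ->
  (forall x (c : R), A x -> `|c| <= `|tau| -> B (x + c *: e i)) ->
  (N ((shiftf (tau *: e i) f - f) \_ A)%R <= `|tau|%:E * N (f' \_ B)%R)%E.
Proof.
move=> Lf Lg w mA mB HAB; have [mf Nf] := Lf.
have [tau0|tau0|tau0] := ltgtP 0 tau; last first.
- rewrite -tau0 normr0 mul0e (_ : (_ \_ A) = 0) ?nrm0//.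
  by apply/funext => x; rewrite patch_rE !fctE /shiftf scale0r addr0 subrr; case: ifP.
(* The backward increment on [A] is, up to sign and a change of variables, the forward increment on
   [A] translated by [tau] in direction [i]. *)
- have tau0' : 0 < - tau by rewrite oppr_gt0.
  have mf' := measurable_shiftf (- tau *: e i) mf.
  have mD : measurable_fun setT (shiftf (- tau *: e i) f - f) by exact: measurable_funB.
  have mA' := measurable_shift_set (- tau *: e i) mA.
  rewrite (ltr0_norm tau0); apply: (@le_trans _ _
      (N ((shiftf (- tau *: e i) f - f) \_ [set x | A (x + - tau *: e i)]))); last first.
    apply: translation_weak_pos => // x c xA c0 ct.
    have -> : x + c *: e i = x + - tau *: e i + (c + tau) *: e i.
      by rewrite -addrA -scalerDl; congr (_ + _ *: _); lra.
    by apply: HAB => //; rewrite (ltr0_norm tau0) ler0_norm; lra.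
  rewrite -(nrm_shift _ (tau *: e i) (measurable_patch mA' mD)).
  have mft := measurable_shiftf (tau *: e i) mf.
  apply: nrm_le => //.
  - by apply: measurable_patch => //; exact: measurable_funB.
  - exact: measurable_shiftf (measurable_patch mA' mD).
  move=> x; rewrite [in leRHS]/shiftf !patch_rE.
  have xx : x + tau *: e i + - tau *: e i = x by rewrite -addrA -scalerDl subrr scale0r addr0.
  case: ifPn => [/set_mem xA|_]; last by rewrite normr0.
  rewrite mem_set /=; last by rewrite xx.
  change (`|f (x + tau *: e i) - f x| <=
    `|f (x + tau *: e i + - tau *: e i) - f (x + tau *: e i)|).
  by rewrite xx distrC.
rewrite (gtr0_norm tau0); apply: translation_weak_pos => // x c xA c0 ct.
by apply: HAB => //; rewrite (ger0_norm c0) (gtr0_norm tau0).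
Qed.

Lemma sum_delta_coord h (s : seq 'I_n) i : uniq s ->
  (\sum_(j <- s) h ord0 j *: (e j : V)) ord0 i = if i \in s then h ord0 i else 0.
Proof.
elim: s => [|j s ih] /=; first by rewrite big_nil mxE.
move=> /andP[js us]; rewrite big_cons mxE ih// !mxE eqxx /= inE.
case: eqVneq => [->|ij] /=; first by rewrite (negbTE js) addr0 mulr1.
by rewrite mulr0 add0r.
Qed.

(** One coordinate is moved at a time. In the sup norm the intermediate points stay within [|h|] of
    the starting point, provided that no coordinate is moved twice; hence a single [B] serves for
    all the moves. *)
Lemma translation_path f g A B h (s : seq 'I_n) : Lpf f -> (forall i, Lpf (g i)) ->
  (forall i, weak_partial i f (g i)) -> measurable A -> measurable B ->
  (forall x v, A x -> `|v| <= `|h| -> B (x + v)) -> uniq s ->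
  (N ((shiftf (\sum_(i <- s) h ord0 i *: (e i : V))%R f - f) \_ A)%R <=
   \sum_(i <- s) `|h ord0 i|%:E * N (g i \_ B)%R)%E.
Proof.
move=> Lf Lg w mA mB HAB; have [mf Nf] := Lf.
elim: s => [_|i s ih /= /andP[si us]].
  rewrite !big_nil (_ : (_ \_ A) = 0) ?nrm0//.
  by apply/funext => x; rewrite patch_rE !fctE /shiftf addr0 subrr; case: ifP.
rewrite !big_cons; set a := h ord0 i *: e i; set b := \sum_(i <- s) _.
have mD c : measurable_fun setT (shiftf c f - f).
  by apply: measurable_funB => //; exact: measurable_shiftf.
have -> : shiftf (a + b) f - f = shiftf b (shiftf a f - f) + (shiftf b f - f).
  apply/funext => x; rewrite !fctE /shiftf addrA subrK.
  by congr (f _ - f _); rewrite -!addrA [b + a]addrC.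
apply: (le_trans (nrm_patchD p1 mA (measurable_shiftf b (mD a)) (mD b))).
apply: leeD; last exact: ih.
(* The increment by [a] is taken after the translation by [b], hence on [A] translated by [b].
   Coordinate [i] of [b] is 0, so adding at most [|h ord0 i|] there keeps the sup norm below
   [|h|]. *)
pose A' : set V := [set y | A (y - b)].
have mA' : measurable A' by exact: measurable_shift_set.
apply: (@le_trans _ _ (N ((shiftf a f - f) \_ A'))); last first.
  apply: translation_weak => // y c yA ch.
  rewrite -[y](subrK b) -addrA; apply: HAB => //; apply: norm_coord_le => // j.
  rewrite mxE sum_delta_coord// !mxE eqxx /=.
  case: (eqVneq j i) => [->|ji]; first by rewrite (negbTE si) add0r mulr1 (le_trans ch)// norm_coord.
  by rewrite mulr0 addr0; case: ifP; rewrite ?normr0// norm_coord.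
rewrite -(nrm_shift _ b (measurable_patch mA' (mD a))).
apply: nrm_le => //; [exact: measurable_patch (measurable_shiftf b (mD a))|
  exact: measurable_shiftf (measurable_patch mA' (mD a))|].
move=> x; rewrite [in leRHS]/shiftf !patch_rE.
case: ifPn => [/set_mem xA|_]; last by rewrite normr0.
by rewrite mem_set// /A'/= addrK.
Qed.

Lemma translation_bound f g A B h : Lpf f -> (forall i, Lpf (g i)) ->
  (forall i, weak_partial i f (g i)) -> measurable A -> measurable B ->
  (forall x v, A x -> `|v| <= `|h| -> B (x + v)) ->
  (N ((shiftf h f - f) \_ A)%R <= `|h|%:E * \sum_i N (g i \_ B)%R)%E.
Proof.
move=> Lf Lg w mA mB HAB.
have := translation_path Lf Lg w mA mB HAB (index_enum_uniq _).
have <- : h = \sum_i h ord0 i *: (e i : V) by exact: row_sum_delta.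
move=> H; apply: le_trans H _.
rewrite ge0_sume_distrr; last by move=> i _; exact: nrm_ge0.
apply: lee_sum => i _; apply: lee_wpmul2r; first exact: nrm_ge0.
by rewrite lee_fin norm_coord.
Qed.

Lemma nrm_setU f S A B : measurable S -> measurable A -> measurable B -> measurable_fun setT f ->
  (forall x, S x -> A x \/ B x) ->
  (N (f \_ S) <= N (f \_ A) + N (f \_ B))%E.
Proof.
move=> mS mA mB mf H.
have mB' : measurable (B `\` A) by exact: measurableD.
apply: (@le_trans _ _ (N (f \_ A + f \_ (B `\` A))%R)).
  apply: nrm_le => //; [exact: measurable_patch|by apply: measurable_funD; exact: measurable_patch|].
  move=> x; change (`|(f \_ S) x| <= `|(f \_ A) x + (f \_ (B `\` A)) x|).
  rewrite !patch_rE; case: ifPn => [/set_mem /H xAB|_]; last by rewrite normr0.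
  have [xA|xA] := pselect (A x).
    rewrite mem_set// memNset ?addr0//; by case.
  case: xAB => // xB; rewrite memNset// mem_set// add0r.
  by [].
apply: (le_trans (nrmD mu p1 (measurable_patch mA mf) (measurable_patch mB' mf))).
by apply: leeD => //; apply: nrm_patch_le => // x [].
Qed.

(** Induction on [H]: on the part of [S] that [h] carries into [U], the translate of [f] by [h]
    vanishes a.e., so [f] is there its own increment and [translation_bound] applies. The remaining
    translations take care of the rest of [S]. *)
Lemma poincare f g S B U (H : seq V) (rho : R) : Lpf f -> (forall i, Lpf (g i)) ->
  (forall i, weak_partial i f (g i)) -> measurable S -> measurable B -> measurable U ->
  0 <= rho -> N (f \_ U) = 0%E -> (forall h, h \in H -> `|h| <= rho) ->
  (forall x, S x -> exists2 h, h \in H & U (x + h)) ->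
  (forall x v, S x -> `|v| <= rho -> B (x + v)) ->
  (N (f \_ S) <= ((size H)%:R * rho)%:E * \sum_i N (g i \_ B))%E.
Proof.
move=> Lf Lg w + mB mU rho0 fU; have [mf Nf] := Lf.
have sum0 : (0 <= \sum_i N (g i \_ B))%E by apply: sume_ge0 => i _; exact: nrm_ge0.
elim: H S => [|h H ih] S mS Hrho HS HB.
  rewrite mul0r mul0e (_ : f \_ S = 0) ?nrm0//.
  apply/funext => x; rewrite patch_rE; case: ifP => // /set_mem /HS[h].
  by rewrite in_nil.
pose A : set V := [set x | U (x + h)].
have mA : measurable A by exact: measurable_shift_set.
have mSA : measurable (S `&` A) by exact: measurableI.
have mSD : measurable (S `\` A) by exact: measurableD.
have -> : (((size (h :: H))%:R * rho)%:E * \sum_i N (g i \_ B) =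
    rho%:E * \sum_i N (g i \_ B) + ((size H)%:R * rho)%:E * \sum_i N (g i \_ B))%E.
  rewrite -ge0_muleDl ?lee_fin ?mulr_ge0//.
  by rewrite -EFinD -nat1r mulrDl mul1r.
apply: (le_trans (nrm_setU mS mSA mSD mf _)).
  by move=> x xS; have [xA|xA] := pselect (A x); [left|right].
apply: leeD; last first.
  apply: ih => //.
  - by move=> v vH; apply: Hrho; rewrite inE vH orbT.
  - move=> x [xS xA]; have [v + xv] := HS _ xS; rewrite inE => /predU1P[vh|vH].
      by exfalso; apply: xA; rewrite /A/= -vh.
    by exists v.
  - by move=> x v [xS _]; exact: HB.
have hr : `|h| <= rho by apply: Hrho; rewrite mem_head.
have msf := measurable_shiftf h mf.
have mD : measurable_fun setT (f - shiftf h f) by exact: measurable_funB.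
rewrite -{1}(subrK (shiftf h f) f).
apply: (le_trans (nrm_patchD p1 mSA mD msf)).
have -> : N (shiftf h f \_ (S `&` A)) = 0%E.
  apply/eqP; rewrite eq_le nrm_ge0 andbT -fU -(nrm_shift _ h (measurable_patch mU mf)).
  apply: nrm_le => //; [exact: measurable_patch|exact: measurable_shiftf (measurable_patch mU mf)|].
  move=> x; rewrite [in leRHS]/shiftf !patch_rE; case: ifPn => [/set_mem[_ xA]|_]; last by rewrite normr0.
  by rewrite mem_set.
rewrite adde0 -nrmN -scaleN1r -patchZ scaleN1r opprB.
apply: (le_trans (translation_bound Lf Lg w mSA mB _)).
  by move=> x v [xS _] vh; apply: HB => //; exact: le_trans vh hr.
by apply: lee_wpmul2r => //; rewrite lee_fin.
Qed.

End poincare.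

(** * Approximation by test functions vanishing near a set *)

Section neighborhoods.
Context {R : realType} {n : nat}.
Local Notation V := 'rV[R]_n.
Local Notation mu := (lebesgue_rV R n).
Implicit Types (f phi psi rho : V -> R) (x y z h v : V) (A B S U : set V) (i : 'I_n).
Implicit Types (t C d : R) (s : seq 'I_n) (G : seq 'I_n -> V -> R).

Definition nbd U t : set V := [set x | exists2 y, U y & `|x - y| < t].

Lemma open_nbd U t : open (nbd U t).
Proof.
rewrite (_ : nbd U t = \bigcup_(y in U) ball y t).
  by apply: bigcup_open => y _; exact: ball_open.
apply/seteqP; split => [x [y Uy xy]|x [y Uy]].
  by exists y => //; rewrite mx_norm_ball /ball_/= distrC.
by rewrite mx_norm_ball /ball_/= distrC => xy; exists y.
Qed.

Lemma measurable_nbd U t : measurable (nbd U t).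
Proof. by apply: open_measurable_rV; exact: open_nbd. Qed.

Lemma measurable_closure U : measurable (closure U).
Proof.
rewrite -(setCK (closure U)); apply: measurableC; apply: open_measurable_rV.
by apply: closed_openC; exact: closed_closure.
Qed.

Lemma nbd_add U t r x v : nbd U t x -> `|v| <= r -> nbd U (t + r) (x + v).
Proof.
move=> [y Uy xy] vr; exists y => //; rewrite addrAC.
by apply: le_lt_trans (ler_normD _ _) _; exact: ltr_leD.
Qed.

Lemma nbd_sub U t r : t <= r -> nbd U t `<=` nbd U r.
Proof. by move=> tr x [y Uy xy]; exists y => //; exact: lt_le_trans xy tr. Qed.

Lemma list_bound (C : seq 'I_n -> R) k : exists2 M : R, 0 <= M &
  forall s, (size s <= k)%N -> C s <= M.
Proof.
elim: k C => [|k ih] C.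
  exists `|C [::]| => // s; rewrite leqn0 => /nilP ->; exact: ler_norm.
have /choice[M HM] : forall i, exists M : R, 0 <= M /\
    forall s, (size s <= k)%N -> C (i :: s) <= M.
  by move=> i; have [M M0 HM] := ih (fun s => C (i :: s)); exists M.
exists (`|C [::]| + \sum_i M i).
  by rewrite addr_ge0// sumr_ge0// => i _; have [] := HM i.
move=> [_|i s sk].
  by rewrite ler_wpDr ?ler_norm// sumr_ge0// => i _; have [] := HM i.
have [Mi0 /(_ s sk) H] := HM i.
rewrite ler_wpDl// (bigD1 i)//= ler_wpDr// sumr_ge0// => j _.
by have [] := HM j.
Qed.

(** The indicator of the t/2-neighbourhood is mollified at scale t/4, which leaves the value 1 on
    the t/4-neighbourhood and nothing beyond 3t/4. Each derivative of the kernel costs 4/t, and the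
    constants depend neither on [U] nor on [t]. *)
Lemma cutoff_function : exists2 C : seq 'I_n -> R, (forall s, 0 <= C s) &
  forall U t, 0 < t -> exists psi, [/\ Csmooth psi,
    (forall s, vanish_off (nbd U t) (partials s psi)),
    (forall s x, `|partials s psi x| <= C s / t ^+ size s) &
    forall x, nbd U (t / 4) x -> psi x = 1].
Proof.
have [C C0 HC] := @mollifier_scale R n.
exists (fun s => C s * 4 ^+ size s) => [s|U t t0]; first by rewrite mulr_ge0// exprn_ge0.
have eta0 : 0 < t / 4 by rewrite divr_gt0.
have [rho kr Hrho] := HC _ eta0; have [tr rho0 rho1 rv] := kr.
pose A := nbd U (t / 2); pose f : V -> R := \1_A.
have mf : measurable_fun setT f by apply: measurable_indic; exact: measurable_nbd.
have f1 x : `|f x| <= 1 by rewrite /f indicE; case: (_ \in _); rewrite ?normr1 ?normr0.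
have lf : lint f.
  split => // r; have [_ /(_ r)] := lint_cst 1 : lint (cst 1 : V -> R).
  apply: le_integrable => //; first exact: measurable_cube.
    by apply/measurable_EFinP; exact: measurable_funS mf.
  by move=> x _ /=; rewrite lee_fin normr1.
have half : t = t / 2 + t / 2 by lra.
exists (mollify f rho); split.
- exact: smooth_conv.
- move=> s x xU; rewrite partials_conv//; apply: (conv_out (r := t / 4)).
    have := @vanish_off_partials _ _ (cube (t / 4)) s rho (@closed_cube _ _ _) rv.
    by move=> H z /H; rewrite fctE => ->; rewrite scaler0.
  move=> h; rewrite cubeE ?(ltW eta0)// => hr; rewrite /f indicE memNset//.
  move=> /(nbd_add (v := - h)); rewrite addrK normrN => /(_ _ hr) H; apply: xU.
  by apply: nbd_sub H; lra.
- move=> s x; rewrite partials_conv//.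
  have [Is Hs] := Hrho s.
  have tps := Ctest_partials s tr.
  have tps' := CtestZ ((-1) ^+ size s) tps.
  rewrite convE//.
  have -> : C s * 4 ^+ size s / t ^+ size s = C s / (t / 4) ^+ size s.
    by rewrite exprMn exprVn invfM invrK; ring.
  apply: le_trans Hs.
  have I1 : mu.-integrable setT (EFin \o (fun y => f (x + y) * ((-1) ^+ size s *: partials s rho) y)).
    have := integrable_shift x (integrable_test lf (Ctest_shift (- x) tps')).
    by apply: eq_integrable => // y _; rewrite /= !fctE addrK addrC.
  apply: (le_trans (le_normr_Rintegral measurableT I1)).
  apply: le_Rintegral => //.
  + exact: integrable_norm I1.
  + exact: integrable_norm Is.
  move=> y _; rewrite fctE !normrM normrX normrN1 expr1n mul1r ler_piMl//.
- move=> x xU; rewrite convE// -[RHS]rho1; apply: eq_Rintegral => y _.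
  have [|yc] := pselect (cube (t / 4) y); last by rewrite rv// mulr0.
  rewrite cubeE ?(ltW eta0)// => yr; rewrite /f indicE mem_set ?mul1r//.
  by apply: nbd_sub (nbd_add xU yr); lra.
Qed.

Section Lp.
Variable p : R.
Hypothesis p1 : 1 <= p.
Local Notation N := (nrm mu p).
Local Notation Lpf := (Lpf p).
Local Notation fam := (fam p).
Local Notation small := (small p).
Local Notation sob := (sob p).

(** A point outside the closure of [U] leaves the neighbourhoods as they shrink, so dominated
    convergence applies to [f] off that closure. *)
Lemma nrm_nbd f U d : Lpf f -> N (f \_ (closure U)) = 0%E -> 0 < d ->
  exists r : R, 0 < r /\ forall t, 0 < t -> t <= r -> (N (f \_ (nbd U t)) <= d%:E)%E.
Proof.
move=> [mf Nf] N0 d0.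
have mc := measurable_closure U.
pose f' := f \_ (~` closure U).
have mf' : measurable_fun setT f' by apply: measurable_patch => //; exact: measurableC.
have c0 x : (f' \_ (nbd U k.+1%:R^-1)) x @[k --> \oo] --> (0 : R).
  apply: cvg_near_cst; have [xc|xc] := pselect (closure U x).
    have fx : f' x = 0 by rewrite /f' patch_rE memNset//; case.
    by exists 0%N => // k _; rewrite /= patch_rE fx; case: ifP.
  have /nbhs_ballP[r /= r0 Hr] : nbhs x (~` closure U).
    by apply: open_nbhs_nbhs; split => //; apply: closed_openC; exact: closed_closure.
  have [k0 Hk0] := ltr_add_invr r0; exists k0 => // k /= kk.
  rewrite patch_rE memNset// => -[y Uy xy].
  have := @subset_closure _ U _ Uy; apply: Hr.
  rewrite mx_norm_ball /ball_/=; apply: (lt_trans xy); rewrite add0r in Hk0.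
  by apply: le_lt_trans Hk0; rewrite lef_pV2 ?posrE// ler_nat ltnS.
have [k Hk] := nrm_dct p1 (fun k => measurable_patch (measurable_nbd U k.+1%:R^-1) mf') mf Nf
  (fun k x => le_trans (norm_patch _ f' x) (norm_patch _ f x)) c0 d0.
exists k.+1%:R^-1; split; first by rewrite invr_gt0.
move=> t t0 tk; apply: le_trans (Hk k (leqnn _)).
have mt := measurable_nbd U t.
have mi := measurableI _ _ mt (measurableC mc).
apply: (le_trans (nrm_setU p1 mt mi mc mf _)).
  by move=> x xt; have [xc|xc] := pselect (closure U x); [right|left].
rewrite N0 adde0; apply: nrm_le => //; first exact: measurable_patch.
  by apply: measurable_patch => //; exact: measurable_nbd.
move=> x; rewrite patch_rE; case: ifPn => [/set_mem[xt xc]|_]; last by rewrite normr0.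
by rewrite patch_rE mem_set ?/f' ?patch_rE ?mem_set//; exact: nbd_sub tk _ xt.
Qed.

(** The corkscrew condition in the form in which it is used: at every small scale, at most [K]
    translations of size O(t) carry the neighbourhood into [U]. That [K] does not depend on [t]
    makes the constants below uniform. *)
Definition corkscrew U c t0 (K : nat) := forall t : R, 0 < t -> t < t0 ->
  exists H : seq V, [/\ (size H <= K)%N, forall h, h \in H -> `|h| <= c * t &
    forall x, nbd U t x -> exists2 h, h \in H & U (x + h)].

(** Each Poincaré step goes up one order, gains a factor [t] and multiplies the size of the
    neighbourhood by 1 + c; after [m] steps only the derivatives of order [k], bounded by [w],
    remain. *)
Lemma poincare_iter k G U c t0 K : 0 <= c -> open U -> corkscrew U c t0 K -> fam k G ->
  (forall s, (size s <= k)%N -> N (G s \_ U) = 0%E) ->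
  forall m, exists2 C, 0 <= C & forall s t w, (m + size s = k)%N -> 0 < t ->
    t * (1 + c) ^+ m < t0 -> 0 <= w ->
    (forall r, size r = k -> (N (G r \_ (nbd U (t * (1 + c) ^+ m))) <= w%:E)%E) ->
    (N (G s \_ (nbd U t)) <= (C * t ^+ m * w)%:E)%E.
Proof.
move=> c0 oU cU [LG wG] G0; elim=> [|m [C C0 ih]].
  exists 1 => // s t w; rewrite add0n expr0 !mul1r mulr1 => sk _ _ _; exact.
have c1 : 1 <= 1 + c by rewrite lerDl.
(* [K%:R * c] is the Poincaré constant divided by [t], [n] counts the derivatives of next order, and
   the last factor comes from applying the induction hypothesis at scale t (1 + c). *)
pose C' := K%:R * c * (n%:R * (C * (1 + c) ^+ m)).
exists C'; first by rewrite !mulr_ge0// exprn_ge0// addr_ge0.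
move=> s t w sk t0' tt w0 Hw.
have tpos : 0 < t * (1 + c) by rewrite mulr_gt0// (lt_le_trans ltr01).
have tt0 : t < t0.
  by apply: le_lt_trans tt; rewrite ler_peMr ?exprn_ege1// ltW.
have [H [HK Hr HU]] := cU t t0' tt0.
have ssk : (size s < k)%N by rewrite -sk addSn ltnS leq_addl.
have := poincare p1 (LG s (ltnW ssk)) (fun i => LG (i :: s) ssk) (fun i => wG i s ssk)
  (measurable_nbd U t) (measurable_nbd U (t * (1 + c))) (open_measurable_rV oU)
  (mulr_ge0 c0 (ltW t0')) (G0 s (ltnW ssk)) Hr HU _.
move=> /(_ _) PI; apply: (le_trans (PI _)).
  by move=> x v xt vr; rewrite mulrDr mulr1 [t * c]mulrC; exact: nbd_add.
apply: (@le_trans _ _ ((K%:R * (c * t))%:E * \sum_(i < n) (C * (t * (1 + c)) ^+ m * w)%:E)%E).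
  apply: lee_pmul.
  - by rewrite lee_fin !mulr_ge0// ltW.
  - by apply: sume_ge0 => i _; exact: nrm_ge0.
  - by rewrite lee_fin ler_wpM2r ?ler_nat// mulr_ge0// ltW.
  apply: lee_sum => i _; apply: ih => //.
  - by rewrite /= -sk addnS.
  - by rewrite -mulrA -exprS.
  - by move=> r rk; rewrite -mulrA -exprS; exact: Hw.
rewrite sumEFin -EFinM lee_fin sumr_const card_ord -mulr_natl exprMn exprS /C'.
by rewrite le_eqVlt; apply/orP; left; apply/eqP; ring.
Qed.

(** There are finitely many derivatives of order [k], so [nrm_nbd] makes all of them smaller than
    [w] below a common scale; the iterated Poincaré inequality turns this into the weighted bounds
    of all lower orders. *)
Lemma sob_nbd k G U c t0 K d : 0 < c -> 0 < t0 -> open U -> corkscrew U c t0 K -> fam k G ->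
  (forall s, (size s <= k)%N -> N (G s \_ (closure U)) = 0%E) -> 0 < d ->
  exists t, [/\ 0 < t, t <= 1 & sob k 0 t d (nbd U t) (G [::])].
Proof.
move=> c0 t00 oU cU fG G0 d0; have [LG wG] := fG.
have /choice[C HC] : forall m, exists C : R, 0 <= C /\ forall s t w, (m + size s = k)%N -> 0 < t ->
    t * (1 + c) ^+ m < t0 -> 0 <= w ->
    (forall r, size r = k -> (N (G r \_ (nbd U (t * (1 + c) ^+ m))) <= w%:E)%E) ->
    (N (G s \_ (nbd U t)) <= (C * t ^+ m * w)%:E)%E.
  move=> m; have [|C C0 HC] := poincare_iter (ltW c0) oU cU fG _ m; last by exists C.
  move=> s sk; apply/eqP; rewrite eq_le nrm_ge0 andbT -(G0 _ sk).
  have [mG _] := LG _ sk.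
  apply: nrm_patch_le => //; [exact: open_measurable_rV|exact: measurable_closure|].
  exact: subset_closure.
have [M M0 HM] := list_bound (fun s => C (k - size s)%N) k.
pose w := d / (M + 1).
have M1 : 0 < M + 1 by rewrite ltr_wpDl.
have w0 : 0 < w by rewrite divr_gt0.
have /finite_scale[q [q0 Hq]] : forall r : k.-tuple 'I_n, exists a : R, 0 < a /\
    forall t, 0 < t -> t <= a -> (N (G r \_ (nbd U t)) <= w%:E)%E.
  by move=> r; apply: nrm_nbd => //; [apply: LG|apply: G0]; rewrite size_tuple.
have c1 : 1 <= 1 + c by rewrite lerDl ltW.
have cp m : 0 < (1 + c) ^+ m by rewrite exprn_gt0// (lt_le_trans ltr01).
(* The divisor makes room for [k] enlargements by 1 + c: the largest neighbourhood must stay below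
   both [t0], strictly, and the scale [q] at which order [k] is small. *)
pose t := Num.min 1 (Num.min (t0 / 2) q / (1 + c) ^+ k).
have t0' : 0 < t by rewrite lt_min ltr01 divr_gt0// lt_min q0 divr_gt0.
have tk : t * (1 + c) ^+ k <= Num.min (t0 / 2) q.
  by rewrite -ler_pdivlMr// ge_min lexx orbT.
have tm m : (m <= k)%N -> t * (1 + c) ^+ m <= Num.min (t0 / 2) q.
  by move=> mk; apply: le_trans tk; rewrite ler_pM2l// ler_weXn2l.
exists t; split=> //; first by rewrite ge_min lexx.
apply: fam_sob => // s sk; have [C0 H] := HC (k - size s)%N.
have mk : (k - size s <= k)%N by rewrite leq_subr.
apply: (le_trans (H s t w _ t0' _ (ltW w0) _)).
- by rewrite subnK.
- apply: (le_lt_trans (tm _ mk)).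
  by rewrite gt_min; apply/orP; left; rewrite ltr_pdivrMr// ltr_pMr// ltr1n.
- move=> r rk; have rs : size r == k by exact/eqP.
  have := Hq _ _ _ (Tuple rs); apply; first by rewrite mulr_gt0.
  by apply: le_trans (tm _ mk) _; rewrite ge_min lexx orbT.
rewrite lee_fin mulrAC ler_wpM2r ?exprn_ge0 ?(ltW t0')//.
rewrite /w mulrA ler_pdivrMr// mulrC ler_pM2l//.
by apply: le_trans (HM _ sk) _; rewrite lerDl.
Qed.

Lemma partials_cst (a : R) s : exists2 b : R, `|b| <= `|a| & partials s (cst a : V -> R) = cst b.
Proof.
elim: s => [|i s [b ba /= ->]]; first by exists a.
exists 0; first by rewrite normr0.
by apply/funext => x; rewrite /partial derive_cst.
Qed.

(** The cutoff at the fixed scale 1 around the ball of radius [r]: its derivatives have bounds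
    independent of [r]. *)
Lemma cutoff_infinity : exists2 C : seq 'I_n -> R, (forall s, 0 <= C s) &
  forall r : R, 0 < r -> exists chi, [/\ Ctest chi,
    (forall s x, `|partials s chi x| <= C s) &
    forall x, `|x| < r -> chi x = 1].
Proof.
have [C C0 HC] := cutoff_function; exists C => // r r0.
have [psi [sp vp bp p1']] := HC [set x | `|x| < r] 1 ltr01.
exists psi; split.
- split => //; exists (r + 1) => x xr; apply: (vp [::]) => -[y yr xy]; apply: xr.
  rewrite cubeE ?addr_ge0 ?(ltW r0)//= -[x](subrK y).
  apply: le_trans (ler_normD _ _) _; rewrite addrC; apply: lerD; exact: ltW.
- by move=> s x; have := bp s x; rewrite expr1n divr1.
by move=> x xr; apply: p1'; exists x => //; rewrite subrr normr0 divr_gt0.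
Qed.

Lemma fam_small k G : fam k G -> exists2 E : R, 0 <= E & small k E (G [::]).
Proof.
move=> fG; have [LG _] := fG.
have [E E0 HE] := list_bound (fun s => fine (N (G s))) k.
exists E => //; apply: fam_sob => // s sk; have [_ Ns] := LG _ sk.
rewrite patch_setT expr1n mulr1.
have <- : (fine (N (G s)))%:E = N (G s) by rewrite fineK// ge0_fin_numE// nrm_ge0.
by rewrite lee_fin; exact: HE.
Qed.

Lemma fam_tail k G d : fam k G -> 0 < d ->
  exists2 r, 0 < r & sob k 0 1 d (~` [set x | `|x| < r]) (G [::]).
Proof.
move=> fG d0; have [LG _] := fG.
have /choice[r Hr] : forall s, exists r : R, (size s <= k)%N -> 0 < r /\
    (N (G s \_ (~` cube r)) <= d%:E)%E.
  move=> s; have [sk|sk] := boolP (size s <= k)%N; last by exists 0.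
  by have [r r0 Hr] := nrm_tail p1 (LG _ sk) d0; exists r.
have [M M0 HM] := list_bound r k.
exists (M + 1); first by rewrite ltr_wpDl.
have oM : open [set x : V | `|x| < M + 1].
  rewrite (_ : mkset _ = ball (0 : V) (M + 1)); first exact: ball_open.
  by apply/seteqP; split => x; rewrite mx_norm_ball /ball_/= sub0r normrN.
have mM : measurable (~` [set x : V | `|x| < M + 1]).
  by apply: measurableC; exact: open_measurable_rV.
apply: fam_sob => // s sk; rewrite expr1n mulr1; have [r0 H] := Hr _ sk.
apply: le_trans H; have [mG _] := LG _ sk; apply: nrm_patch_le => //.
  by apply: measurableC; exact: measurable_cube.
move=> x xM; rewrite /setC/= cubeE ?(ltW r0)//= => xr; apply: xM => /=.
by apply: le_lt_trans xr _; apply: le_lt_trans (HM _ sk) _; rewrite ltrDl.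
Qed.

(** With [chi] the cutoff at infinity and [psi] the one near [U], [phi] is a mollification of chi (1
    - psi) f. The three errors, (1 - chi) f, chi psi f and that of the mollification, receive d/3
    each. *)
Lemma test_approximation k G U c t0 K d : 0 < c -> 0 < t0 -> open U -> corkscrew U c t0 K ->
  fam k G -> (forall s, (size s <= k)%N -> N (G s \_ (closure U)) = 0%E) -> 0 < d ->
  exists phi, exists t, [/\ Ctest phi, 0 < t, (forall x, nbd U t x -> phi x = 0) &
    small k d (G [::] - phi)].
Proof.
move=> c0 t00 oU cU fG G0 d0; pose f := G [::]; have [LG _] := fG.
have [Ci Ci0 HCi] := cutoff_infinity.
have [C C0 HC] := cutoff_function.
have [Mi Mi0 HMi] := list_bound Ci k.
have [M M0 HM] := list_bound C k.
have d3 : 0 < d / 3 by rewrite divr_gt0.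
(* [D1] is the loss of the lemma [cutoff] for the cutoff at infinity, [D2] the product of the losses
   of both cutoffs. *)
pose D1 := 2 ^+ k * (1 + Mi).
have D10 : 0 < D1 by rewrite mulr_gt0 ?exprn_gt0// ltr_pwDl.
pose D2 := 2 ^+ k * (1 + Mi) * (2 ^+ k * (1 + M)).
have D20 : 0 < D2 by rewrite !mulr_gt0 ?exprn_gt0// ltr_pwDl.
have [r r0 sr] := fam_tail fG (divr_gt0 d3 D10).
have [chi [tchi bchi chi1]] := HCi _ r0; have [schi _] := tchi.
have oB : open [set x : V | `|x| < r].
  rewrite (_ : mkset _ = ball (0 : V) r); first exact: ball_open.
  by apply/seteqP; split => x; rewrite mx_norm_ball /ball_/= sub0r normrN.
have mB : measurable (~` [set x : V | `|x| < r]).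
  by apply: measurableC; exact: open_measurable_rV.
have scst : Csmooth (cst 1 : V -> R) by exact: smooth_cst.
have s1 : small k (d / 3) ((cst 1 - chi) * f).
  have -> : d / 3 = 2 ^+ k * (1 + Mi) * (d / 3 / D1) by rewrite -/D1 [RHS]mulrC divfK// gt_eqF.
  apply: (cutoff p1 ltr01 (lexx 1) _ _ mB _ _ _ sr).
  - by rewrite addr_ge0.
  - by rewrite divr_ge0 ?ltW.
  - exact: smoothB.
  - move=> s; apply: vanish_off_partials; first exact: open_closedC.
    by move=> x /contrapT /chi1 cx; change (1 - chi x = 0); rewrite cx subrr.
  move=> s x sk; rewrite expr1n divr1 partialsB//.
  have [b b1 ->] := partials_cst 1 s; rewrite normr1 in b1.
  change (`|b - partials s chi x| <= 1 + Mi).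
  apply: le_trans (ler_normB _ _) _; apply: lerD => //.
  by apply: le_trans (bchi _ _) (HMi _ sk).
have [t [t0' t1 st]] := sob_nbd c0 t00 oU cU fG G0 (divr_gt0 d3 D20).
have [psi [spsi vpsi bpsi psi1]] := HC U _ t0'.
have s2 : small k (2 ^+ k * (1 + M) * (d / 3 / D2)) (psi * f).
  apply: (cutoff p1 t0' t1 _ _ (measurable_nbd U t) spsi vpsi _ st).
  - by rewrite addr_ge0.
  - by rewrite divr_ge0 ?ltW.
  move=> s x sk; apply: le_trans (bpsi s x) _; rewrite add0n.
  rewrite ler_wpM2r ?invr_ge0 ?exprn_ge0 ?(ltW t0')//.
  by apply: le_trans (HM _ sk) _; rewrite lerDr.
have s3 : small k (d / 3) (chi * (psi * f)).
  have -> : d / 3 = 2 ^+ k * (1 + Mi) * (2 ^+ k * (1 + M) * (d / 3 / D2)).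
    by rewrite [RHS]mulrA -/D2 [RHS]mulrC divfK// gt_eqF.
  apply: (cutoff p1 ltr01 (lexx 1) _ _ measurableT schi _ _ s2).
  - by rewrite addr_ge0.
  - by rewrite !mulr_ge0 ?addr_ge0 ?exprn_ge0 ?divr_ge0 ?invr_ge0 ?(ltW D20)// ltW.
  - by move=> s x [].
  move=> s x sk; rewrite expr1n divr1; apply: le_trans (bchi _ _) _.
  by apply: le_trans (HMi _ sk) _; rewrite lerDr.
have [E E0 sE] := fam_small fG.
pose f2 := f - ((cst 1 - chi) * f + chi * (psi * f)).
have f2E x : f2 x = chi x * ((1 - psi x) * f x).
  by change (f x - ((1 - chi x) * f x + chi x * (psi x * f x)) = chi x * ((1 - psi x) * f x)); ring.
have s4 := sobD p1 measurableT s1 s3.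
have [E2 sE2] : exists E2, small k E2 f2.
  have := sobD p1 measurableT sE (sobZ p1 (-1) measurableT s4).
  by rewrite scaleN1r; eexists; eassumption.
have [q [q0 Hq]] := small_mollify p1 sE2 d3.
(* [f2] vanishes on the t/4-neighbourhood of [U], where psi = 1; a kernel of size at most t/8
   preserves this on the t/8-neighbourhood. *)
pose eta := Num.min q (t / 8).
have eta0 : 0 < eta by rewrite lt_min q0 divr_gt0.
have [C' _ /(_ _ eta0)[rho kr _]] := @mollifier_scale R n.
have etaq : eta <= q by rewrite ge_min lexx.
have s5 := Hq _ eta0 etaq _ kr; have [tr _ _ rv] := kr.
have lf2 : lint f2 by apply: (Lpf_lint p1); exact: sob_Lpf sE2.
have [rc rc0 chiv] := Ctest_supp tchi.
exists (mollify f2 rho), (t / 8); split.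
- split; first exact: smooth_conv.
  exists (rc + eta) => x xr; apply: (conv_out rv) => h.
  rewrite cubeE ?(ltW eta0)// => hr; rewrite f2E chiv ?mul0r// => xh; apply: xr.
  move: xh; rewrite !cubeE ?addr_ge0 ?(ltW eta0)//= => xh.
  rewrite -[x](addrK h); apply: le_trans (ler_normB _ _) _; exact: lerD.
- by rewrite divr_gt0.
- move=> x xU; apply: (conv_out rv) => h; rewrite cubeE ?(ltW eta0)// => hr.
  rewrite f2E psi1 ?subrr ?mul0r ?mulr0//.
  have h8 : `|h| <= t / 8 by apply: le_trans hr _; rewrite ge_min lexx orbT.
  by apply: nbd_sub (nbd_add xU h8); lra.
have -> : G [::] - mollify f2 rho = ((cst 1 - chi) * f + chi * (psi * f)) + (-1) *: (mollify f2 rho - f2).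
  have gen (a b w : V -> R) : a - b = w + (-1) *: (b - (a - w)).
    by rewrite scaleN1r opprB [RHS]addrA [w + _]addrC subrK.
  exact: gen.
have -> : d = (d / 3 + d / 3) + `|-1| * (d / 3) by rewrite normrN1; lra.
exact: (sobD p1 measurableT s4 (sobZ p1 (-1) measurableT s5)).
Qed.

End Lp.
End neighborhoods.

(** * Corkscrew condition and its consequences *)

Section geometry.
Context {R : realType} {n : nat}.
Local Notation V := 'rV[R]_n.
Local Notation mu := (lebesgue_rV R n).
Implicit Types (x y z h v w : V) (A B S U : set V) (t c r : R).

Lemma norm_le_enorm x : `|x| <= enorm x.
Proof.
apply: norm_coord_le => [|i]; first exact: sqrtr_ge0.
rewrite -sqrtr_sqr ler_sqrt; last by apply: sumr_ge0 => j _; exact: sqr_ge0.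
by rewrite (bigD1 i)//= lerDl sumr_ge0// => j _; exact: sqr_ge0.
Qed.

Lemma enorm_le_norm x : enorm x <= n%:R * `|x|.
Proof.
have nx : 0 <= n%:R * `|x| by rewrite mulr_ge0.
rewrite -(ger0_norm nx) -sqrtr_sqr ler_sqrt ?sqr_ge0// exprMn.
apply: (@le_trans _ _ (\sum_(i < n) `|x| ^+ 2)).
  by apply: ler_sum => i _; rewrite -real_normK ?num_real// lerXn2r ?nnegrE// norm_coord.
rewrite sumr_const card_ord -[leLHS]mulr_natl ler_wpM2r ?sqr_ge0//.
by rewrite expr2; case: (n) => [|m]; rewrite ?mul0r// ler_peMr// ler1n.
Qed.

Lemma continuous_dist y : continuous (fun w : V => `|w - y|).
Proof.
apply: norm_continuousP => x d d0; exists d => // w xw.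
apply: le_trans (ltW xw); rewrite ler_distl.
have := ler_distD x w y; have := ler_distD w x y; rewrite [ `|w - x|]distrC.
by move: `|w - y| `|x - y| `|x - w| => a b c; lra.
Qed.

(** The hypothesis makes the trace of [U] on the segment closed as well as open, and the segment is
    connected. This is how a lower bound on the distance to the boundary yields a ball inside
    [U]. *)
Lemma segment_sub U z w : open U -> U z ->
  (forall s : R, 0 <= s -> s <= 1 -> closure U (z + s *: (w - z)) -> U (z + s *: (w - z))) ->
  U w.
Proof.
move=> oU Uz H.
pose g (s : R) : V := z + s *: (w - z).
have cg : continuous g.
  move=> s; apply: (@continuousD R V _ (cst z) (fun s : R => s *: (w - z))).
    exact: cst_continuous.
  exact: (@scalel_continuous R V (w - z)).
have cI : connected (`[0, 1]%classic : set R).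
  by apply/connected_intervalP; exact: interval_is_interval.
have E : `[0, 1]%classic `&` g @^-1` U = `[0, 1]%classic `&` g @^-1` (closure U).
  apply/seteqP; split => s /= [s01 us]; split => //.
    exact: (@subset_closure _ U).
  by move: s01; rewrite in_itv/= => /andP[s0 s1]; exact: H.
have gI : `[0, 1]%classic `&` g @^-1` U = `[0, 1]%classic.
  apply: cI.
  - by exists 0; split; rewrite /= ?in_itv/= ?lexx ?ler01// /g scale0r addr0.
  - by exists (g @^-1` U) => //; apply: open_comp => // x _; exact: cg.
  - exists (g @^-1` (closure U)) => //; apply: closed_comp => [x _|]; first exact: cg.
    exact: closed_closure.
have [_] : (`[0, 1]%classic `&` g @^-1` U) 1 by rewrite gI /= in_itv/= ler01 lexx.
by rewrite /preimage/= /g scale1r addrC subrK.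
Qed.

Lemma ereal_real_lb (a : \bar R) : (0 < a)%E -> exists2 r : R, 0 < r & (r%:E <= a)%E.
Proof.
case: a => [r|_|//]; last by exists 1; rewrite ?leey.
by rewrite lte_fin => r0; exists r.
Qed.

(** The component of [y] contains a point at distance more than [r] by the radius hypothesis, and by
    connectedness the distance to [y] takes every smaller value on it. *)
Lemma component_sphere U : open U -> (0 < component_radius U)%E -> exists2 rho : R, 0 < rho &
  forall y r, U y -> 0 < r -> r < rho -> exists2 y', U y' & `|y - y'| = r.
Proof.
move=> oU /ereal_real_lb[rho rho0 Hrho].
(* The Euclidean norm is at most [n] times the sup norm; n + 1 is used to divide by a visibly
   positive number. *)
exists (rho / (n%:R + 1)); first by rewrite divr_gt0// ltr_wpDl.
move=> y r Uy r0 rrho.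
pose C := connected_component U y.
have Cy : C y by exact: connected_component_refl.
have : (rho%:E <= ereal_sup [set (enorm (y - w))%:E | w in C])%E.
  apply: (le_trans Hrho).
  apply: (@le_trans _ _ (ereal_inf [set ereal_sup [set (enorm (x - w))%:E | w in C] | x in C])).
    by apply: ereal_inf_lbound; exists C => //; exists y.
  by apply: ereal_inf_lbound; exists y.
have rn : (n%:R + 1) * r < rho.
  by move: rrho; rewrite ltr_pdivlMr ?ltr_wpDl// mulrC.
have /lt_le_trans/[apply] : (((n%:R + 1) * r)%:E < rho%:E)%E by rewrite lte_fin.
move=> /ereal_sup_gt[_ [w Cw <-]]; rewrite lte_fin => wr.
have yw : r <= `|y - w|.
  rewrite -(ler_pM2l (_ : 0 < n%:R + 1)) ?ltr_wpDl//.
  apply: le_trans (ltW wr) _; apply: le_trans (enorm_le_norm _) _.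
  by rewrite ler_wpM2r// lerDl.
have cn : continuous (fun w : V => `|y - w|).
  rewrite (_ : (fun w : V => _) = fun w : V => `|w - y|); first exact: continuous_dist.
  by apply/funext => u; rewrite distrC.
have /connected_intervalP iC : connected ((fun w : V => `|y - w|) @` C).
  apply: connected_continuous_connected; first exact: component_connected.
  exact: continuous_subspaceT.
have [|||y' Cy' <-] := iC 0 `|y - w| _ _ r _.
- by exists y => //; rewrite subrr normr0.
- by exists w.
- by rewrite ltW.
by exists y' => //; exact: connected_component_sub Cy'.
Qed.

(** Join [y] to a point [y'] of [U] at sup distance [r]. The curve has a point z with |z - y| = r/2,
    hence |z - y'| >= r/2, and the product of these distances over |y - y'| bounds the distance of z
    to the boundary below by a multiple of [r]. *)
Lemma corkscrew_ball eps (delta : \bar R) U : 0 < eps -> (0 < delta)%E ->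
  eps_delta_domain eps delta U -> (0 < component_radius U)%E ->
  exists c, exists r0, [/\ 0 < c, 0 < r0 & forall y r, U y -> 0 < r -> r < r0 ->
    exists2 z, `|y - z| <= r & forall w, `|z - w| < c * r -> U w].
Proof.
move=> eps0 /ereal_real_lb[d d0 dd] [oU _ _ HU] /(component_sphere oU)[rho rho0 Hrho].
have n1 : (0 : R) < n%:R + 1 by rewrite ltr_wpDl.
(* The 4 comes from the two halves of [r]. One factor n + 1 bounds the Euclidean distance of [y] and
   [y'], the other brings the distance to the boundary back to the sup norm; d / (n + 1) keeps [y]
   and [y'] closer than [delta]. *)
exists (eps / (4 * (n%:R + 1) ^+ 2)), (Num.min rho (d / (n%:R + 1))).
split; first by rewrite divr_gt0// mulr_gt0// exprn_gt0.
  by rewrite lt_min rho0 divr_gt0.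
move=> y r Uy r0; rewrite lt_min => /andP[rrho rd].
have [y' Uy' yy'] := Hrho y r Uy r0 rrho.
have eyy : r <= enorm (y - y') by rewrite -yy' norm_le_enorm.
have eyy' : enorm (y - y') <= (n%:R + 1) * r.
  by apply: le_trans (enorm_le_norm _) _; rewrite yy' ler_wpM2r ?lerDl// ltW.
have [|gamma [cg g0 g1 _ Hg]] := HU y y' Uy Uy'.
  apply: lt_le_trans dd; rewrite lte_fin; apply: le_lt_trans eyy' _.
  by move: rd; rewrite ltr_pdivlMr// mulrC.
have cn := @continuous_dist y.
have cf : {within `[0, 1], continuous (fun t => `|gamma t - y|)}.
  move=> t; apply: (@continuous_comp (subspace _) _ _ gamma (fun w : V => `|w - y|)).
    exact: cg.
  exact: cn.
have r2 : 0 < r / 2 by rewrite divr_gt0.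
have [|t t01 gt] := @IVT R (fun t => `|gamma t - y|) 0 1 (r / 2) ler01 cf.
  rewrite g0 g1 subrr normr0 distrC yy' min_l ?max_r ?(ltW r0)//.
  by rewrite (ltW r2)/= ler_pdivrMr// ler_peMr ?(ltW r0)// ler1n.
have [Ug Hd] := Hg t t01.
exists (gamma t).
  by rewrite distrC gt ler_pdivrMr// ler_peMr ?(ltW r0)// ler1n.
have gy' : r / 2 <= `|gamma t - y'|.
  have := ler_distD (gamma t) y y'; rewrite yy' distrC gt.
  by move: `|_| => a; lra.
have L : eps * r / (4 * (n%:R + 1)) <= eps * enorm (gamma t - y) * enorm (gamma t - y') / enorm (y - y').
  have e0 : 0 < enorm (y - y') by exact: lt_le_trans eyy.
  rewrite ler_pdivlMr//.
  apply: (@le_trans _ _ (eps * r / (4 * (n%:R + 1)) * ((n%:R + 1) * r))).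
    by rewrite ler_wpM2l// divr_ge0 ?mulr_ge0 ?(ltW eps0) ?(ltW r0) ?(ltW n1).
  have -> : eps * r / (4 * (n%:R + 1)) * ((n%:R + 1) * r) = eps * (r / 2) * (r / 2).
    by field; rewrite gt_eqF.
  apply: ler_pM.
  - by rewrite mulr_ge0 ?ltW.
  - exact: ltW.
  - by rewrite ler_wpM2l ?(ltW eps0)// -gt norm_le_enorm.
  - exact: le_trans gy' (norm_le_enorm _).
move=> w gw.
(* A point of the segment in [closure U] but outside [U] would lie on the boundary, nearer to
   [gamma t] than [L] allows. *)
apply: (segment_sub oU Ug) => s s0 s1 cs.
apply: contrapT => nU.
have : ((eps * enorm (gamma t - y) * enorm (gamma t - y') / enorm (y - y'))%:E <=
    (enorm (gamma t - (gamma t + s *: (w - gamma t))))%:E)%E.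
  apply: (le_trans Hd); apply: ereal_inf_lbound.
  exists (gamma t + s *: (w - gamma t)) => //; split => //.
  by move=> /interior_subset.
rewrite lee_fin => /(le_trans L); rewrite opprD addrA subrr add0r.
move=> /le_trans /(_ (enorm_le_norm _)); rewrite normrN normrZ (ger0_norm s0).
rewrite distrC => H.
have : eps * r / (4 * (n%:R + 1)) < eps * r / (4 * (n%:R + 1)).
  apply: (le_lt_trans H).
  apply: (@le_lt_trans _ _ ((n%:R + 1) * `|gamma t - w|)).
    apply: ler_pM => //; first by rewrite mulr_ge0.
      by rewrite lerDl.
    by rewrite ler_piMl.
  rewrite -[ltRHS](_ : (n%:R + 1) * (eps / (4 * (n%:R + 1) ^+ 2) * r) = _).
    by rewrite ltr_pM2l.
  by field; rewrite gt_eqF.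
by rewrite ltxx.
Qed.

(** The centre given by the hypothesis depends on the point, but the ball around it leaves room to
    round the translation to a grid of step ct/2. The grid points in question are finitely many, in
    a number independent of [t]. *)
Lemma corkscrew_grid c r0 U : 0 < c -> (forall y r, U y -> 0 < r -> r < r0 ->
    exists2 z, `|y - z| <= r & forall w, `|z - w| < c * r -> U w) ->
  exists C, exists K, 0 < C /\ corkscrew U C r0 K.
Proof.
move=> c0 H.
(* The coordinates of the translation are at most 2t = (4/c) q, so integers from -M to M, shifted
   into an ordinal, cover them. *)
pose M : nat := (Num.truncn (4 / c)).+1.
have M4 : 4 / c <= M%:R by apply/ltW/truncnS_gt.
pose I := {ffun 'I_n -> 'I_(M + M).+1}.
pose C := c / 2 * M%:R.
exists C, #|{: I}|; split; first by rewrite !mulr_gt0// divr_gt0.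
move=> t t0 tr.
pose q := c / 2 * t; have q0 : 0 < q by rewrite mulr_gt0// divr_gt0.
pose hh (a : I) : V := \row_i (q * ((a i)%:R - M%:R)).
exists [seq hh a | a <- enum {: I}]; split.
- by rewrite size_map -cardE.
- move=> h /mapP[a _ ->]; apply: norm_coord_le.
    by rewrite mulr_ge0 ?mulr_ge0 ?divr_ge0 ?(ltW c0) ?(ltW t0).
  move=> i; rewrite mxE normrM (gtr0_norm q0) [C * t]mulrAC ler_wpM2l ?(ltW q0)//.
  have := ltn_ord (a i); rewrite ltnS => ai.
  have aiR : (a i)%:R <= M%:R + M%:R :> R by rewrite -natrD ler_nat.
  have a0 : 0 <= (a i)%:R :> R by [].
  rewrite ler_norml; move: aiR a0; move: (_%:R : R) (_%:R : R) => u w uw u0.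
  by apply/andP; split; lra.
move=> x [y Uy xy]; have [z yz Hz] := H y t Uy t0 tr.
have zx i : `|(z - x) ord0 i| <= t + t.
  apply: le_trans (norm_coord _ _) _; rewrite distrC -[x - z](subrKA y).
  by apply: le_trans (ler_normD _ _) _; apply: lerD => //; exact: ltW.
pose v i := (z - x) ord0 i / q + M%:R.
have vM i : 0 <= v i <= (M + M)%:R.
  have : `|(z - x) ord0 i / q| <= M%:R.
    rewrite normrM normfV (gtr0_norm q0) ler_pdivrMr//.
    apply: le_trans (zx i) _; apply: le_trans (ler_wpM2r (ltW q0) M4).
    rewrite (_ : 4 / c * q = t + t)// /q; by field; rewrite gt_eqF.
  by rewrite ler_norml natrD /v => /andP[]; move: (_ / q) => u; lra.
have va i : (Num.truncn (v i) < (M + M).+1)%N.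
  by have /andP[v0 vl] := vM i; rewrite ltnS -(ler_nat R); apply: le_trans vl; rewrite truncn_le.
pose a : I := [ffun i => Ordinal (va i)].
exists (hh a); first by apply: map_f; rewrite mem_enum.
(* Truncation moves each coordinate by at most [q], half the radius of the ball around [z]. *)
apply: Hz; apply: (@le_lt_trans _ _ q); last first.
  by rewrite /q mulrAC ltr_pdivrMr// ltr_pMr ?ltr1n// mulr_gt0.
apply: norm_coord_le => [|i]; first exact: ltW.
have /andP[v0 _] := vM i.
have /andP[a1 a2] := truncn_itv v0.
rewrite !mxE ffunE /=.
have -> : z ord0 i - (x ord0 i + q * ((Num.truncn (v i))%:R - M%:R)) = q * (v i - (Num.truncn (v i))%:R).
  by rewrite /v !mxE; field; rewrite gt_eqF.
rewrite normrM (gtr0_norm q0) ler_piMr ?(ltW q0)// ger0_norm ?subr_ge0//.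
by rewrite lerBlDr addrC natr1 ltW.
Qed.

(* Every point of [closure U `\` U] leaves this set by one of finitely many small
   translations, so that the continuity of translations in L^1 bounds its measure. *)
Lemma corkscrew_null U C r0 K : 0 < C -> 0 < r0 -> open U -> corkscrew U C r0 K ->
  {ae mu, forall x, closure U x -> U x}.
Proof.
move=> C0 r00 oU cU.
pose Z := closure U `\` U.
have mZ : measurable Z.
  by apply: measurableD; [exact: measurable_closure|exact: open_measurable_rV].
have Zr r : 0 <= r -> {ae mu, forall x, (\1_(Z `&` cube r) : V -> R) x = 0}.
  move=> rr; set f := (\1_(Z `&` cube r) : V -> R).
  have mZr : measurable (Z `&` cube r) by apply: measurableI => //; exact: measurable_cube.
  have mf : measurable_fun setT f by exact: measurable_indic.
  have Nf : (nrm mu 1 f < +oo)%E.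
    rewrite nrm_indic// poweR_lty//.
    apply: (@le_lt_trans _ _ (mu (cube r))); last by rewrite lebesgue_cubeE// ltry.
    by apply: le_measure; rewrite ?inE//; exact: measurable_cube.
  apply: (nrm_eq0 (m := mu) (p := 1)) => // e e0.
  pose e' := e / (K%:R + 1); have e'0 : 0 < e' by rewrite divr_gt0// ltr_wpDl.
  have [s s0 Hs] := shift_continuous_Lp (lexx 1) mf Nf e'0.
  pose t := Num.min (r0 / 2) (s / C).
  have t0 : 0 < t by rewrite lt_min !divr_gt0.
  have tr : t < r0.
    by rewrite gt_min; apply/orP; left; rewrite ltr_pdivrMr// ltr_pMr// ltr1n.
  have [H [HK Hh HU]] := cU t t0 tr.
  have mD h : measurable_fun setT (fun x => `|f (x + h) - f x|).
    apply: measurableT_comp => //; apply: measurable_funB => //.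
    exact: measurable_shiftf.
  apply: (@le_trans _ _ (nrm mu 1 (\sum_(h <- H) (fun x => `|f (x + h) - f x|))%R)).
    apply: nrm_le => //.
      elim/big_ind : _ => [|g1 g2 m1 m2|h _]; [exact: measurable_cst| |exact: mD].
      exact: measurable_funD.
    move=> x; rewrite fct_sumE; set F := fun h => `|f (x + h) - f x|.
    have sF : 0 <= \sum_(h <- H) F h by apply: sumr_ge0 => h _; exact: normr_ge0.
    rewrite [leRHS]ger0_norm//.
    have [xZ|xZ] := pselect ((Z `&` cube r) x); last first.
      by apply: le_trans sF; rewrite /f indicE memNset// normr0.
    have fx : f x = 1 by rewrite /f indicE mem_set.
    have [h hH Uh] : exists2 h, h \in H & U (x + h).
      apply: HU; have [[xc _] _] := xZ.
      have [y [Uy]] := xc _ (nbhsx_ballx x t t0).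
      by rewrite mx_norm_ball /ball_/= => xy; exists y.
    have fh : f (x + h) = 0.
      by rewrite /f indicE memNset// => -[[_ nU] _].
    rewrite (big_rem h)//= ler_wpDr//; first by apply: sumr_ge0 => i _; exact: normr_ge0.
    by rewrite /F fh fx sub0r normrN.
  apply: (le_trans (nrm_sum mu (lexx 1) H mD)).
  apply: (@le_trans _ _ (\sum_(h <- H) e'%:E)%E).
    rewrite [leLHS]big_seq [leRHS]big_seq; apply: lee_sum => h hH.
    apply: le_trans (Hs h _).
      apply: nrm_le => //; last by move=> x; rewrite normr_id.
      by apply: measurable_funB => //; exact: measurable_shiftf.
    apply: le_trans (Hh h hH) _.
    by rewrite mulrC -ler_pdivlMr// ge_min lexx orbT.
  rewrite sumEFin lee_fin big_const_seq count_predT iter_addr addr0 -mulr_natl /e'.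
  rewrite mulrA ler_pdivrMr ?ltr_wpDl// mulrC ler_wpM2l ?(ltW e0)//.
  by rewrite ler_wpDr// ler_nat.
have /negligible_bigcup : forall k : nat, mu.-negligible
    (~` [set x | (\1_(Z `&` cube k%:R) : V -> R) x = 0]).
  by move=> k; exact: Zr.
apply: negligibleS => x /= /not_implyP[xc xU].
have [k _ xk] : (\bigcup_k cube k%:R : set V) x by rewrite bigcup_cube.
exists k => //= /eqP; rewrite indicE mem_set ?oner_eq0//.
Qed.

End geometry.

(** * Sobolev spaces on open sets and extension by zero *)

Section weak_derivatives_on_open_sets.
Context {R : realType} {n : nat}.
Local Notation V := 'rV[R]_n.
Local Notation mu := (lebesgue_rV R n).
Implicit Types (f g phi psi u v w : V -> R) (x y z : V) (A B S U Omega K : set V) (a : 'I_n -> nat).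

Lemma LpP p Omega u : Lp p Omega u <-> Lpf p (u \_ Omega).
Proof.
rewrite /Lp inE/=; split.
  by move=> /andP[]; rewrite !inE.
by move=> [mf Nf]; apply/andP; split; rewrite inE.
Qed.

Lemma measurable_compact K : compact K -> measurable K.
Proof.
move=> cK; rewrite -(setCK K); apply: measurableC; apply: open_measurable_rV.
by apply: closed_openC; apply: compact_closed => //; exact: norm_hausdorff.
Qed.

Lemma L1locT v : L1loc setT v <-> lint v.
Proof.
split=> -[mv lv]; split => //.
  by move=> r; apply: lv => //; exact: compact_cube.
move=> K cK _; have [r r0 Kr] := bounded_sub_cube cK.
apply: integrableS Kr (lv r) => //; first exact: measurable_cube.
exact: measurable_compact.
Qed.

Lemma lint_L1loc Omega v : open Omega -> lint (v \_ Omega) -> L1loc Omega v.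
Proof.
move=> oO lv; have [mv _] := lv; have mO := open_measurable_rV oO.
split; first by apply/(measurable_restrictT _ mO).
move=> K cK KO; have [_ /(_ K cK) H] := (L1locT (v \_ Omega)).2 lv.
have := H (@subsetT _ _); apply: eq_integrable => //; first exact: measurable_compact.
by move=> x /set_mem /KO xO; rewrite /= patch_rE mem_set.
Qed.

Lemma Rintegral_patch Omega u phi : measurable Omega ->
  \int[mu]_(x in Omega) (u x * phi x) = \int[mu]_x ((u \_ Omega) x * phi x).
Proof.
move=> mO; rewrite Rintegral_mkcond; apply: eq_Rintegral => x _.
by rewrite !patch_rE; case: ifP => // _; rewrite mul0r.
Qed.

Lemma patchTE u : u \_ setT = u.
Proof. by rewrite patch_setT. Qed.

Lemma integrable_L1loc_test Omega v phi : open Omega -> L1loc Omega v ->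
  test_function Omega phi -> mu.-integrable Omega (EFin \o (v * phi)).
Proof.
move=> oO [mv lv] tphi; have mO := open_measurable_rV oO.
have tp := test_function_Ctest tphi.
have [sp [K [cK KO vK]]] := (test_functionP _ _).1 tphi.
have mK := measurable_compact cK.
have mw : measurable_fun setT (v \_ K) by apply/(measurable_restrictT _ mK); exact: measurable_funS mO KO mv.
have Iw : mu.-integrable setT (EFin \o (v \_ K)).
  have := (integrable_mkcond (EFin \o v) mK).1 (lv _ cK KO).
  by apply: eq_integrable => // y _; rewrite /= /patch; case: ifP.
have lw : lint (v \_ K).
  by split => // s; apply: integrableS Iw => //; exact: measurable_cube.
have := integrableS measurableT mO (@subsetT _ _) (integrable_test lw tp).
apply: eq_integrable => // x _ /=; rewrite !fctE.
have [xK|xK] := pselect (K x); first by rewrite patch_rE mem_set.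
by rewrite vK// !mulr0.
Qed.

Lemma is_weak_deriv_unique Omega a u v w : open Omega ->
  is_weak_deriv Omega a u v -> is_weak_deriv Omega a u w ->
  {ae mu, forall x, Omega x -> v x = w x}.
Proof.
move=> oO [lv Hv] [lw Hw]; have mO := open_measurable_rV oO.
have : {ae mu, forall x, Omega x -> (v - w) x = 0}.
  apply: du_bois_reymond => //.
    have [mv Kv] := lv; have [mw Kw] := lw; split; first exact: measurable_funB.
    move=> K cK KO; have := integrableB (measurable_compact cK) (Kv _ cK KO) (Kw _ cK KO).
    by apply: eq_integrable => //; exact: measurable_compact.
  move=> phi tp.
  have : \int[mu]_(x in Omega) (v x * phi x) = \int[mu]_(x in Omega) (w x * phi x).
    have /eqP := Hv phi tp; rewrite Hw// => /eqP E.
    have a0 : (-1) ^+ mi_deg a != 0 :> R by rewrite signr_eq0.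
    by apply: (mulfI a0); rewrite E.
  have Iv := integrable_L1loc_test oO lv tp; have Iw := integrable_L1loc_test oO lw tp.
  move/eqP; rewrite -subr_eq0 -(RintegralB mO Iv Iw) => /eqP H; rewrite -[RHS]H.
  by apply: eq_Rintegral => x _; rewrite !fctE mulrBl.
by apply: filterS => x H xO; apply/eqP; rewrite -subr_eq0; apply/eqP/H.
Qed.

Lemma measurable_restrict_fun Omega u : open Omega -> measurable_fun Omega u ->
  measurable_fun setT (u \_ Omega).
Proof. by move=> oO mu'; apply/(measurable_restrictT _ (open_measurable_rV oO)). Qed.

Lemma ae_eq_patch Omega v w : {ae mu, forall x, Omega x -> v x = w x} ->
  {ae mu, forall x, (v \_ Omega) x = (w \_ Omega) x}.
Proof.
by apply: filterS => x H; rewrite !patch_rE; case: ifPn => [/set_mem/H|].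
Qed.

(** [weak_deriv] is an arbitrary choice, determined only up to a.e. equality on [Omega]; its norms
    are computed through any version at hand. *)
Lemma Lpnorm_weak_deriv p Omega a u v : 1 <= p -> open Omega ->
  is_weak_deriv Omega a u v ->
  Lpnorm p Omega (weak_deriv Omega a u) = nrm mu p (v \_ Omega).
Proof.
move=> p1 oO dv.
have dw : is_weak_deriv Omega a u (weak_deriv Omega a u) by apply: getPex; exists v.
apply: (nrm_ae_eq p1 (m := mu)).
- by apply: measurable_restrict_fun => //; case: dw => -[].
- by apply: measurable_restrict_fun => //; case: dv => -[].
by apply: ae_eq_patch; exact: is_weak_deriv_unique dw dv.
Qed.

Lemma ae_eq_Rintegral_test u v phi : measurable_fun setT u -> measurable_fun setT v ->
  measurable_fun setT phi -> {ae mu, forall x, u x = v x} ->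
  \int[mu]_x (u x * phi x) = \int[mu]_x (v x * phi x).
Proof.
move=> mu' mv mp uv; rewrite /Rintegral; congr fine.
apply: ae_eq_integral => //.
- by apply/measurable_EFinP; exact: measurable_funM.
- by apply/measurable_EFinP; exact: measurable_funM.
by apply: filterS uv => x /= -> _.
Qed.

(** The multi-index counting the letters of a word. [inord] does not truncate for words of length at
    most [k], the only ones considered. *)
Definition mi_of k (s : seq 'I_n) : {ffun 'I_n -> 'I_k.+1} := [ffun i => inord (count_mem i s)].

Lemma count_mi_seq a i : count_mem i (mi_seq a) = a i.
Proof.
rewrite /mi_seq count_flatten -map_comp sumnE big_map big_enum/=.
rewrite (bigD1 i)//= count_nseq /= eqxx mul1n big1 ?addn0// => j ji.
by rewrite count_nseq /= (negbTE ji).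
Qed.

Lemma size_mi_seq a : size (mi_seq a) = mi_deg a.
Proof.
rewrite /mi_seq size_flatten /shape -map_comp sumnE big_map big_enum/=.
by apply: eq_bigr => i _; rewrite size_nseq.
Qed.

Lemma perm_mi_seq a (s : seq 'I_n) : (forall i, a i = count_mem i s) -> perm_eq (mi_seq a) s.
Proof. by move=> H; apply/allP => i _ /=; rewrite count_mi_seq H. Qed.

Lemma mi_ofE k (s : seq 'I_n) i : (size s <= k)%N -> mi (mi_of k s) i = count_mem i s.
Proof.
move=> sk; rewrite /mi ffunE inordK// ltnS.
exact: leq_trans (count_size _ _) sk.
Qed.

Lemma perm_mi_of k (s : seq 'I_n) : (size s <= k)%N -> perm_eq (mi_seq (mi (mi_of k s))) s.
Proof. by move=> sk; apply: perm_mi_seq => i; exact: mi_ofE. Qed.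

Lemma mi_deg_of k (s : seq 'I_n) : (size s <= k)%N -> mi_deg (mi (mi_of k s)) = size s.
Proof. by move=> sk; rewrite -size_mi_seq; apply: perm_size; exact: perm_mi_of. Qed.

End weak_derivatives_on_open_sets.

(** * Extension by zero: weak derivatives on the domain and on the whole space *)

Section zero_extension.
Context {R : realType} {n : nat}.
Local Notation V := 'rV[R]_n.
Local Notation mu := (lebesgue_rV R n).
Implicit Types (f g phi psi u v w : V -> R) (x y z : V) (U K : set V) (s : seq 'I_n).
Variables (k : nat) (p : R) (Omega : set V).
Hypotheses (p_gt1 : 1 < p) (oO : open Omega).
Let p1 : 1 <= p. Proof. exact: ltW. Qed.
Let mO : measurable Omega. Proof. exact: open_measurable_rV. Qed.
Local Notation N := (nrm mu p).
Local Notation Lpf := (Lpf p).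
Local Notation index := {ffun 'I_n -> 'I_k.+1}.
Implicit Types (a : index) (G H : index -> V -> R).

Definition weak_rep f s g := forall psi, Ctest psi ->
  \int[mu]_x (f x * partials s psi x) = (- 1) ^+ size s * \int[mu]_x (g x * psi x).

(* [G a] is the weak derivative of order [a] on the whole space of the extension
   of [u] by zero. *)
Definition trep u G := Lpf (u \_ Omega) /\
  forall a, (mi_deg (mi a) <= k)%N -> [/\ Lpf (G a), vanish_off Omega (G a) &
    weak_rep (u \_ Omega) (mi_seq (mi a)) (G a)].

Lemma patch_vanish f : vanish_off Omega f -> f \_ Omega = f.
Proof.
move=> vf; apply/funext => x; rewrite patch_rE; case: ifPn => // /negP xO.
by rewrite vf// => xx; apply: xO; exact: mem_set.
Qed.

Lemma patch_vanish_off f : vanish_off Omega (f \_ Omega).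
Proof. by move=> x xO; rewrite patch_rE memNset. Qed.

Lemma Lpf_patch f : Lpf f -> Lpf (f \_ Omega).
Proof.
move=> [mf Nf]; split; first exact: measurable_patch.
by apply: le_lt_trans Nf; exact: nrm_patch.
Qed.

Lemma weak_rep_deriv u a g : lint (g \_ Omega) ->
  weak_rep (u \_ Omega) (mi_seq (mi a)) (g \_ Omega) -> is_weak_deriv Omega (mi a) u g.
Proof.
move=> lg H; split; first exact: lint_L1loc.
move=> phi tp; rewrite (Rintegral_patch u _ mO) (Rintegral_patch g _ mO) -size_mi_seq; apply: H.
exact: test_function_Ctest tp.
Qed.

Lemma weak_rep_derivT f a g : lint g -> weak_rep f (mi_seq (mi a)) g ->
  is_weak_deriv setT (mi a) f g.
Proof.
move=> lg H; split; first exact/L1locT.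
by move=> phi /test_functionT tp; rewrite -size_mi_seq; exact: H.
Qed.

Lemma trep_sobolev u G : trep u G -> sobolev_tilde k p Omega u.
Proof.
move=> [Lu HG]; split; split.
- by apply: lint_L1loc => //; exact: Lpf_lint Lu.
- move=> a ak; have [La va wa] := HG a ak.
  have E := patch_vanish va.
  exists (G a); last by apply/LpP; rewrite E.
  by apply: weak_rep_deriv; rewrite E//; exact: Lpf_lint La.
- by apply/L1locT; exact: Lpf_lint Lu.
move=> a ak; have [La va wa] := HG a ak.
exists (G a); last by apply/LpP; rewrite patchTE.
by apply: weak_rep_derivT => //; exact: Lpf_lint La.
Qed.

(** Since [G a] vanishes off [Omega], it is a version of the weak derivative both on [Omega] and on
    the whole space, with the same norm. This is the reason for the isometry. *)
Lemma trep_norm u G : trep u G ->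
  sobolev_norm k p Omega u = (\sum_(a : index | (mi_deg (mi a) <= k)%N) N (G a))%E /\
  sobolev_norm k p setT (u \_ Omega) = (\sum_(a : index | (mi_deg (mi a) <= k)%N) N (G a))%E.
Proof.
move=> [Lu HG]; split; apply: eq_bigr => a ak; have [La va wa] := HG a ak.
  have E := patch_vanish va.
  rewrite (@Lpnorm_weak_deriv _ _ _ _ _ _ (G a)) ?E//.
  by apply: weak_rep_deriv; rewrite E//; exact: Lpf_lint La.
rewrite (@Lpnorm_weak_deriv _ _ _ _ _ _ (G a)) ?patchTE//; first exact: openT.
by apply: weak_rep_derivT => //; exact: Lpf_lint La.
Qed.

Lemma trep_lin (c : R) u v G H : trep u G -> trep v H ->
  trep (c *: u + v) (fun a => c *: G a + H a).
Proof.
move=> [Lu HG] [Lv HH].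
have E : (c *: u + v) \_ Omega = c *: (u \_ Omega) + v \_ Omega by rewrite patchD patchZ.
split; first by rewrite E; apply: (LpfD p1) => //; exact: (LpfZ p1).
move=> a ak; have [La va wa] := HG a ak; have [La' va' wa'] := HH a ak; split.
- by apply: (LpfD p1) => //; exact: (LpfZ p1).
- by move=> x xO; change (c * G a x + H a x = 0); rewrite va// va'// mulr0 addr0.
move=> psi tpsi; have tps := Ctest_partials (mi_seq (mi a)) tpsi.
have l f : Lpf f -> lint f by exact: Lpf_lint.
have lZ f : Lpf f -> lint (c *: f) by move=> Lf; apply: l; exact: (LpfZ p1).
rewrite E !Rintegral_test_D//; try by [exact: l|exact: lZ].
rewrite !Rintegral_test_Z//; try exact: l.
by rewrite wa// wa'//; ring.
Qed.

Lemma mi_seq0 : mi_seq (mi (mi_of k [::])) = [::] :> seq 'I_n.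
Proof. by apply/perm_nilP; exact: perm_mi_of. Qed.

Lemma mi_deg0 : mi_deg (mi (mi_of k ([::] : seq 'I_n))) = 0%N.
Proof. by rewrite mi_deg_of. Qed.

Lemma is_weak_deriv0 (U : set V) u : L1loc U u -> is_weak_deriv U (mi (mi_of k [::])) u u.
Proof. by move=> lu; split => // phi tp; rewrite mi_deg0 expr0 mul1r mi_seq0. Qed.

(** Membership provides a derivative of order 0 in L^p, which is a.e. the function itself by
    uniqueness. *)
Lemma Lpf_sobolev (U : set V) u : open U -> sobolev k p U u -> Lpf (u \_ U).
Proof.
move=> oU [lu H].
have [|v dv /LpP[mv Nv]] := H (mi_of k [::]); first by rewrite mi_deg0.
have mu' : measurable_fun setT (u \_ U) by apply: measurable_restrict_fun => //; case: lu.
split => //; rewrite (nrm_ae_eq p1 mu' mv)//; apply: ae_eq_patch.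
exact: is_weak_deriv_unique (is_weak_deriv0 lu) dv.
Qed.

Lemma weak_deriv_vanish (U : set V) a f g : open U -> (forall x, U x -> f x = 0) ->
  is_weak_deriv setT (mi a) f g -> {ae mu, forall x, U x -> g x = 0}.
Proof.
move=> oU f0 [lg Hg]; have mU := open_measurable_rV oU.
apply: du_bois_reymond => //.
  have [mg Kg] := lg; split; first exact: measurable_funS mg.
  by move=> K cK _; exact: Kg.
move=> phi tp; have [sp [K [cK KU vK]]] := (test_functionP _ _).1 tp.
have tp' := test_function_Ctest tp.
have := Hg phi ((test_functionT _).2 tp').
have -> : \int[mu]_x (f x * partials (mi_seq (mi a)) phi x) = 0.
  rewrite (_ : (fun x => _) = cst 0) ?Rintegral_cst ?mul0r//.
  apply/funext => x /=; have [xK|xK] := pselect (K x); first by rewrite f0 ?mul0r//; exact: KU.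
  rewrite (vanish_off_partials _ _ vK) ?mulr0//.
  by apply: compact_closed => //; exact: norm_hausdorff.
move/esym/eqP; rewrite mulf_eq0 signr_eq0 /= => /eqP E.
rewrite (Rintegral_patch g _ mU) -[RHS]E; apply: eq_Rintegral => x _.
rewrite patch_rE; case: ifPn => // /negP xU; rewrite vK ?mulr0// => /KU xx.
by apply: xU; exact: mem_set.
Qed.

Section null_boundary.
Hypothesis ae_ext : {ae mu, forall x, ~ Omega x -> (~` Omega)° x}.

(** The weak derivatives of the extension vanish a.e. on the exterior of [Omega], hence a.e. off
    [Omega] since the boundary is null: cutting them to [Omega] changes no integral. *)
Lemma sobolev_trep u : sobolev k p setT (u \_ Omega) -> exists G, trep u G.
Proof.
move=> su; have Lu := Lpf_sobolev openT su; rewrite patchTE in Lu.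
have [_ H] := su.
have /choice[v Hv] : forall a, exists v, (mi_deg (mi a) <= k)%N ->
    is_weak_deriv setT (mi a) (u \_ Omega) v /\ Lpf v.
  move=> a; have [ak|ak] := boolP (mi_deg (mi a) <= k)%N; last by exists 0.
  by have [v dv /LpP] := H a ak; rewrite patchTE => Lv; exists v.
exists (fun a => v a \_ Omega); split => // a ak; have [dv Lv] := Hv a ak.
have LvO := Lpf_patch Lv; have [mvO _] := LvO; have [mv _] := Lv.
split => //; first exact: patch_vanish_off.
move=> psi tp; have [lv Hpsi] := dv.
rewrite Hpsi; last exact/test_functionT.
rewrite size_mi_seq; congr (_ * _); apply: ae_eq_Rintegral_test => //.
  by apply: Csmooth_measurable; exact: tp.1.
have : {ae mu, forall x, (~` Omega)° x -> v a x = 0}.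
  apply: weak_deriv_vanish dv; first exact: open_interior.
  by move=> x /interior_subset xO; rewrite patch_rE memNset.
move: ae_ext; apply: filterS2 => x H1 H2; rewrite patch_rE.
by case: ifPn => // /negP xO; apply/H2/H1 => xx; apply: xO; exact: mem_set.
Qed.

Lemma sobolev_tildeP u : sobolev_tilde k p Omega u <-> exists G, trep u G.
Proof.
split; first by move=> [_]; exact: sobolev_trep.
by move=> [G]; exact: trep_sobolev.
Qed.

(** A function [v] with support in [closure Omega] vanishes a.e. outside it, and what remains
    outside [Omega] is null, so that [v] is a.e. the extension by zero of its restriction. *)
Lemma sobolev_tilde_support : (~` Omega)° = ~` closure Omega -> sobolev_tilde k p Omega =
  [set u : V -> R | exists v, [/\ sobolev k p setT v, ess_support v `<=` closure Omega &
                               {in Omega, u =1 v}]].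
Proof.
move=> UE; apply/seteqP; split => u /=.
  move=> [_ su]; exists (u \_ Omega); split => //.
    apply: subsetCl => x xO; exists (~` closure Omega) => //; split.
      by apply: closed_openC; exact: closed_closure.
    by apply: aeW => y yO; rewrite patch_rE memNset// => /(@subset_closure V).
  by move=> x xO; rewrite patch_rE xO.
move=> [v [sv supp uv]].
have uE : u \_ Omega = v \_ Omega.
  by apply/funext => x; rewrite !patch_rE; case: ifPn => // /uv.
have v0 : {ae mu, forall x, ~ closure Omega x -> v x = 0}.
  (* The complement of the support is a union of open sets that need not be countable, hence the
     recourse to [ae_local]. *)
  have : {ae mu, forall x, (~` ess_support v) x -> v x = 0}.
    rewrite /ess_support setCK; apply: ae_local => x [U [oU vU] Ux].
    have /nbhs_ballP[r /= r0 Hr] : nbhs x U by exact: open_nbhs_nbhs.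
    exists r => //; move: vU; apply: filterS => y H yx; apply: H; apply: Hr.
    by rewrite mx_norm_ball /ball_/= distrC.
  by apply: filterS => x H xO; apply: H => /supp.
have Lv := Lpf_sobolev openT sv; rewrite patchTE in Lv.
have LvO := Lpf_patch Lv; have [mvO _] := LvO; have [mv _] := Lv.
have vE : {ae mu, forall x, v x = (v \_ Omega) x}.
  move: ae_ext v0; apply: filterS2 => x H1 H2; rewrite patch_rE; case: ifPn => // /negP xO.
  apply: H2; have : (~` Omega)° x by apply: H1 => xx; apply: xO; exact: mem_set.
  by rewrite UE.
apply/sobolev_tildeP; apply: sobolev_trep; rewrite uE.
have [_ Hv] := sv; split; first by apply/L1locT; exact: Lpf_lint LvO.
move=> a ak; have [w [lw dw] Lw] := Hv a ak; exists w => //; split => // phi tp.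
rewrite -dw//; apply: ae_eq_Rintegral_test => //.
  apply: Csmooth_measurable; apply: smooth_partials.
  by case: (test_function_Ctest tp).
by move: vE; apply: filterS => x ->.
Qed.

End null_boundary.

(** Both sides of the identity are pairings with fixed test functions, hence continuous for the L^p
    norm by [test_small]. *)
Lemma weak_rep_lim f g s : Lpf f -> Lpf g ->
  (forall d : R, 0 < d -> exists f', exists g', [/\ Lpf f', Lpf g',
     (N (f - f')%R <= d%:E)%E, (N (g - g')%R <= d%:E)%E & weak_rep f' s g']) ->
  weak_rep f s g.
Proof.
move=> Lf Lg H psi tpsi.
have tps := Ctest_partials s tpsi.
apply/eqP; rewrite -subr_eq0 -normr_le0; apply/ler_addgt0Pr => d d0; rewrite add0r.
have d2 : 0 < d / 2 by rewrite divr_gt0.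
have [r1 r10 H1] := test_small p_gt1 tps d2.
have [r2 r20 H2] := test_small p_gt1 tpsi d2.
have r0 : 0 < Num.min r1 r2 by rewrite lt_min r10.
have [f' [g' [Lf' Lg' Nf Ng wf]]] := H _ r0.
have sub (h h' : V -> R) : Lpf h -> Lpf h' -> Lpf (h - h').
  by move=> Lh Lh'; rewrite -scaleN1r; apply: (LpfD p1) => //; exact: (LpfZ p1).
have [mff _] := sub _ _ Lf Lf'; have [mgg _] := sub _ _ Lg Lg'.
have Hf := H1 (f - f') mff (le_trans Nf _); have Hg := H2 (g - g') mgg (le_trans Ng _).
have dec (h h' : V -> R) phi : Lpf h -> Lpf h' -> Ctest phi ->
    \int[mu]_x ((h - h') x * phi x) = \int[mu]_x (h x * phi x) - \int[mu]_x (h' x * phi x).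
  move=> Lh Lh' tp; rewrite -scaleN1r Rintegral_test_D//.
  - by rewrite Rintegral_test_Z ?mulN1r//; exact: Lpf_lint Lh'.
  - exact: Lpf_lint Lh.
  - by apply: (Lpf_lint p1); exact: (LpfZ p1).
have -> : \int[mu]_x (f x * partials s psi x) - (-1) ^+ size s * \int[mu]_x (g x * psi x) =
  \int[mu]_x ((f - f') x * partials s psi x) - (-1) ^+ size s * \int[mu]_x ((g - g') x * psi x).
  by rewrite !dec// wf//; ring.
apply: le_trans (ler_normB _ _) _; rewrite normrM normrX normrN1 expr1n mul1r.
rewrite (splitr d); apply: lerD; [apply: Hf|apply: Hg].
  by rewrite lee_fin ge_min lexx.
by rewrite lee_fin ge_min lexx orbT.
Qed.

End zero_extension.

(** * The two inclusions between the spaces *)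

Section density.
Context {R : realType} {n : nat}.
Local Notation V := 'rV[R]_n.
Local Notation mu := (lebesgue_rV R n).
Implicit Types (f g phi psi u v w : V -> R) (x y z : V) (U K : set V) (s : seq 'I_n).
Variables (k : nat) (p : R) (Omega : set V).
Hypotheses (p_gt1 : 1 < p) (oO : open Omega).
Let p1 : 1 <= p. Proof. exact: ltW. Qed.
Let mO : measurable Omega. Proof. exact: open_measurable_rV. Qed.
Local Notation N := (nrm mu p).
Local Notation Lpf := (Lpf p).
Local Notation index := {ffun 'I_n -> 'I_k.+1}.
Implicit Types (a : index) (G H : index -> V -> R).
Local Notation trep := (@trep R n k p Omega).

Lemma test_function_partials s psi : test_function Omega psi ->
  test_function Omega (partials s psi).
Proof.
move=> /test_functionP[sp [K [cK KO vK]]]; apply/test_functionP; split.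
  exact: smooth_partials.
exists K; split => //; apply: vanish_off_partials => //.
by apply: compact_closed => //; exact: norm_hausdorff.
Qed.

Lemma test_vanish_off phi : test_function Omega phi -> vanish_off Omega phi.
Proof. by move=> /test_functionP[_ [K [_ KO vK]]] x xO; apply: vK => /KO. Qed.

Lemma weak_rep_smooth s phi : Csmooth phi -> weak_rep phi s (partials s phi).
Proof.
elim: s phi => [|i s ih] phi sp psi tpsi /=; first by rewrite expr0 mul1r.
rewrite (weak_partial_smooth i sp (Ctest_partials s tpsi)).
rewrite (ih _ (smooth_partial i sp) psi tpsi) exprS mulN1r mulNr; congr (- (_ * _)).
have pe : perm_eq (rcons s i) (i :: s) by rewrite perm_rcons.
by rewrite -partials_rcons (partials_perm pe sp).
Qed.

Lemma L1locB u v : L1loc Omega u -> L1loc Omega v -> L1loc Omega (u - v).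
Proof.
move=> [mv Kv] [mw Kw]; split; first exact: measurable_funB.
move=> K cK KO; have := integrableB (measurable_compact cK) (Kv _ cK KO) (Kw _ cK KO).
by apply: eq_integrable => //; exact: measurable_compact.
Qed.

Lemma L1loc_smooth phi : Csmooth phi -> L1loc Omega phi.
Proof.
move=> sp; have [mp lp] := (L1locT phi).2 (Csmooth_lint sp).
by split; [exact: measurable_funS mp|move=> K cK _; exact: lp].
Qed.

Lemma is_weak_deriv_sub_test a u v phi : L1loc Omega u -> test_function Omega phi ->
  is_weak_deriv Omega (mi a) u v ->
  is_weak_deriv Omega (mi a) (u - phi) (v - partials (mi_seq (mi a)) phi).
Proof.
move=> lu tphi [lv Hv]; have [sphi _] := test_function_Ctest tphi.
have sps := smooth_partials (mi_seq (mi a)) sphi.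
split; first by apply: L1locB => //; exact: L1loc_smooth.
move=> psi tpsi; have tps := test_function_partials (mi_seq (mi a)) tpsi.
have I f g chi : L1loc Omega f -> L1loc Omega g -> test_function Omega chi ->
    \int[mu]_(x in Omega) ((f - g) x * chi x) =
    \int[mu]_(x in Omega) (f x * chi x) - \int[mu]_(x in Omega) (g x * chi x).
  move=> lf lg tc.
  rewrite -(RintegralB mO (integrable_L1loc_test oO lf tc) (integrable_L1loc_test oO lg tc)).
  by apply: eq_Rintegral => x _; rewrite !fctE mulrBl.
rewrite (I _ _ _ lu (L1loc_smooth sphi) tps) (I _ _ _ lv (L1loc_smooth sps) tpsi) Hv//.
rewrite mulrBr; congr (_ - _).
rewrite (Rintegral_patch phi _ mO) (Rintegral_patch (partials _ phi) _ mO).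
rewrite !patch_vanish; try exact: test_vanish_off (test_function_partials _ tphi).
  by rewrite -size_mi_seq; apply: weak_rep_smooth => //; exact: test_function_Ctest tpsi.
exact: test_vanish_off.
Qed.

Lemma sobolev_norm_ge a u : (mi_deg (mi a) <= k)%N ->
  (Lpnorm p Omega (weak_deriv Omega (mi a) u) <= sobolev_norm k p Omega u)%E.
Proof.
move=> ak; rewrite /sobolev_norm (bigD1 a)//= leeDl// sume_ge0// => b _.
exact: Lnorm_ge0.
Qed.

Lemma patchB_test u phi : test_function Omega phi -> (u - phi) \_ Omega = u \_ Omega - phi.
Proof.
by move=> tphi; rewrite -scaleN1r patchD patchZ (patch_vanish (test_vanish_off tphi)) scaleN1r.
Qed.

(** For a test function of [Omega] the classical derivatives are weak derivatives on the whole space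
    and vanish off [Omega]. Convergence in the Sobolev norm of [Omega] carries this identity over to
    [u] and its derivatives extended by zero. *)
Lemma sobolev_circ_trep u : sobolev_circ k p Omega u -> exists G, trep u G.
Proof.
move=> [su H]; have Lu := Lpf_sobolev p_gt1 oO su; have [lu Hu] := su.
have /choice[v Hv] : forall a, exists v, (mi_deg (mi a) <= k)%N ->
    is_weak_deriv Omega (mi a) u v /\ Lpf (v \_ Omega).
  move=> a; have [ak|ak] := boolP (mi_deg (mi a) <= k)%N; last by exists 0.
  by have [v dv /LpP Lv] := Hu a ak; exists v.
exists (fun a => v a \_ Omega); split => // a ak; have [dv Lv] := Hv a ak.
split => //; first exact: patch_vanish_off.
apply: (weak_rep_lim p_gt1 Lu Lv) => d d0; have [phi tphi Hphi] := H d d0.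
have tp := test_function_Ctest tphi; have [sp _] := tp.
have tps := test_function_partials (mi_seq (mi a)) tphi.
exists phi, (partials (mi_seq (mi a)) phi); split.
- exact: Ctest_Lpf.
- by apply: Ctest_Lpf => //; exact: test_function_Ctest tps.
- apply/ltW/(le_lt_trans _ Hphi); rewrite -patchB_test//.
  have l0 := L1locB lu (L1loc_smooth sp).
  rewrite -(Lpnorm_weak_deriv p1 oO (is_weak_deriv0 k l0)).
  by apply: sobolev_norm_ge; rewrite mi_deg0.
- apply/ltW/(le_lt_trans _ Hphi); rewrite -patchB_test//.
  rewrite -(Lpnorm_weak_deriv p1 oO (is_weak_deriv_sub_test lu tphi dv)).
  exact: sobolev_norm_ge.
exact: weak_rep_smooth.
Qed.

(** The derivative along a word is the one of its multi-index, except that the empty word gets the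
    extension itself, of which [G] gives only a version. Consecutive orders are related by testing
    order [size s] against [partial i psi] and cancelling the sign. *)
Lemma trep_fam u G : trep u G ->
  fam p k (fun s => if s is [::] then u \_ Omega else G (mi_of k s)).
Proof.
move=> [Lu HG]; set F := fun s => _.
have HF s : (size s <= k)%N -> weak_rep (u \_ Omega) s (F s).
  case: s => [|i s] sk psi tpsi; first by rewrite /= expr0 mul1r.
  have [|_ _ /(_ psi tpsi)] := HG (mi_of k (i :: s)); first by rewrite mi_deg_of.
  rewrite (partials_perm (perm_mi_of sk) tpsi.1).
  by rewrite (perm_size (perm_mi_of sk)).
split.
  by case=> [|i s] sk //; have [] := HG (mi_of k (i :: s)); rewrite ?mi_deg_of.
move=> i s sk psi tpsi.
have H1 := HF s (ltnW sk) _ (Ctest_partial i tpsi).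
have H2 := HF (i :: s) sk psi tpsi.
have pe : perm_eq (rcons s i) (i :: s) by rewrite perm_rcons.
move: H1; rewrite -partials_rcons (partials_perm pe tpsi.1) H2 /= exprS.
rewrite mulN1r mulNr -mulrN => E.
have s0 : (-1) ^+ size s != 0 :> R by rewrite signr_eq0.
by apply: (mulfI s0); rewrite E.
Qed.

(** The approximating function vanishes on a neighbourhood of the closure of [U], which contains the
    complement of [Omega]; its support is thus compact in [Omega]. The errors on the whole space
    bound those on [Omega]. *)
Lemma trep_circ U (c t0 : R) (m : nat) u G : 0 < c -> 0 < t0 -> open U -> corkscrew U c t0 m ->
  ~` Omega `<=` closure U -> (forall x, closure U x -> ~ Omega x) ->
  trep u G -> sobolev_circ k p Omega u.
Proof.
move=> c0 t00 oU cU OU UO tu; have [su _] := trep_sobolev p_gt1 oO tu; split => // e e0.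
have fG := trep_fam tu; have [Lu HG] := tu.
(* The Sobolev norm has at most one term for each element of [index]; one more in the divisor gives
   the strict inequality. *)
pose q : R := #|{: index}|%:R + 1; have q0 : 0 < q by rewrite ltr_wpDl.
have [|phi [t [tphi t0' vphi sphi]]] := test_approximation p1 c0 t00 oU cU fG _ (divr_gt0 e0 q0).
  move=> s sk; set F := (X in nrm _ _ (X \_ _)).
  rewrite (_ : _ \_ _ = 0) ?nrm0//; apply/funext => x; rewrite patch_rE.
  case: ifPn => // /set_mem /UO xO; rewrite /F; case: s sk {F} => [|i s] sk.
    by rewrite patch_rE memNset.
  by have [|_ + _] := HG (mi_of k (i :: s)); [rewrite mi_deg_of|apply].
have tp : test_function Omega phi.
  have [sp [r Hr]] := tphi; apply/test_functionP; split => //.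
  exists (cube r `&` ~` nbd U t); split.
  - apply: (@subclosed_compact _ _ (cube r)); last by move=> x [].
      by apply: closedI; [exact: closed_cube|apply: open_closedC; exact: open_nbd].
    exact: compact_cube.
  - move=> x [_ xU]; apply: contrapT => /OU xc; apply: xU.
    have [y [Uy]] := xc _ (nbhsx_ballx x t t0').
    by rewrite mx_norm_ball /ball_/= => xy; exists y.
  move=> x xK; have [xU|xU] := pselect (nbd U t x); first exact: vphi.
  by apply: Hr => xr; apply: xK.
exists phi => //.
have bound a : (mi_deg (mi a) <= k)%N ->
    (Lpnorm p Omega (weak_deriv Omega (mi a) (u - phi)%R) <= (e / q)%:E)%E.
  move=> ak; have [|g [Lg Ng Hg]] := small_weak (s := mi_seq (mi a)) _ sphi.
    by rewrite size_mi_seq.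
  have LgO := Lpf_patch p_gt1 oO Lg.
  rewrite (@Lpnorm_weak_deriv _ _ _ _ _ _ g p1 oO).
    by apply: le_trans Ng; have [mg _] := Lg; exact: nrm_patch.
  split; first by apply: lint_L1loc => //; exact: Lpf_lint LgO.
  move=> psi tpsi; rewrite (Rintegral_patch _ _ mO) patchB_test//.
  rewrite Hg; last exact: test_function_Ctest tpsi.
  rewrite size_mi_seq; congr (_ * _); rewrite (Rintegral_patch _ _ mO).
  apply: eq_Rintegral => x _; rewrite patch_rE; case: ifPn => // /negP xO.
  rewrite (test_vanish_off tpsi) ?mulr0// => xx; apply: xO; exact: mem_set.
apply: (@le_lt_trans _ _ (\sum_(a : index) (e / q)%:E)%E).
  rewrite /sobolev_norm big_mkcond/=; apply: lee_sum => a _.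
  by case: ifPn => [/bound//|_]; rewrite lee_fin divr_ge0 ?ltW.
rewrite sumEFin sumr_const lte_fin -mulr_natl /q mulrA ltr_pdivrMr// mulrC.
by rewrite ltr_pM2l// cardT -cardE ltrDl.
Qed.

End density.

(** * Completeness *)

Section Lp_complete.
Context d (T : measurableType d) (R : realType).
Variables (m : {measure set T -> \bar R}) (p : R).
Hypothesis p1 : 1 <= p.
Let p0 : 0 < p. Proof. exact: lt_le_trans p1. Qed.
Implicit Types (f g : T -> R) (u w : nat -> T -> R).
Local Notation N := (nrm m p).

Lemma powR_cvg (w : nat -> R) (l : R) : w j @[j --> \oo] --> l -> 0 < l ->
  (w j) `^ p @[j --> \oo] --> l `^ p.
Proof.
move=> wl l0.
have E y : 0 < y -> y `^ p = expR (p * ln y) by move=> y0; rewrite /powR gt_eqF.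
have H : expR (p * ln (w j)) @[j --> \oo] --> l `^ p.
  rewrite E//; apply: (continuous_cvg _ (@continuous_expR R _)).
  apply: cvgMr; apply: (continuous_cvg _ (@continuous_ln R _ l0)); exact: wl.
apply: cvg_trans H; apply: near_eq_cvg.
have /cvgrPdist_lt /(_ _ l0) := wl; apply: filterS => j.
by rewrite ltr_distl => /andP[_ lw]; rewrite E//; lra.
Qed.

Lemma limn_einf_le (v : nat -> \bar R) (c : \bar R) :
  (exists J, forall j, (J <= j)%N -> (v j <= c)%E) -> (limn_einf v <= c)%E.
Proof.
move=> [J HJ]; rewrite limn_einf_lim; apply: lime_le; first exact: is_cvg_einfs.
near=> k; apply: (@le_trans _ _ (v (maxn J k))).
  by apply: ereal_inf_lbound; exists (maxn J k) => //=; exact: leq_maxr.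
by apply: HJ; exact: leq_maxl.
Unshelve. all: by end_near.
Qed.

Lemma limn_einf_ge (v : nat -> \bar R) (c : \bar R) :
  (exists J, forall j, (J <= j)%N -> (c <= v j)%E) -> (c <= limn_einf v)%E.
Proof.
move=> [J HJ]; rewrite limn_einf_lim; apply: lime_ge; first exact: is_cvg_einfs.
near=> k; apply: le_ereal_inf_tmp => _ [j /= kj <-]; apply: HJ.
by apply: leq_trans kj; near: k; exact: nbhs_infty_ge.
Unshelve. all: by end_near.
Qed.

Lemma measurable_limn_einf (F : nat -> T -> \bar R) : (forall j, measurable_fun setT (F j)) ->
  measurable_fun setT (fun x => limn_einf (F^~ x)).
Proof.
move=> mF; apply: (@measurableT_comp _ _ _ _ _ _ (@oppe R)) => //.
by apply: measurable_fun_limn_esup => j; exact: measurableT_comp.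
Qed.

(** Lower semicontinuity of the norm under a.e. convergence, by Fatou's lemma for p-th powers. *)
Lemma nrm_fatou w g (c : R) : (forall j, measurable_fun setT (w j)) -> measurable_fun setT g ->
  0 <= c -> (exists J, forall j, (J <= j)%N -> (N (w j) <= c%:E)%E) ->
  {ae m, forall x, w j x @[j --> \oo] --> g x} -> (N g <= c%:E)%E.
Proof.
move=> mw mg c0 [J HJ] wg; rewrite nrm_le_pow//.
pose F j x := (`|w j x| `^ p)%:E.
have mF j : measurable_fun setT (F j) by exact: measurable_abs_powR.
have F0 j x : setT x -> (0 <= F j x)%E by rewrite lee_fin powR_ge0.
apply: (@le_trans _ _ (\int[m]_x limn_einf (F^~ x))%E).
  apply: ae_ge0_le_integral => //.
  - exact: measurable_abs_powR.
  - by move=> x _; apply: limn_einf_ge; exists 0%N => j _; exact: F0.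
  - exact: measurable_limn_einf.
  move: wg; apply: filterS => x wx _; have [->|gx] := eqVneq (g x) 0.
    rewrite normr0 powR0 ?gt_eqF//.
    by apply: limn_einf_ge; exists 0%N => j _; exact: F0.
  rewrite le_eqVlt; apply/orP; left; apply/eqP; apply/esym.
  have H : F j x @[j --> \oo] --> (`|g x| `^ p)%:E.
    apply: cvg_EFin; first exact: nearW.
    by apply: powR_cvg; [exact: cvg_norm|rewrite normr_gt0].
  by have [] := cvg_limn_einf_sup H.
apply: (le_trans (fatou m measurableT mF F0)); apply: limn_einf_le.
by exists J => j /HJ; rewrite nrm_le_pow.
Qed.

Lemma Lp_complete u : (forall k, measurable_fun setT (u k)) -> (forall k, (N (u k) < +oo)%E) ->
  (forall e : R, 0 < e -> exists K, forall k l, (K <= k)%N -> (K <= l)%N ->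
    (N (u k - u l)%R <= e%:E)%E) ->
  exists g, [/\ measurable_fun setT g, (N g < +oo)%E & forall e : R, 0 < e ->
    exists K, forall k, (K <= k)%N -> (N (u k - g)%R <= e%:E)%E].
Proof.
move=> mu Nu cu.
have h0 (j : nat) : (0 : R) < 2^-1 ^+ j.+1 by rewrite exprn_gt0.
have /choice[K HK] := fun j => cu _ (h0 j).
pose M j := (\sum_(i < j.+1) K i + j)%N.
have MK j : (K j <= M j)%N by rewrite /M big_ord_recr/= -addnA addnCA leq_addr.
have MS j : (M j <= M j.+1)%N.
  by rewrite /M [in leqRHS]big_ord_recr/= leq_add// leq_addr.
have Mj j : (j <= M j)%N by rewrite /M leq_addl.
pose w j := u (M j).
have mw j : measurable_fun setT (w j) by exact: mu.
pose S J x := \sum_(0 <= j < J) `|w j.+1 x - w j x|.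
have mD j : measurable_fun setT (fun x => `|w j.+1 x - w j x|).
  by apply: measurableT_comp => //; exact: measurable_funB.
have S0 : S 0 = 0 by apply/funext => x; rewrite /S big_geq.
have SS J : S J.+1 = S J + (fun x => `|w J.+1 x - w J x|).
  by apply/funext => x; rewrite /S big_nat_recr.
have mS J : measurable_fun setT (S J).
  elim: J => [|J ih]; first by rewrite S0; exact: measurable_cst.
  by rewrite SS; exact: measurable_funD.
have NS J : (N (S J) <= (1 - 2^-1 ^+ J)%:E)%E.
  elim: J => [|J ih]; first by rewrite S0 nrm0// expr0 subrr.
  rewrite SS; apply: (le_trans (nrmD m p1 (mS J) (mD J))).
  have -> : 1 - 2^-1 ^+ J.+1 = (1 - 2^-1 ^+ J) + 2^-1 ^+ J.+1 :> R.
    by rewrite exprS; move: (2^-1 ^+ J) => a; lra.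
  rewrite EFinD; apply: leeD => //.
  apply: le_trans (HK J (M J.+1) (M J) (leq_trans (MK J) (MS J)) (MK J)).
  by apply: nrm_le => //; [exact: measurable_funB|move=> x; rewrite normr_id].
have NS1 J : (N (S J) <= 1%:E)%E.
  by apply: le_trans (NS J) _; rewrite lee_fin gerBl exprn_ge0.
have Spos J x : 0 <= S J x by rewrite sumr_ge0// => j _; exact: normr_ge0.
pose F J x := (`|S J x| `^ p)%:E.
have mF J : measurable_fun setT (F J) by exact: measurable_abs_powR.
have F0 J x : setT x -> (0 <= F J x)%E by rewrite lee_fin powR_ge0.
pose h x := limn_einf (F^~ x).
have h_ge0 x : (0 <= h x)%E by apply: limn_einf_ge; exists 0%N => j _; exact: F0.
have Ih : m.-integrable setT h.
  apply/integrableP; split; first exact: measurable_limn_einf.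
  under eq_integral do rewrite gee0_abs//.
  apply: (@le_lt_trans _ _ (1 `^ p)%:E); last exact: ltry.
  apply: (le_trans (fatou m measurableT mF F0)); apply: limn_einf_le.
  by exists 0%N => J _; move: (NS1 J); rewrite nrm_le_pow.
pose g x := fine (limn_esup (fun j => (w j x)%:E)).
have mg : measurable_fun setT g.
  apply: (@measurableT_comp _ _ _ _ _ _ (@fine R)); first exact: fine_measurable.
  by apply: measurable_fun_limn_esup => j; exact/measurable_EFinP.
have wg : {ae m, forall x, w j x @[j --> \oo] --> g x}.
  have := integrable_ae measurableT Ih; apply: filterS => x /(_ I) hfin.
  have SJ J : (F J x <= h x)%E.
    apply: limn_einf_ge; exists J => j Jj; rewrite lee_fin; apply: ler_powR_base => //.
    rewrite !ger0_norm ?Spos// /S [leRHS](big_cat_nat (n := J))//= lerDl.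
    by rewrite sumr_ge0// => i _; exact: normr_ge0.
  have cS : cvgn (S^~ x).
    apply: nondecreasing_is_cvgn.
      move=> a b ab; rewrite /S [leRHS](big_cat_nat (n := a))//= lerDl.
      by rewrite sumr_ge0// => i _; exact: normr_ge0.
    exists ((fine (h x)) `^ p^-1) => _ [J _ <-].
    have -> : S J x = (`|S J x| `^ p) `^ p^-1.
      by rewrite ger0_norm// -powRrM mulfV ?gt_eqF// powRr1.
    have pV : 0 <= p^-1 by rewrite invr_ge0 ltW.
    apply: ge0_ler_powR => //; rewrite ?nnegrE ?powR_ge0 ?fine_ge0//.
    by rewrite -lee_fin fineK//; exact: SJ.
  have cw : cvgn (w^~ x).
    have := normed_cvg (u_ := telescope (w^~ x)) cS.
    rewrite telescopeK => c1.
    have -> : w^~ x = (fun j => (w j x - w 0%N x) + w 0%N x) by apply/funext => j; rewrite subrK.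
    by apply: is_cvgD => //; exact: is_cvg_cst.
  have /cvg_ex[l wl] := cw.
  have H : (w j x)%:E @[j --> \oo] --> l%:E by apply: cvg_EFin; [exact: nearW|].
  by rewrite /g; have [_ ->] := cvg_limn_einf_sup H.
have lim (e : R) : 0 < e -> exists K', forall k, (K' <= k)%N -> (N (u k - g)%R <= e%:E)%E.
  move=> e0; have [K' HK'] := cu e e0; exists K' => k Kk.
  apply: (@nrm_fatou (fun j => u k - w j)) => //; last 2 first.
  - exists K' => j Kj; apply: HK' => //; exact: leq_trans Kj (Mj j).
  - move: wg; apply: filterS => x wx; change (u k x - w j x @[j --> \oo] --> u k x - g x).
    by apply: cvgB => //; exact: cvg_cst.
  - by move=> j; exact: measurable_funB.
  - exact: measurable_funB.
  - exact: ltW.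
exists g; split => //.
have [K' HK'] := lim 1 ltr01.
have -> : g = u K' + - (u K' - g) by rewrite opprB addrC subrK.
have mug : measurable_fun setT (u K' - g) by exact: measurable_funB.
apply: (le_lt_trans (nrmD m p1 (mu K') (measurable_funN mug))); rewrite nrmN.
by rewrite lte_add_pinfty//; apply: le_lt_trans (HK' K' (leqnn _)) _; exact: ltry.
Qed.

End Lp_complete.

Section seminormed_quotient.
Variables (R : realType) (F : lmodType R) (W : set F) (N : F -> R).
Hypothesis W0 : W 0.
Hypothesis WZD : forall (c : R) u v, W u -> W v -> W (c *: u + v).
Hypothesis ND : forall u v, W u -> W v -> N (u + v) <= N u + N v.
Hypothesis NZ : forall (c : R) u, W u -> N (c *: u) = `|c| * N u.
Hypothesis N_complete : forall u : nat -> F, (forall k, W (u k)) ->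
  (forall e : R, 0 < e -> exists K, forall k l, (K <= k)%N -> (K <= l)%N -> N (u k - u l) <= e) ->
  exists2 v, W v & forall e : R, 0 < e -> exists K, forall k, (K <= k)%N -> N (u k - v) <= e.
Implicit Types (u v w : F) (c : R).

Let WD u v : W u -> W v -> W (u + v).
Proof. by move=> Wu Wv; rewrite -[u]scale1r; exact: WZD. Qed.

Let WZ c u : W u -> W (c *: u).
Proof. by move=> Wu; rewrite -[c *: u]addr0; exact: WZD. Qed.

Let WN u : W u -> W (- u).
Proof. by move=> Wu; rewrite -scaleN1r; exact: WZ. Qed.

Let WB u v : W u -> W v -> W (u - v).
Proof. by move=> Wu Wv; apply: WD => //; exact: WN. Qed.

Let NN u : W u -> N (- u) = N u.
Proof. by move=> Wu; rewrite -scaleN1r NZ// normrN1 mul1r. Qed.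

Let N0 : N 0 = 0.
Proof. by rewrite -(scale0r 0) NZ// normr0 mul0r. Qed.

Let N_ge0 u : W u -> 0 <= N u.
Proof.
move=> Wu; have := ND Wu (WN Wu); rewrite subrr N0 (NN Wu).
by move: (N u) => a; lra.
Qed.

Let NBC u v : W u -> W v -> N (u - v) = N (v - u).
Proof. by move=> Wu Wv; rewrite -opprB NN//; exact: WB. Qed.

Let N_trans u v w : W u -> W v -> W w -> N (u - w) <= N (u - v) + N (v - w).
Proof.
by move=> Wu Wv Ww; have := ND (WB Wu Wv) (WB Wv Ww); rewrite addrA subrK.
Qed.

Let N_eq u v : W u -> W v -> N (u - v) = 0 -> N u = N v.
Proof.
move=> Wu Wv uv; apply/eqP; rewrite eq_le; apply/andP; split.
  by have := ND (WB Wu Wv) Wv; rewrite subrK uv add0r.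
by have := ND (WB Wv Wu) Wu; rewrite subrK (NBC Wv Wu) uv add0r.
Qed.

(* The quotient is realized by canonical representatives of the classes. *)
Let rep u : F := xget 0 [set w | W w /\ N (w - u) = 0].

Let repP u : W u -> W (rep u) /\ N (rep u - u) = 0.
Proof.
move=> Wu; apply: (@xgetPex _ 0 [set w | W w /\ N (w - u) = 0]).
by exists u; split; rewrite ?subrr.
Qed.

Let rep_eq u v : W u -> W v -> N (u - v) = 0 -> rep u = rep v.
Proof.
move=> Wu Wv uv; rewrite /rep; congr xget; apply/seteqP.
have H a b x : W a -> W b -> N (a - b) = 0 -> W x -> N (x - a) = 0 -> N (x - b) = 0.
  move=> Wa Wb ab Wx xa; apply/eqP; rewrite eq_le N_ge0 ?andbT; last exact: WB.
  by apply: le_trans (N_trans Wx Wa Wb) _; rewrite xa ab addr0.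
split => x [Wx xu]; split => //; first exact: H uv Wx xu.
by apply: (H v u) => //; rewrite NBC.
Qed.

Let rep_rep u : W u -> rep (rep u) = rep u.
Proof. by move=> Wu; have [Wr rN] := repP Wu; exact: rep_eq. Qed.

Definition seminormed_quotient := {u : F | `[< W u /\ rep u = u >]}.
Local Notation E := seminormed_quotient.
HB.instance Definition _ := Choice.on E.

Let cls_sub u : `[< W (if `[< W u >] then rep u else rep 0) /\
  rep (if `[< W u >] then rep u else rep 0) = (if `[< W u >] then rep u else rep 0) >].
Proof.
apply/asboolP; case: asboolP => [Wu|_]; last by have [? _] := repP W0; rewrite rep_rep.
by have [? _] := repP Wu; rewrite rep_rep.
Qed.

Definition class_of u : E := exist (fun u : F => `[< W u /\ rep u = u >]) _ (cls_sub u).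

Let WE (a : E) : W (val a).
Proof. by case: a => u /= /asboolP[]. Qed.

Let val_class u : W u -> val (class_of u) = rep u.
Proof. by move=> Wu /=; rewrite asboolT. Qed.

Let classK (a : E) : class_of (val a) = a.
Proof. by apply: val_inj; rewrite val_class//; case: a => u /= /asboolP[]. Qed.

Let classN u : W u -> N (val (class_of u) - u) = 0.
Proof. by move=> Wu; rewrite val_class//; have [] := repP Wu. Qed.

Let class_eq u v : W u -> W v -> N (u - v) = 0 -> class_of u = class_of v.
Proof. by move=> Wu Wv uv; apply: val_inj; rewrite !val_class//; exact: rep_eq. Qed.

Let eq_class u v : W u -> W v -> class_of u = class_of v -> N (u - v) = 0.
Proof.
move=> Wu Wv uv; apply/eqP; rewrite eq_le N_ge0 ?andbT; last exact: WB.
apply: le_trans (N_trans Wu (WE (class_of u)) Wv) _.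
by rewrite (NBC Wu (WE _)) classN// add0r uv classN.
Qed.

Let zero : E := class_of 0.
Let opp (a : E) : E := class_of (- val a).
Let add (a b : E) : E := class_of (val a + val b).
Let scale c (a : E) : E := class_of (c *: val a).
Let norm (a : E) : R := N (val a).

Let addl u v : W u -> W v -> class_of (val (class_of u) + v) = class_of (u + v).
Proof.
move=> Wu Wv; have Wc := WE (class_of u); apply: class_eq; try exact: WD.
by rewrite opprD addrACA subrr addr0 classN.
Qed.

Let addr u v : W u -> W v -> class_of (u + val (class_of v)) = class_of (u + v).
Proof. by move=> Wu Wv; rewrite addrC addl// addrC. Qed.

Let scalec c u : W u -> class_of (c *: val (class_of u)) = class_of (c *: u).
Proof.
move=> Wu; have Wc := WE (class_of u); apply: class_eq; try exact: WZ.
by rewrite -scalerBr NZ ?classN ?mulr0//; exact: WB.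
Qed.

Let addA : associative add.
Proof.
move=> a b c; rewrite /add addr ?addl ?addrA//; try exact: WE.
  by apply: WD; exact: WE.
by apply: WD; exact: WE.
Qed.

Let addC : commutative add.
Proof. by move=> a b; rewrite /add addrC. Qed.

Let add0 : left_id zero add.
Proof. by move=> a; rewrite /add /zero addl ?add0r ?classK//; exact: WE. Qed.

Let addN : left_inverse zero opp add.
Proof. by move=> a; rewrite /add /opp addl ?addNr//; apply: WN; exact: WE. Qed.

HB.instance Definition _ := GRing.isZmodule.Build E addA addC add0 addN.

Let scaleA b c (a : E) : scale b (scale c a) = scale (b * c) a.
Proof. by rewrite /scale scalec ?scalerA//; apply: WZ; exact: WE. Qed.

Let scale1 : left_id 1 scale.
Proof. by move=> a; rewrite /scale scale1r classK. Qed.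

Let scaleDr : right_distributive scale +%R.
Proof.
move=> c a b; have Wa := WE a; have Wb := WE b.
change (class_of (c *: val (class_of (val a + val b))) =
  class_of (val (class_of (c *: val a)) + val (class_of (c *: val b)))).
by rewrite scalec ?addl ?addr ?scalerDr//; try exact: WZ; try exact: WD; exact: WE.
Qed.

Let scaleDl (a : E) : {morph scale^~ a : b c / b + c}.
Proof.
move=> b c; have Wa := WE a.
change (class_of ((b + c) *: val a) =
  class_of (val (class_of (b *: val a)) + val (class_of (c *: val a)))).
by rewrite addl ?addr ?scalerDl//; try exact: WZ; exact: WE.
Qed.

HB.instance Definition _ := GRing.Zmodule_isLmodule.Build R E scaleA scale1 scaleDr scaleDl.

Let norm_class u : W u -> norm (class_of u) = N u.
Proof. by move=> Wu; apply: N_eq => //; exact: classN. Qed.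

Let ler_norm_add (a b : E) : norm (a + b) <= norm a + norm b.
Proof.
rewrite -[norm (a + b)]/(norm (class_of (val a + val b))) norm_class; last first.
  by apply: WD; exact: WE.
by apply: ND; exact: WE.
Qed.

Let norm_scale c (a : E) : norm (c *: a) = `|c| * norm a.
Proof.
rewrite -[norm (c *: a)]/(norm (class_of (c *: val a))) norm_class; last by apply: WZ; exact: WE.
by rewrite NZ//; exact: WE.
Qed.

Let norm_eq0 (a : E) : norm a = 0 -> a = 0.
Proof.
by move=> a0; rewrite -[a]classK; apply: class_eq => //; rewrite subr0.
Qed.

HB.instance Definition _ := @Lmodule_isNormed.Build R E norm ler_norm_add norm_scale norm_eq0.

Let normE (a b : E) : `|a - b| = N (val a - val b).
Proof.
have -> : a - b = class_of (val a - val b).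
  change (class_of (val a + val (class_of (- val b))) = class_of (val a - val b)).
  by rewrite addr//; exact: WN.
by rewrite -[LHS]/(norm _) norm_class//; apply: WB; exact: WE.
Qed.

Let complete (G : set_system E) : ProperFilter G -> cauchy G -> cvg G.
Proof.
move=> FG /cauchyP cG.
have i0 (k : nat) : (0 : R) < k.+1%:R^-1 by rewrite invr_gt0.
have small (d : R) : 0 < d -> exists K, forall k, (K <= k)%N -> k.+1%:R^-1 < d.
  move=> d0; have [K] := ltr_add_invr d0; rewrite add0r => HK; exists K => k Kk.
  by apply: le_lt_trans HK; rewrite lef_pV2 ?posrE// ler_nat ltnS.
have /choice[x Hx] : forall k : nat, exists x : E, G (ball x k.+1%:R^-1).
  by move=> k; exact: cG _ (i0 k).
have cx (d : R) : 0 < d -> exists K, forall k l, (K <= k)%N -> (K <= l)%N ->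
    N (val (x k) - val (x l)) <= d.
  move=> d0; have [K HK] := small _ (divr_gt0 d0 (ltr0Sn R 1)).
  exists K => k l /HK kd /HK ld; rewrite -normE.
  have [z []] := filter_ex (filterI (Hx k) (Hx l)).
  rewrite -!ball_normE /ball_/= => xz yz.
  have := ler_distD z (x k) (x l); rewrite [ `|z - x l|]distrC.
  move=> H; apply: (le_trans H); apply/ltW; rewrite (splitr d); apply: ltrD.
    exact: lt_trans xz kd.
  exact: lt_trans yz ld.
have [v Wv Hv] := N_complete (fun k => WE (x k)) cx.
apply/cvg_ex; exists (class_of v); apply/cvg_ballP => d d0.
have [K1 HK1] := small _ (divr_gt0 d0 (ltr0Sn R 1)).
have [K2 HK2] := Hv _ (divr_gt0 d0 (ltr0Sn R 1)).
pose k := maxn K1 K2.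
apply: filterS (Hx k) => y; rewrite -!ball_normE /ball_/= => xy.
have := ler_distD (x k) (class_of v) y.
have vx : `|class_of v - x k| <= d / 2.
  rewrite normE; apply: le_trans (N_trans (WE _) Wv (WE _)) _.
  by rewrite classN// add0r NBC//; apply: HK2; exact: leq_maxr.
move=> H; apply: (le_lt_trans H); rewrite (splitr d); apply: ler_ltD vx _.
exact: lt_trans xy (HK1 k (leq_maxl _ _)).
Qed.

HB.instance Definition _ := Uniform_isComplete.Build E complete.

Lemma banach_quotient : exists (B : completeNormedModType R) (cls : F -> B),
  [/\ forall c u v, W u -> W v -> cls (c *: u + v) = c *: cls u + cls v,
      forall b, exists2 u, W u & cls u = b,
      forall u v, W u -> W v -> (cls u = cls v <-> N (u - v) = 0) &
      forall u, W u -> N u = `|cls u|].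
Proof.
exists E, class_of; split.
- move=> c u v Wu Wv.
  change (class_of (c *: u + v) =
    class_of (val (class_of (c *: val (class_of u))) + val (class_of v))).
  by rewrite scalec// addl ?addr//; exact: WZ.
- by move=> b; exists (val b); [exact: WE|exact: classK].
- by move=> u v Wu Wv; split; [exact: eq_class|exact: class_eq].
by move=> u Wu; rewrite -[RHS]/(norm _) norm_class.
Qed.

End seminormed_quotient.

Section banach.
Context {R : realType} {n : nat}.
Local Notation V := 'rV[R]_n.
Local Notation mu := (lebesgue_rV R n).
Implicit Types (f g phi psi u v w : V -> R) (x y z : V).
Variables (k : nat) (p : R) (Omega : set V).
Hypotheses (p_gt1 : 1 < p) (oO : open Omega).
Hypothesis ae_ext : {ae mu, forall x, ~ Omega x -> (~` Omega)° x}.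
Let p1 : 1 <= p. Proof. exact: ltW. Qed.
Let mO : measurable Omega. Proof. exact: open_measurable_rV. Qed.
Local Notation N := (nrm mu p).
Local Notation Lpf := (Lpf p).
Local Notation index := {ffun 'I_n -> 'I_k.+1}.
Implicit Types (a : index) (G H : index -> V -> R).
Local Notation trep := (@trep R n k p Omega).
Local Notation W := (sobolev_tilde k p Omega).
Let nm u : R := fine (sobolev_norm k p Omega u).

Let WP u : W u <-> exists G, trep u G.
Proof. exact: sobolev_tildeP. Qed.

Lemma trep_norm_fin u G : trep u G -> sobolev_norm k p Omega u \is a fin_num.
Proof.
move=> tu; have [-> _] := trep_norm p_gt1 oO tu; have [_ HG] := tu.
apply/sum_fin_numP => a _ ak; have [[_ Na] _ _] := HG a ak.
by rewrite ge0_fin_numE// nrm_ge0.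
Qed.

Let nmE u : W u -> sobolev_norm k p Omega u = (nm u)%:E.
Proof. by move=> /WP[G tu]; rewrite fineK//; exact: trep_norm_fin tu. Qed.

Let trepB u v G H : trep u G -> trep v H -> trep (u - v) (fun a => G a - H a).
Proof.
move=> tu tv; have := trep_lin p_gt1 (-1) tv tu.
rewrite scaleN1r addrC (_ : (fun a => _) = fun a => G a - H a)//.
by apply/funext => a; rewrite scaleN1r addrC.
Qed.

Let W0 : W 0.
Proof.
have L0 : Lpf (0 : V -> R) by split; [exact: measurable_cst|rewrite nrm0].
have E0 : (0 : V -> R) \_ Omega = 0.
  by apply/funext => x; rewrite patch_rE; case: ifP.
apply/WP; exists (fun=> 0); split; rewrite ?E0// => a ak; split => // psi tpsi.
have E1 chi : \int[mu]_x ((0 : V -> R) x * chi x) = 0.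
  rewrite (_ : (fun x => _) = cst 0) ?Rintegral_cst ?mul0r//.
  by apply/funext => x /=; rewrite mul0r.
by rewrite !E1 mulr0.
Qed.

Let WZD (c : R) u v : W u -> W v -> W (c *: u + v).
Proof.
move=> /WP[G tu] /WP[H tv]; apply/WP; exists (fun a => c *: G a + H a).
exact: trep_lin.
Qed.

Let WB u v : W u -> W v -> W (u - v).
Proof. by move=> Wu Wv; rewrite addrC -scaleN1r; exact: WZD. Qed.

Let nmD u v : W u -> W v -> nm (u + v) <= nm u + nm v.
Proof.
move=> Wu Wv; have Wuv : W (u + v) by rewrite -[u]scale1r; exact: WZD.
rewrite -lee_fin EFinD -!nmE//; have [G tu] := (WP u).1 Wu; have [H tv] := (WP v).1 Wv.
have tuv := trep_lin p_gt1 1 tu tv; rewrite scale1r in tuv.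
have [-> _] := trep_norm p_gt1 oO tuv; have [-> _] := trep_norm p_gt1 oO tu.
have [-> _] := trep_norm p_gt1 oO tv.
rewrite -big_split/=; apply: lee_sum => a ak; rewrite scale1r.
have [_ /(_ a ak)[[mG _] _ _]] := tu; have [_ /(_ a ak)[[mH _] _ _]] := tv.
exact: nrmD.
Qed.

Let nmZ (c : R) u : W u -> nm (c *: u) = `|c| * nm u.
Proof.
move=> Wu; have Wcu : W (c *: u) by rewrite -[c *: u]addr0; exact: WZD.
have [G tu] := (WP u).1 Wu; have [H t0] := (WP 0).1 W0.
have tcu : trep (c *: u) (fun a => c *: G a).
  have := trep_lin p_gt1 c tu (trepB t0 t0).
  rewrite subrr addr0 (_ : (fun a => _) = fun a => c *: G a)//.
  by apply/funext => a; rewrite subrr addr0.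
apply: EFin_inj; rewrite EFinM -!nmE//.
have [-> _] := trep_norm p_gt1 oO tcu; have [-> _] := trep_norm p_gt1 oO tu.
rewrite ge0_sume_distrr; last by move=> a _; exact: nrm_ge0.
apply: eq_bigr => a ak; have [_ /(_ a ak)[[mG _] _ _]] := tu.
by rewrite nrmZ.
Qed.

Let nrm_le_nm u : W u -> (N (u \_ Omega) <= (nm u)%:E)%E.
Proof.
move=> Wu; rewrite -nmE//; have [[lu _] _] := Wu.
rewrite -(Lpnorm_weak_deriv p1 oO (is_weak_deriv0 k lu)).
by apply: sobolev_norm_ge; rewrite mi_deg0.
Qed.

Let patchB u v : (u - v) \_ Omega = u \_ Omega - v \_ Omega.
Proof. by rewrite -scaleN1r patchD patchZ scaleN1r. Qed.

Let nm_eq0 u v : W u -> W v ->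
  (nm (u - v) = 0 <-> {ae mu, forall x, Omega x -> u x = v x}).
Proof.
move=> Wu Wv; have Wuv := WB Wu Wv.
have [lw _] := Wuv.1; have mw : measurable_fun setT ((u - v) \_ Omega).
  by apply: measurable_restrict_fun => //; case: lw.
split=> [w0|uv].
  have : {ae mu, forall x, ((u - v) \_ Omega) x = 0}.
    apply: (nrm_eq0 p1) => // e e0; apply: le_trans (nrm_le_nm Wuv) _.
    by rewrite w0 lee_fin ltW.
  apply: filterS => x + xO; rewrite patch_rE mem_set// => H.
  by apply/eqP; rewrite -subr_eq0; exact/eqP.
have w0 : {ae mu, forall x, ((u - v) \_ Omega) x = (cst 0 : V -> R) x}.
  move: uv; apply: filterS => x H; rewrite patch_rE; case: ifPn => // /set_mem /H E.
  by rewrite !fctE E subrr.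
apply: EFin_inj; rewrite -nmE// /sobolev_norm big1// => a _.
have L0 : Lpf (0 : V -> R) by split; [exact: measurable_cst|rewrite nrm0].
have E0 : (0 : V -> R) \_ Omega = 0.
  by apply/funext => x; rewrite patch_rE; case: ifP.
rewrite (@Lpnorm_weak_deriv _ _ _ _ _ _ 0)// ?E0 ?nrm0//.
apply: weak_rep_deriv => //; rewrite E0; first exact: (Lpf_lint p1 L0).
move=> psi tpsi; have [sps _] := Ctest_partials (mi_seq (mi a)) tpsi.
have E1 chi : \int[mu]_x ((cst 0 : V -> R) x * chi x) = 0.
  rewrite (_ : (fun x => _) = cst 0) ?Rintegral_cst ?mul0r//.
  by apply/funext => x /=; rewrite mul0r.
rewrite (ae_eq_Rintegral_test mw _ (Csmooth_measurable sps) w0)// E1.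
by rewrite -[X in _ * X]/(\int[mu]_x ((cst 0 : V -> R) x * psi x)) E1 mulr0.
Qed.

Let nm_complete (u : nat -> V -> R) : (forall j, W (u j)) ->
  (forall e : R, 0 < e -> exists K, forall i j, (K <= i)%N -> (K <= j)%N -> nm (u i - u j) <= e) ->
  exists2 v, W v & forall e : R, 0 < e -> exists K, forall j, (K <= j)%N -> nm (u j - v) <= e.
Proof.
move=> Wu cu; have /choice[G tG] := fun j => (WP (u j)).1 (Wu j).
pose ut j := u j \_ Omega.
have Lut j : Lpf (ut j) by have [] := tG j.
have [f [mf Nf Hf]] : exists f, [/\ measurable_fun setT f, (N f < +oo)%E &
    forall e : R, 0 < e -> exists K, forall j, (K <= j)%N -> (N (ut j - f)%R <= e%:E)%E].
  apply: Lp_complete => //; try by move=> j; have [] := Lut j.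
  move=> e e0; have [K HK] := cu e e0; exists K => i j Ki Kj.
  rewrite /ut -patchB; apply: le_trans (nrm_le_nm (WB (Wu i) (Wu j))) _.
  by rewrite lee_fin; exact: HK.
have /choice[g Hg] : forall a, exists g, (mi_deg (mi a) <= k)%N -> Lpf g /\
    forall e : R, 0 < e -> exists K, forall j, (K <= j)%N -> (N (G j a - g)%R <= e%:E)%E.
  move=> a; have [ak|ak] := boolP (mi_deg (mi a) <= k)%N; last by exists 0.
  have LG j : Lpf (G j a) by have [_ /(_ a ak)[]] := tG j.
  have [|||g [mg Ng Hg]] := @Lp_complete _ _ _ mu p p1 (fun j => G j a); last by exists g.
  - by move=> j; have [] := LG j.
  - by move=> j; have [] := LG j.
  move=> e e0; have [K HK] := cu e e0; exists K => i j Ki Kj.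
  apply: le_trans (_ : (nm (u i - u j))%:E <= e%:E)%E; last by rewrite lee_fin; exact: HK.
  rewrite -nmE; last exact: WB.
  have [-> _] := trep_norm p_gt1 oO (trepB (tG i) (tG j)).
  by rewrite (bigD1 a)//= leeDl// sume_ge0// => b _; exact: nrm_ge0.
have patch2 w : (w \_ Omega) \_ Omega = w \_ Omega.
  exact/patch_vanish/patch_vanish_off.
have close w (h : V -> R) (e : R) : vanish_off Omega w -> measurable_fun setT w -> measurable_fun setT h ->
    (N (w - h)%R <= e%:E)%E -> (N (w - h \_ Omega)%R <= e%:E)%E.
  move=> vw mw mh H; rewrite -(patch_vanish vw) -patchB; apply: le_trans H.
  by apply: nrm_patch => //; exact: measurable_funB.
have sym w (h : V -> R) (e : R) : (N (w - h)%R <= e%:E)%E -> (N (h - w)%R <= e%:E)%E.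
  by rewrite -nrmN opprB.
pose v := f \_ Omega.
have tv : trep v (fun a => g a \_ Omega).
  have Lf : Lpf (f \_ Omega) by apply: Lpf_patch.
  split; first by rewrite /v patch2.
  move=> a ak; have [Lg Hga] := Hg a ak; have LgO := Lpf_patch p_gt1 oO Lg.
  split => //; first exact: patch_vanish_off.
  rewrite /v patch2; apply: (weak_rep_lim p_gt1 Lf LgO) => e e0.
  have [K1 HK1] := Hf e e0; have [K2 HK2] := Hga e e0.
  pose j := maxn K1 K2; have [Lj /(_ a ak)[LGj vGj wj]] := tG j.
  exists (ut j), (G j a); split => //; apply: sym; apply: close => //.
  - exact: patch_vanish_off.
  - by have [] := Lut j.
  - by apply: HK1; exact: leq_maxl.
  - by have [] := LGj.
  - by have [] := Lg.
  - by apply: HK2; exact: leq_maxr.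
exists v; first by apply/WP; exists (fun a => g a \_ Omega).
move=> e e0; pose q : R := #|{: index}|%:R + 1; have q0 : 0 < q by rewrite ltr_wpDl.
have eq0 : 0 < e / q by rewrite divr_gt0.
have /choice[K HK] : forall a, exists K, (mi_deg (mi a) <= k)%N -> forall j, (K <= j)%N ->
    (N (G j a - g a \_ Omega)%R <= (e / q)%:E)%E.
  move=> a; have [ak|ak] := boolP (mi_deg (mi a) <= k)%N; last by exists 0%N.
  have [Lg /(_ _ eq0)[K HK]] := Hg a ak; exists K => _ j Kj.
  have [_ /(_ a ak)[[mGj _] vGj _]] := tG j.
  by apply: close => //; [have [] := Lg|exact: HK].
exists (\sum_a K a)%N => j Kj; have Wv : W v by apply/WP; exists (fun a => g a \_ Omega).
rewrite -lee_fin -nmE; last exact: WB.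
have [-> _] := trep_norm p_gt1 oO (trepB (tG j) tv).
apply: (@le_trans _ _ (\sum_(a : index) (e / q)%:E)%E).
  rewrite big_mkcond/=; apply: lee_sum => a _; case: ifPn => [ak|_]; last by rewrite lee_fin ltW.
  by apply: HK => //; apply: leq_trans Kj; rewrite (bigD1 a)//= leq_addr.
rewrite sumEFin sumr_const lee_fin -mulr_natl /q mulrA ler_pdivrMr// mulrC.
by rewrite ler_pM2l// cardT -cardE lerDl.
Qed.

Lemma sobolev_tilde_banach : is_banach Omega W (sobolev_norm k p Omega).
Proof.
split => //.
have [B [cls [clsl surj eqc ncls]]] := banach_quotient W0 WZD nmD nmZ nm_complete.
exists B, cls; split => //.
- by move=> u v Wu Wv; rewrite eqc//; exact: nm_eq0.
by move=> u Wu; rewrite nmE// ncls.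
Qed.

Lemma sobolev_tilde_isometry u v : W u -> W v ->
  sobolev_norm k p setT (u \_ Omega - v \_ Omega) = sobolev_norm k p Omega (u - v).
Proof.
move=> Wu Wv; have [G tw] := (WP _).1 (WB Wu Wv).
by rewrite -patchB; have [-> ->] := trep_norm p_gt1 oO tw.
Qed.

End banach.

Theorem theorem5p10 (R : realType) (n : nat) (hn : (2 <= n)%N)
    (Omega : set 'rV[R]_n)
    (Omega_open : open Omega) (Omega_neq0 : Omega !=set0)
    (Omega_proper : Omega != setT)
    (Omega_bd : boundary Omega = boundary (closure Omega))
    (eps : R) (eps_gt0 : 0 < eps) (delta : \bar R) (delta_gt0 : (0 < delta)%E)
    (Omega_ext : eps_delta_domain eps delta (~` Omega)°)
    (rad_gt0 : (0 < component_radius (~` Omega)°)%E)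
    (k : nat) (p : R) (p_gt1 : 1 < p) :
  [/\ sobolev_tilde k p Omega = sobolev_circ k p Omega,
      is_banach Omega (sobolev_tilde k p Omega) (sobolev_norm k p Omega),
      (forall u, sobolev_tilde k p Omega u -> sobolev k p setT (u \_ Omega)) /\
      (forall u v, sobolev_tilde k p Omega u -> sobolev_tilde k p Omega v ->
        sobolev_norm k p setT (u \_ Omega - v \_ Omega) =
        sobolev_norm k p Omega (u - v)) &
      sobolev_tilde k p Omega =
        [set u : 'rV[R]_n -> R | exists v, [/\ sobolev k p setT v,
                               ess_support v `<=` closure Omega &
                               {in Omega, u =1 v}]] ].
Proof.
pose U := (~` Omega)°.
have oU : open U by exact: open_interior.
have UE : U = ~` closure Omega by exact: interiorC.
have OU : ~` Omega `<=` closure U.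
  move=> x xO; have [xc|xc] := pselect (closure Omega x); last first.
    by apply: subset_closure; rewrite UE.
  have [_] : boundary (closure Omega) x.
    by rewrite -Omega_bd; split => // /interior_subset.
  by move=> xi; rewrite UE closure_setC.
have UO x : closure U x -> ~ Omega x.
  move=> xU xO; have [y [Uy Oy]] := xU _ (open_nbhs_nbhs (conj Omega_open xO)).
  exact: interior_subset Uy Oy.
have [c [r0 [c0 r00 Hc]]] := corkscrew_ball eps_gt0 delta_gt0 Omega_ext rad_gt0.
have [C [K [C0 cU]]] := corkscrew_grid c0 Hc.
have ae_ext : {ae lebesgue_rV R n, forall x, ~ Omega x -> U x}.
  have := corkscrew_null C0 r00 oU cU.
  by apply: filterS => x H /OU; exact: H.
split.
- apply/seteqP; split => u.
    move=> /(@sobolev_tildeP _ _ k p _ p_gt1 Omega_open ae_ext)[G tu].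
    exact: trep_circ C0 r00 oU cU OU UO tu.
  move=> /(@sobolev_circ_trep _ _ k p _ p_gt1 Omega_open)[G tu].
  exact: trep_sobolev tu.
- exact: sobolev_tilde_banach.
- split; first by move=> u [].
  exact: sobolev_tilde_isometry.
exact: sobolev_tilde_support.
Qed.
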